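(* Let $M(f,\xi_i,\eta^i,g)$ be a metric $f$-$K$-contact manifold (with $s$ characteristic vector fields $\xi_1,\dots,\xi_s$), let $\mathcal D_1$ be spanned by the vector fields $\xi_1,\dots,\xi_m$ for some $m<s$ and let $\mathcal D_2$ be spanned by $\xi_{m+1},\dots,\xi_s$. Then $g$ is critical for the action $J_{\mathcal D_1,\mathcal D_2}$ with respect to all variations preserving orthogonality of $\mathcal D_1$ and $\mathcal D_2$.
   Context: Framed $f$-structure: on a smooth manifold $M^{2n+s}$ there are linearly independent vector fields $\xi_1,\dots,\xi_s$, one-forms $\eta^1,\dots,\eta^s$ with $\eta^i(\xi_j)=\delta^i_j$, and a $(1,1)$-tensor $f$ of constant rank $2n$ with $f^2=-\mathrm{id}+\sum_i\eta^i\otimes\xi_i$ (then $f\xi_i=0$, $\eta^i\circ f=0$). If $g$ is a Riemannian metric with $g(fX,fY)=g(X,Y)-\sum_i\eta^i(X)\eta^i(Y)$ and $g(\xi_i,\xi_j)=\delta_{ij}$, then $M(f,\xi_i,\eta^i,g)$ is a metric $f$-manifold. With $\Phi(X,Y)=g(X,fY)$, it is a metric $f$-contact manifold if $d\eta^i=\Phi$ for all $i\le s$; it is a metric $f$-$K$-contact manifold if moreover all $\xi_i$ are Killing vector fields. For orthogonal distributions $\mathcal D_1,\mathcal D_2$ on a Riemannian manifold $(M,g)$, $\dim M>2$, with local orthonormal frames $\{E_a\}$ and $\{\mathcal E_i\}$, the mutual curvature is $S_{\mathcal D_1,\mathcal D_2}=\sum_{a,i}g(R(E_a,\mathcal E_i)\mathcal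 E_i,E_a)$ (sum of sectional curvatures of the planes $E_a\wedge\mathcal E_i$). The action is $J_{\mathcal D_1,\mathcal D_2}(g)=\int_MS_{\mathcal D_1,\mathcal D_2}\,d\mathrm{vol}_g$, on metrics making $\mathcal D_1,\mathcal D_2$ orthogonal; if $M$ is non-compact one integrates over an arbitrary relatively compact domain $\Omega$ containing the support of the variation. A variation is a smooth family $g_t$, $|t|<\varepsilon$, of Riemannian metrics with $g_0=g$, $g_t=g$ outside $\Omega$. $g$ is critical with respect to a class of variations if $\frac{d}{dt}J_{\mathcal D_1,\mathcal D_2}(g_t)|_{t=0}=0$ for all variations in the class. *)

(* Defs.v *)
From HB Require Import structures.
From mathcomp Require Import all_boot all_order all_algebra.
From mathcomp Require Import all_classical all_reals all_analysis.

Set Implicit Arguments.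
Unset Strict Implicit.
Unset Printing Implicit Defensive.

Import Order.TTheory GRing.Theory Num.Theory.
Import numFieldNormedType.Exports.

Local Open Scope classical_set_scope.
Local Open Scope ring_scope.

(* For finite-dimensional V: f is of class C^k (resp. C^oo) on the open set A. *)
Fixpoint Ck_on (R : realType) (V W : normedModType R) (k : nat)
    (A : set V) (f : V -> W) : Prop :=
  if k is k'.+1 then
    (forall x, A x -> differentiable f x) /\
    (forall v, Ck_on k' A (fun x => 'D_v f x))
  else forall x, A x -> {for x, continuous f}.

Definition smooth_on (R : realType) (V W : normedModType R)
    (A : set V) (f : V -> W) : Prop := forall k, Ck_on k A f.

(* A manifold is nonempty (the carrier is pointed), Hausdorff and second
   countable; the atlas need not be maximal.  The value of [coord c] outside
   [dom c], and of [param c] outside [coord c @` dom c], is irrelevant. *)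
Record smooth_manifold (R : realType) (N : nat) := SmoothManifold {
  carrier :> ptopologicalType ;
  carrier_hausdorff : hausdorff_space carrier ;
  carrier_second_countable : @second_countable carrier ;
  chart : Type ;
  dom : chart -> set carrier ;
  coord : chart -> carrier -> 'rV[R]_N ;
  param : chart -> 'rV[R]_N -> carrier ;
  dom_open : forall c, open (dom c) ;
  dom_cover : forall p, exists c, dom c p ;
  img_open : forall c, open (coord c @` dom c) ;
  coordK : forall c p, dom c p -> param c (coord c p) = p ;
  coord_continuous : forall c p, dom c p -> {for p, continuous (coord c)} ;
  param_continuous : forall c x, (coord c @` dom c) x ->
    {for x, continuous (param c)} ;
  transition_smooth : forall c d,
    smooth_on (coord c @` (dom c `&` dom d)) (coord d \o param c) }.

Definition img (R : realType) N (M : smooth_manifold R N) (c : chart M) :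
  set 'rV[R]_N := coord c @` dom c.

Definition overlap (R : realType) N (M : smooth_manifold R N) (c d : chart M) :
  set 'rV[R]_N := coord c @` (dom c `&` dom d).

Definition transition (R : realType) N (M : smooth_manifold R N)
  (c d : chart M) : 'rV[R]_N -> 'rV[R]_N := coord d \o param c.

Definition chart_at (R : realType) N (M : smooth_manifold R N) (p : M) :
  chart M := projT1 (cid (dom_cover p)).

(* A tensor field is the family of its component functions in the charts, each a
   function of the coordinates x of the point, relevant only for x in [img c].
   Tangent vectors are row vectors v.  A one-form is a column: v |-> v *m a; a
   (1,1)-tensor is a square matrix acting on the right: v |-> v *m F; a bilinear
   form is a square matrix: (u, v) |-> u *m G *m v^T.  The last conjunct of each
   predicate below is the transformation law under a change of charts t, whose
   tangent map at x is v |-> 'D_v t x. *)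
Definition field (R : realType) N (M : smooth_manifold R N) (T : Type) :=
  chart M -> 'rV[R]_N -> T.

Definition pairing (R : realType) N (G : 'M[R]_N) (u v : 'rV[R]_N) : R :=
  (u *m G *m v^T) 0 0.

Definition is_vector_field (R : realType) N (M : smooth_manifold R N)
    (X : field M 'rV[R]_N) : Prop :=
  (forall c, smooth_on (img c) (X c)) /\
  (forall c d x, overlap c d x ->
     X d (transition c d x) = 'D_(X c x) (transition c d) x).

Definition is_one_form (R : realType) N (M : smooth_manifold R N)
    (a : field M 'cV[R]_N) : Prop :=
  (forall c, smooth_on (img c) (a c)) /\
  (forall c d x, overlap c d x -> forall v : 'rV[R]_N,
     v *m a c x = 'D_v (transition c d) x *m a d (transition c d x)).

Definition is_endomorphism_field (R : realType) N (M : smooth_manifold R N)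
    (F : field M 'M[R]_N) : Prop :=
  (forall c, smooth_on (img c) (F c)) /\
  (forall c d x, overlap c d x -> forall v : 'rV[R]_N,
     'D_(v *m F c x) (transition c d) x =
     'D_v (transition c d) x *m F d (transition c d x)).

Definition is_riemannian_metric (R : realType) N (M : smooth_manifold R N)
    (G : field M 'M[R]_N) : Prop :=
  [/\ forall c, smooth_on (img c) (G c),
      forall c x, img c x -> (G c x)^T = G c x,
      forall c x, img c x -> forall v, v != 0 -> 0 < pairing (G c x) v v
    & forall c d x, overlap c d x -> forall u v : 'rV[R]_N,
        pairing (G c x) u v =
        pairing (G d (transition c d x))
          ('D_u (transition c d) x) ('D_v (transition c d) x)].

(* da(X,Y) = (X(a(Y)) - Y(a(X)) - a([X,Y])) / 2, with the factor 1/2 customary in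
   contact metric geometry, on constant coordinate fields u, v. *)
Definition ext_deriv (R : realType) N (a : 'rV[R]_N -> 'cV[R]_N)
    (x u v : 'rV[R]_N) : R :=
  2^-1 * ((v *m 'D_u a x) 0 0 - (u *m 'D_v a x) 0 0).

(* (L_X g)(u,v), for a metric G and a vector field X on an open set of R^N. *)
Definition lie_metric (R : realType) N (X : 'rV[R]_N -> 'rV[R]_N)
    (G : 'rV[R]_N -> 'M[R]_N) (x u v : 'rV[R]_N) : R :=
  pairing ('D_(X x) G x) u v + pairing (G x) ('D_u X x) v
  + pairing (G x) u ('D_v X x).

Definition is_killing (R : realType) N (M : smooth_manifold R N)
    (G : field M 'M[R]_N) (X : field M 'rV[R]_N) : Prop :=
  forall c x, img c x -> forall u v, lie_metric (X c) (G c) x u v = 0.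

Definition framed_f_structure (R : realType) (n s : nat)
    (M : smooth_manifold R (n.*2 + s)) (f : field M 'M[R]_(n.*2 + s))
    (xi : 'I_s -> field M 'rV[R]_(n.*2 + s))
    (eta : 'I_s -> field M 'cV[R]_(n.*2 + s)) : Prop :=
  [/\ is_endomorphism_field f,
      forall i, is_vector_field (xi i),
      forall i, is_one_form (eta i)
    & forall c x, img c x ->
      [/\ row_free (\matrix_(i < s) xi i c x),
          forall i j, (xi j c x *m eta i c x) 0 0 = (i == j)%:R,
          \rank (f c x) = n.*2
        & f c x *m f c x =
          - 1%:M + \sum_(i < s) (eta i c x *m xi i c x)]].

Definition metric_f_manifold (R : realType) (n s : nat)
    (M : smooth_manifold R (n.*2 + s)) (f : field M 'M[R]_(n.*2 + s))
    (xi : 'I_s -> field M 'rV[R]_(n.*2 + s))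
    (eta : 'I_s -> field M 'cV[R]_(n.*2 + s))
    (g : field M 'M[R]_(n.*2 + s)) : Prop :=
  [/\ framed_f_structure f xi eta,
      is_riemannian_metric g,
      forall c x, img c x -> forall u v : 'rV[R]_(n.*2 + s),
        pairing (g c x) (u *m f c x) (v *m f c x) =
        pairing (g c x) u v
        - \sum_(i < s) (u *m eta i c x) 0 0 * (v *m eta i c x) 0 0
    & forall c x, img c x -> forall i j,
        pairing (g c x) (xi i c x) (xi j c x) = (i == j)%:R].

Definition metric_f_contact_manifold (R : realType) (n s : nat)
    (M : smooth_manifold R (n.*2 + s)) (f : field M 'M[R]_(n.*2 + s))
    (xi : 'I_s -> field M 'rV[R]_(n.*2 + s))
    (eta : 'I_s -> field M 'cV[R]_(n.*2 + s))
    (g : field M 'M[R]_(n.*2 + s)) : Prop :=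
  metric_f_manifold f xi eta g /\
  forall i c x, img c x -> forall u v,
    ext_deriv (eta i c) x u v = pairing (g c x) u (v *m f c x).

Definition metric_f_K_contact_manifold (R : realType) (n s : nat)
    (M : smooth_manifold R (n.*2 + s)) (f : field M 'M[R]_(n.*2 + s))
    (xi : 'I_s -> field M 'rV[R]_(n.*2 + s))
    (eta : 'I_s -> field M 'cV[R]_(n.*2 + s))
    (g : field M 'M[R]_(n.*2 + s)) : Prop :=
  metric_f_contact_manifold f xi eta g /\ forall i, is_killing g (xi i).

(* Levi-Civita derivative of the constant field v along u, for a metric G on an
   open set of R^N: 2 G(christoffel u v, w) = u G(v,w) + v G(u,w) - w G(u,v). *)
Definition christoffel (R : realType) N (G : 'rV[R]_N -> 'M[R]_N)
    (u v x : 'rV[R]_N) : 'rV[R]_N :=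
  2^-1 *: (\row_l (pairing ('D_u G x) v (delta_mx 0 l)
                   + pairing ('D_v G x) u (delta_mx 0 l)
                   - pairing ('D_(delta_mx 0 l) G x) u v) *m invmx (G x)).

(* R(u,v)w = nabla_u nabla_v w - nabla_v nabla_u w for constant u, v, w. *)
Definition curvature (R : realType) N (G : 'rV[R]_N -> 'M[R]_N)
    (x u v w : 'rV[R]_N) : 'rV[R]_N :=
  'D_u (christoffel G v w) x + christoffel G u (christoffel G v w x) x
  - 'D_v (christoffel G u w) x - christoffel G v (christoffel G u w x) x.

(* A distribution is the field of its fibres, each the row space of a matrix. *)
Definition span_distribution (R : realType) N (M : smooth_manifold R N) (s : nat)
    (P : pred 'I_s) (X : 'I_s -> field M 'rV[R]_N) : field M 'M[R]_N :=
  fun c x => (\sum_(i < s | P i) <<X i c x>>)%MS.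

Definition orthogonal_distributions (R : realType) N (M : smooth_manifold R N)
    (D1 D2 : field M 'M[R]_N) (G : field M 'M[R]_N) : Prop :=
  forall c x, img c x -> forall u v : 'rV[R]_N,
    (u <= D1 c x)%MS -> (v <= D2 c x)%MS -> pairing (G c x) u v = 0.

(* Some G-orthonormal basis (as rows) of the row space of A; there is one when G
   is symmetric positive definite. *)
Definition orthonormal_frame (R : realType) N (G A : 'M[R]_N) :
    'M[R]_(\rank A, N) :=
  xget 0 [set E : 'M[R]_(\rank A, N) |
            (E == A)%MS /\ E *m G *m E^T = 1%:M].

(* Independent of the orthonormal bases chosen. *)
Definition mutual_curvature_loc (R : realType) N (G : 'rV[R]_N -> 'M[R]_N)
    (x : 'rV[R]_N) (A B : 'M[R]_N) : R :=
  \sum_(a < \rank A) \sum_(i < \rank B)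
    let u := row a (orthonormal_frame (G x) A) in
    let v := row i (orthonormal_frame (G x) B) in
    pairing (G x) (curvature G x u v v) u.

(* Independent of the chart around p. *)
Definition mutual_curvature (R : realType) N (M : smooth_manifold R N)
    (D1 D2 : field M 'M[R]_N) (G : field M 'M[R]_N) (p : M) : R :=
  let c := chart_at p in
  let x := coord c p in
  mutual_curvature_loc (G c) x (D1 c x) (D2 c x).

(* Lebesgue integral over R^N of a nonnegative Borel function, as an iterated
   integral (Tonelli). *)
Fixpoint lebesgue_integral_rV (R : realType) (N : nat) :
    ('rV[R]_N -> \bar R) -> \bar R :=
  match N return ('rV[R]_N -> \bar R) -> \bar R with
  | 0 => fun F => F 0
  | N'.+1 => fun F =>
      (\int[@lebesgue_measure R]_(t in setT)
        lebesgue_integral_rV (fun y : 'rV[R]_N' =>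
          F (row_mx (t%:M : 'rV[R]_1) y : 'rV[R]_(1 + N'))))%E
  end.

Definition borel (T : ptopologicalType) := g_sigma_algebraType (@open T).

(* mu is the Riemannian volume dvol_g: the Borel measure with density
   sqrt(det g_ij) in each chart.  Charts cover M and M is second countable, so
   this determines mu. *)
Definition is_riemannian_volume (R : realType) N (M : smooth_manifold R N)
    (G : field M 'M[R]_N) (mu : {measure set (borel M) -> \bar R}) : Prop :=
  forall (c : chart M) (A : set (borel M)), measurable A -> A `<=` dom c ->
    mu A = lebesgue_integral_rV (fun x =>
             (\1_(coord c @` A) x * Num.sqrt (\det (G c x)))%:E).

(* j is the value on Omega of the action J_{D1,D2}(G). *)
Definition is_action (R : realType) N (M : smooth_manifold R N)
    (D1 D2 : field M 'M[R]_N) (Omega : set M) (G : field M 'M[R]_N)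
    (j : R) : Prop :=
  exists2 mu : {measure set (borel M) -> \bar R},
    is_riemannian_volume G mu &
    j = Rintegral mu Omega (mutual_curvature D1 D2 G).

(* gt t, for |t| < eps, is a smooth family of metrics equal to g for t = 0 and
   outside Omega; gt t is irrelevant for other t. *)
Definition is_variation (R : realType) N (M : smooth_manifold R N)
    (Omega : set M) (g : field M 'M[R]_N) (eps : R)
    (gt : R -> field M 'M[R]_N) : Prop :=
  [/\ forall t, `|t| < eps -> is_riemannian_metric (gt t),
      forall c, smooth_on [set z : R^o * 'rV[R]_N | `|z.1| < eps /\ img c z.2]
                          (fun z => gt z.1 c z.2),
      forall c x, img c x -> gt 0 c x = g c x
    & forall t, `|t| < eps -> forall c x, img c x -> ~ Omega (param c x) ->
        gt t c x = g c x].

(* g is critical for J_{D1,D2} with respect to the variations all of whose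
   metrics satisfy P.  If M is compact, Omega may be all of M. *)
Definition critical (R : realType) N (M : smooth_manifold R N)
    (D1 D2 : field M 'M[R]_N) (P : field M 'M[R]_N -> Prop)
    (g : field M 'M[R]_N) : Prop :=
  forall (Omega : set M) (eps : R) (gt : R -> field M 'M[R]_N) (J : R -> R),
    open Omega -> compact (closure Omega) -> 0 < eps ->
    is_variation Omega g eps gt ->
    (forall t, `|t| < eps -> P (gt t)) ->
    (forall t, `|t| < eps -> is_action D1 D2 Omega (gt t) (J t)) ->
    is_derive (0 : R) (1 : R) J 0.

(* Main.v *)
(* The brackets of the characteristic fields [xi_i] vanish and the Killing condition makes
   every covariant derivative of a [xi_i] along a [xi_j] vanish for [g].  For a
   metric [g_t] of the variation, with Gram matrix [gamma] of the [xi_i], the mutual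
   curvature is the contraction with [gamma^-1] of second derivatives
   [xi_p xi_q gamma_ij] and of products of two covariant derivatives, which are
   [O(t)] each.  Hence it is [L_t + O(t^2)], where [L_t] is a sum of terms
   [xi_p xi_p (gamma_ii - 1)] and is [O(t)].  Since [xi_p] is divergence free for
   [g], the integral of [L_t] with respect to the volume of [g] is zero, and the volume
   of [g_t] is [1 + O(t)] times the volume of [g]; so the action is [O(t^2)].
   The boundary of [Omega] may have positive measure: there one uses that the
   derivative of a function vanishes almost everywhere on its zero set. *)

From HB Require Import structures.
Require Import Defs.
From mathcomp Require Import all_boot all_order all_algebra.
From mathcomp Require Import all_classical all_reals all_analysis.
From mathcomp Require Import perm finmap measurable_realfun ring lra.

Set Implicit Arguments.
Unset Strict Implicit.
Unset Printing Implicit Defensive.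

Import Order.TTheory GRing.Theory Num.Theory.
Import numFieldNormedType.Exports.

Local Open Scope classical_set_scope.
Local Open Scope ring_scope.

(** * Functions of class C^k *)

(** Curvature is reduced to Lie derivatives: for commuting fields the Koszul formula expresses a
    covariant derivative by [lie_metric] and derivatives of Gram entries. This one formula gives
    both the vanishing at t = 0 and the independence of the chart. Orthogonality, for each metric of
    the variation, makes the Gram matrix block diagonal; this turns the unspecified orthonormal
    frames, which may depend irregularly on the point, into blocks of the inverse Gram matrix.
    Bounds in t are proved near each point (0, x) of the joint space of t and the coordinates, by
    the mean value theorem in t, and made uniform by compactness of the closure of [Omega]. A volume
    is known only through a predicate, so two volumes are compared by inequalities between measures
    of small sets, which add up. The divergence theorem is globalised by dividing by a positive sum
    of bumps, in place of a partition of unity. Nothing is differentiated under the integral: a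
    quadratic bound on the action yields its derivative together with its existence. *)

Lemma near_eq_continuous (V T : topologicalType) (f g : V -> T) x :
  (\near x, f x = g x) -> {for x, continuous f} -> {for x, continuous g}.
Proof.
move=> fg cf; have e : f x = g x := nbhs_singleton fg.
have cf' : f @ x --> g x by rewrite -e; exact: cf.
by apply: cvg_trans cf'; apply: near_eq_cvg.
Qed.

Section CkAlgebra.
Variables (R : realType) (V : normedModType R).
Implicit Types (A B : set V) (k : nat).

Lemma open_nbhs_eq (T : Type) A (f g : V -> T) x :
  open A -> A x -> (forall y, A y -> f y = g y) -> \near x, f x = g x.
Proof.
move=> oA Ax fg; near=> y; apply: fg; near: y.
by apply: open_nbhs_nbhs; split.
Unshelve. all: by end_near. Qed.

Lemma derive_open_eq (W : normedModType R) A (f g : V -> W) x v :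
  open A -> A x -> (forall y, A y -> f y = g y) -> 'D_v f x = 'D_v g x.
Proof. by move=> oA Ax fg; exact/near_eq_derive/(open_nbhs_eq oA Ax fg). Qed.

(** The first-order expansion of [f] is, near [x], one of [g]; uniqueness of the differential
    identifies the two differentials. *)
Lemma near_eq_differentiable (W : normedModType R) (f g : V -> W) x :
  (\near x, f x = g x) -> differentiable f x -> differentiable g x.
Proof.
move=> fg df; apply/diff_locallyP.
have df' := diff_locally df.
have gfx : g x = f x by rewrite (nbhs_singleton fg).
have E : 'd g x = 'd f x :> (V -> W).
  apply: diff_unique; first exact: diff_continuous.
  apply/eqaddoP => _/posnumP[e].
  have /eqaddoP/(_ e%:num)/(_ [gt0 of e%:num]) := df'.
  have fg' : \forall y \near (0 : V), f (y + x) = g (y + x).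
    have := fg; rewrite (near_shift 0 x) /=.
    by apply: filterS => y; rewrite /= subr0.
  move: fg'; apply: filter_app2; apply: nearW => y /= fgy.
  rewrite -![(_ + _ : _ -> _) _]/(_ + _) -![(- _ : _ -> _) _]/(- _) /=.
  by rewrite /cst fgy gfx.
split; first by rewrite E; exact: diff_continuous.
rewrite E; apply/eqaddoP => _/posnumP[e].
have /eqaddoP/(_ e%:num)/(_ [gt0 of e%:num]) := df'.
have fg' : \forall y \near (0 : V), f (y + x) = g (y + x).
  have := fg; rewrite (near_shift 0 x) /=.
  by apply: filterS => y; rewrite /= subr0.
move: fg'; apply: filter_app2; apply: nearW => y /= fgy.
rewrite -![(_ + _ : _ -> _) _]/(_ + _) -![(- _ : _ -> _) _]/(- _) /=.
by rewrite /cst fgy gfx.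
Qed.

Lemma Ck_on_eq (W : normedModType R) k A (f g : V -> W) :
  open A -> (forall y, A y -> f y = g y) -> Ck_on k A f -> Ck_on k A g.
Proof.
elim: k f g => [|k IH] f g oA fg /=.
  by move=> cf x Ax; apply: near_eq_continuous (cf x Ax); exact: open_nbhs_eq Ax _.
move=> [df Cf]; split.
  by move=> x Ax; apply: near_eq_differentiable (df x Ax); exact: open_nbhs_eq Ax _.
move=> v; apply: IH (Cf v) => // y Ay; exact: derive_open_eq Ay _.
Qed.

Lemma Ck_on_sub (W : normedModType R) k A B (f : V -> W) :
  A `<=` B -> Ck_on k B f -> Ck_on k A f.
Proof.
move=> AB; elim: k f => [|k IH] f /=; first by move=> cf x /AB; exact: cf.
by move=> [df Cf]; split=> [x /AB|v]; [exact: df|exact: IH].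
Qed.

Lemma Ck_onS (W : normedModType R) k A (f : V -> W) :
  Ck_on k.+1 A f -> Ck_on k A f.
Proof.
elim: k f => [|k IH] f [df Cf].
  by move=> x Ax; apply: differentiable_continuous; exact: df.
by split=> // v; exact: IH.
Qed.

Lemma Ck_on_le (W : normedModType R) k l A (f : V -> W) :
  (k <= l)%N -> Ck_on l A f -> Ck_on k A f.
Proof.
by move=> /subnK <-; elim: (l - k)%N => // j IH; rewrite addSn => /Ck_onS/IH.
Qed.

Lemma Ck_on_continuous (W : normedModType R) k A (f : V -> W) x :
  Ck_on k A f -> A x -> {for x, continuous f}.
Proof. by move/(Ck_on_le (leq0n k)) => cf Ax; exact: cf. Qed.

Lemma Ck_on_differentiable (W : normedModType R) k A (f : V -> W) x :
  Ck_on k.+1 A f -> A x -> differentiable f x.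
Proof. by move=> [df _] Ax; exact: df. Qed.

Lemma Ck_on_derive (W : normedModType R) k A (f : V -> W) v :
  Ck_on k.+1 A f -> Ck_on k A (fun x => 'D_v f x).
Proof. by move=> [_ Cf]; exact: Cf. Qed.

Lemma Ck_on_cst (W : normedModType R) k A (a : W) : Ck_on k A (fun=> a).
Proof.
elim: k a => [|k IH] a /=; first by move=> x _; exact: cvg_cst.
split=> [x _|v]; first exact: differentiable_cst.
have -> : (fun x => 'D_v (fun=> a) x) = (fun=> 0 : W) :> (V -> W).
  by apply/funext => x; rewrite derive_cst.
exact: IH.
Qed.

Implicit Types (f g : V -> R).

Lemma Ck_onD k A f g : open A ->
  Ck_on k A f -> Ck_on k A g -> Ck_on k A (fun x => f x + g x).
Proof.
move=> oA; elim: k f g => [|k IH] f g.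
  by move=> cf cg x Ax; apply: continuousD; [exact: cf|exact: cg].
move=> [df Cf] [dg Cg]; split=> [x Ax|v].
  by apply: differentiableD; [exact: df|exact: dg].
apply: Ck_on_eq (IH _ _ (Cf v) (Cg v)) => // y Ay.
by rewrite -deriveD //; apply/diff_derivable; [exact: df|exact: dg].
Qed.

Lemma Ck_onM k A f g : open A ->
  Ck_on k A f -> Ck_on k A g -> Ck_on k A (fun x => f x * g x).
Proof.
move=> oA; elim: k f g => [|k IH] f g.
  by move=> cf cg x Ax; apply: continuousM; [exact: cf|exact: cg].
move=> Cf1 Cg1; have [df Cf] := Cf1; have [dg Cg] := Cg1; split=> [x Ax|v].
  by apply: differentiableM; [exact: df|exact: dg].
have h1 := IH _ _ (Ck_onS Cf1) (Cg v); have h2 := IH _ _ (Ck_onS Cg1) (Cf v).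
apply: Ck_on_eq (Ck_onD oA h1 h2) => // y Ay.
by rewrite -deriveM //; apply/diff_derivable; [exact: df|exact: dg].
Qed.

Lemma Ck_onN k A f : open A -> Ck_on k A f -> Ck_on k A (fun x => - f x).
Proof.
move=> oA Cf; have h := Ck_onM oA (Ck_on_cst k A (-1 : R)) Cf.
by apply: Ck_on_eq h => // y _; rewrite mulN1r.
Qed.

Lemma Ck_onB k A f g : open A ->
  Ck_on k A f -> Ck_on k A g -> Ck_on k A (fun x => f x - g x).
Proof. by move=> oA Cf Cg; apply: Ck_onD => //; exact: Ck_onN. Qed.

Lemma Ck_on_sum k A (I : Type) (r : seq I) (P : pred I) (F : I -> V -> R) :
  open A -> (forall i, P i -> Ck_on k A (F i)) ->
  Ck_on k A (fun x => \sum_(i <- r | P i) F i x).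
Proof.
move=> oA CF; elim: r => [|i r IH].
  by apply: Ck_on_eq (Ck_on_cst k A (0 : R)) => // y _; rewrite big_nil.
case Pi : (P i); last by apply: Ck_on_eq IH => // y _; rewrite big_cons Pi.
apply: Ck_on_eq (Ck_onD oA (CF i Pi) IH) => // y _; by rewrite big_cons Pi.
Qed.

Lemma Ck_on_prod k A (I : Type) (r : seq I) (P : pred I) (F : I -> V -> R) :
  open A -> (forall i, P i -> Ck_on k A (F i)) ->
  Ck_on k A (fun x => \prod_(i <- r | P i) F i x).
Proof.
move=> oA CF; elim: r => [|i r IH].
  by apply: Ck_on_eq (Ck_on_cst k A (1 : R)) => // y _; rewrite big_nil.
case Pi : (P i); last by apply: Ck_on_eq IH => // y _; rewrite big_cons Pi.
apply: Ck_on_eq (Ck_onM oA (CF i Pi) IH) => // y _; by rewrite big_cons Pi.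
Qed.

Lemma Ck_onV k A f : open A -> (forall x, A x -> f x != 0) ->
  Ck_on k A f -> Ck_on k A (fun x => (f x)^-1).
Proof.
move=> oA f0; elim: k => [|k IH].
  by move=> cf x Ax; apply: continuousV; [exact: f0|exact: cf].
move=> Cf1; have [df Cf] := Cf1; split=> [x Ax|v].
  by apply: differentiableV; [exact: df|exact: f0].
have h := IH (Ck_onS Cf1).
apply: Ck_on_eq (Ck_onN oA (Ck_onM oA (Ck_onM oA h h) (Cf v))) => // y Ay.
rewrite (deriveV (f0 y Ay)); last by apply/diff_derivable; exact: df.
by rewrite expr2 invfM scaleNr.
Qed.

Lemma Ck_on_entry k A m n (F : V -> 'M[R]_(m, n)) i j : open A ->
  Ck_on k A F -> Ck_on k A (fun x => F x i j).
Proof.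
move=> oA; elim: k F => [|k IH] F.
  move=> cf x Ax; apply: (@continuous_comp _ _ _ F (fun N : 'M[R]_(m, n) => N i j)).
    exact: cf.
  exact: coord_continuous.
move=> [df Cf]; split=> [x Ax|v].
  apply: (@differentiable_comp _ _ _ _ F (fun N : 'M[R]_(m, n) => N i j : R)).
    exact: df.
  exact: differentiable_coord.
apply: Ck_on_eq (IH _ (Cf v)) => // y Ay.
by rewrite derive_mx ?mxE //; apply/diff_derivable; exact: df.
Qed.

End CkAlgebra.

Lemma derive_entry (R : realType) (V : normedModType R) m n
    (F : V -> 'M[R]_(m, n)) x v i j :
  differentiable F x -> ('D_v F x) i j = 'D_v (fun y => F y i j) x.
Proof. by move=> dF; rewrite derive_mx ?mxE //; exact: diff_derivable. Qed.

Lemma derive_comp_diff (R : realType) (U V W : normedModType R) (phi : U -> V)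
    (f : V -> W) x v : differentiable phi x -> differentiable f (phi x) ->
  'D_v (f \o phi) x = 'D_('D_v phi x) f (phi x).
Proof.
move=> dphi df; rewrite !deriveE //; last exact: differentiable_comp.
by rewrite diff_comp.
Qed.

(** The derivative of [phi] along [v] is the constant [l v], so a derivative of the composite is
    again a composite with [phi] and the induction on [k] closes. *)
Lemma Ck_on_comp_affine (R : realType) (U V W : normedModType R) (phi : U -> V)
    (l : U -> V) k (A : set V) (f : V -> W) :
  open (phi @^-1` A) -> (forall x, differentiable phi x) ->
  (forall x v, 'D_v phi x = l v) ->
  Ck_on k A f -> Ck_on k (phi @^-1` A) (f \o phi).
Proof.
move=> oA dphi Dphi; elim: k f => [|k IH] f.
  move=> cf x Ax; apply: continuous_comp; last exact: cf.
  exact: differentiable_continuous.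
move=> [df Cf]; split=> [x Ax|v].
  by apply: differentiable_comp => //; exact: df.
apply: Ck_on_eq (IH _ (Cf (l v))) => // y Ay.
by rewrite derive_comp_diff //; [rewrite Dphi|exact: df].
Qed.

Lemma derive_sum_dir (R : realType) (V W : normedModType R) (f : V -> W) x
    (I : Type) (r : seq I) (P : pred I) (c : I -> R) (e : I -> V) :
  differentiable f x ->
  'D_(\sum_(i <- r | P i) c i *: e i) f x =
  \sum_(i <- r | P i) c i *: 'D_(e i) f x.
Proof.
move=> df; rewrite deriveE // linear_sum; apply: eq_bigr => i _.
by rewrite linearZ deriveE.
Qed.

Lemma derive_rV (R : realType) N (W : normedModType R) (f : 'rV[R]_N -> W) x v :
  differentiable f x ->
  'D_v f x = \sum_j v 0 j *: 'D_(delta_mx 0 j) f x.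
Proof. by move=> df; rewrite [v in LHS]row_sum_delta derive_sum_dir. Qed.

Lemma affine_line_diff (R : realType) (V : normedModType R) (y v : V) (s : R) :
  differentiable (fun r : R => y + r *: v) s /\
  'D_1 (fun r : R => y + r *: v) s = v.
Proof.
have d : differentiable (fun r : R => y + r *: v) s.
  apply: (@differentiableD _ _ _ (fun=> y) (fun r : R => r *: v)).
    exact: differentiable_cst.
  exact: differentiableZl.
split=> //; rewrite deriveE // (@diffD _ _ _ (fun=> y) (fun r : R => r *: v)).
- by rewrite diff_cst diffZl //= diff_val /= add0r scale1r.
- exact: differentiable_cst.
- exact: differentiableZl.
Qed.

Lemma mean_value_line (R : realType) (V : normedModType R) (f : V -> R)
    (y v : V) (h : R) : 0 <= h ->
  (forall s, 0 <= s <= h -> differentiable f (y + s *: v)) ->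
  exists2 c, 0 <= c <= h & f (y + h *: v) - f y = 'D_v f (y + c *: v) * h.
Proof.
move=> h0 df.
pose g := f \o (fun s : R => y + s *: v).
have dg s : 0 <= s <= h -> is_derive s 1 g ('D_v f (y + s *: v)).
  move=> sh; have [dl Dl] := affine_line_diff y v s.
  apply: DeriveDef; last by rewrite derive_comp_diff ?Dl //; exact: df.
  by apply/diff_derivable/differentiable_comp => //; exact: df.
have [||c ch E] := @MVT_segment R g (fun s => 'D_v f (y + s *: v)) 0 h h0.
- by move=> s; rewrite in_itv /= => /andP[s0 sh]; apply: dg; rewrite !ltW.
- apply: continuous_in_subspaceT => s /set_mem; rewrite /= in_itv /= => sh.
  have [ds _] := dg s sh.
  exact/differentiable_continuous/derivable1_diffP.
exists c; first by move: ch; rewrite in_itv.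
by move: E; rewrite /g /= scale0r addr0 subr0.
Qed.

(** * Symmetry of second derivatives *)

Section Schwarz.
Variables (R : realType) (V : normedModType R) (A : set V) (f : V -> R).
Hypotheses (oA : open A) (Cf : Ck_on 2 A f).

(** Two mean value theorems: along [u] for the increment [p] of [f] by [h *: v], then along [v] for
    ['D_u f]. *)
Let second_difference (x u v : V) (h : R) : 0 <= h ->
  (forall r s, 0 <= r <= h -> 0 <= s <= h -> A (x + r *: u + s *: v)) ->
  exists r s, [/\ 0 <= r <= h, 0 <= s <= h &
    f (x + h *: u + h *: v) - f (x + h *: u) - (f (x + h *: v) - f x) =
    'D_v (fun y => 'D_u f y) (x + r *: u + s *: v) * h * h].
Proof.
move=> h0 Arect.
have df y : A y -> differentiable f y by move=> Ay; exact: Ck_on_differentiable Cf Ay.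
have dDf w y : A y -> differentiable (fun z => 'D_w f z) y.
  by move=> Ay; exact: Ck_on_differentiable (Ck_on_derive w Cf) Ay.
have hh : 0 <= h <= h by rewrite h0 lexx.
have h00 : 0 <= (0 : R) <= h by rewrite h0 lexx.
pose p y := f (y + h *: v) - f y.
have dp y : A y -> A (y + h *: v) ->
    differentiable p y /\ 'D_u p y = 'D_u f (y + h *: v) - 'D_u f y.
  move=> Ay Ayh.
  have dsh : differentiable (fun y => y + h *: v) y.
    by apply: (@differentiableD _ _ _ id (fun=> h *: v)) => //; exact: differentiable_cst.
  have Dsh : 'D_u (fun y => y + h *: v) y = u.
    by rewrite deriveD // ?derive_cst ?addr0 ?derive_id //; exact: derivable_id.
  have d1 : differentiable (f \o (fun y => y + h *: v)) y.
    by apply: differentiable_comp => //; exact: df.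
  split; first by apply: differentiableB => //; exact: df.
  rewrite (_ : p = (f \o (fun y => y + h *: v)) - f) //.
  rewrite deriveB; [|exact: diff_derivable|by apply: diff_derivable; exact: df].
  by rewrite derive_comp_diff ?Dsh //; exact: df.
have A1 r : 0 <= r <= h -> A (x + r *: u).
  by move=> rh; have := Arect r 0 rh h00; rewrite scale0r addr0.
have [|r rh E1] := @mean_value_line R V p x u h h0.
  by move=> r rh; apply: (dp _ _ _).1; [exact: A1|exact: Arect].
have [|s sh E2] := @mean_value_line R V (fun y => 'D_u f y) (x + r *: u) v h h0.
  by move=> s sh; apply: dDf; exact: Arect.
exists r, s; split=> //.
rewrite -E2 -(dp _ _ _).2; [|exact: A1|exact: Arect].
by rewrite -E1 /p.
Qed.

Let second_difference_eq (p p' q r s a b h : R) : p = p' ->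
  p - q - (r - s) = a * h * h -> p' - r - (q - s) = b * h * h -> (h == 0) = false ->
  a = b.
Proof.
move=> <- E1 E2 h0; have {}h0 : h != 0 by rewrite h0.
have E : a * h * h = b * h * h by rewrite -E1 -E2; ring.
by rewrite -(mulfK h0 a) -(mulfK h0 (a * h)) E !mulfK.
Qed.

Let close_eq (p q a b e : R) :
  a = b -> `|p - b| < e / 2 -> `|q - a| < e / 2 -> `|p - q| <= e.
Proof.
move=> <- /ltW pb /ltW qa; rewrite -(subrKA a) (le_trans (ler_normD _ _)) //.
by rewrite (splitr e) lerD // distrC.
Qed.

(** The second difference is symmetric in [u] and [v]. Hence one mixed derivative at some point of a
    small parallelogram equals the other at another such point, and continuity brings both points
    back to [x]. *)
Lemma derive_comm x u v : A x ->
  'D_u (fun y => 'D_v f y) x = 'D_v (fun y => 'D_u f y) x.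
Proof.
move=> Ax.
pose F w z := fun y => 'D_w (fun y => 'D_z f y) y.
have cF w z : {for x, continuous (F w z)}.
  by apply: (@Ck_on_continuous _ _ _ 0 A) => //; apply: Ck_on_derive; apply: Ck_on_derive.
rewrite -[LHS]/(F u v x) -[RHS]/(F v u x).
apply/eqP; rewrite -subr_eq0 -normr_le0; apply/ler_addgt0Pr => e e0; rewrite add0r.
have e2 : 0 < e / 2 by rewrite divr_gt0.
have n1 : \forall y \near x, `|F u v x - F u v y| < e / 2 by exact: (cvgrPdist_lt _ _).1 (cF u v) _ e2.
have n2 : \forall y \near x, `|F v u x - F v u y| < e / 2 by exact: (cvgrPdist_lt _ _).1 (cF v u) _ e2.
have n3 : \forall y \near x, A y by apply: open_nbhs_nbhs; split.
have /nbhs_ballP[d /= d0 Hd] : \forall y \near x,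
  `|F u v x - F u v y| < e / 2 /\ `|F v u x - F v u y| < e / 2 /\ A y.
  exact: filterI n1 (filterI n2 n3).
(* With [h = d / 2 / c] the whole parallelogram stays within [d] of [x]; the summand 1 keeps [c]
   positive even if [u] and [v] vanish. *)
pose c := 1 + `|u| + `|v|.
have c0 : 0 < c by rewrite /c -addrA ltr_pwDl // addr_ge0.
pose h := d / 2 / c.
have h0 : 0 < h by rewrite !divr_gt0.
have inb w z r s : `|w| + `|z| <= `|u| + `|v| -> 0 <= r <= h -> 0 <= s <= h ->
    ball x d (x + r *: w + s *: z).
  move=> wz /andP[r0 rh] /andP[s0 sh]; rewrite -ball_normE /= -addrA opprD addNKr.
  rewrite normrN (le_lt_trans (ler_normD _ _)) // !normrZ !ger0_norm //.
  apply: (@le_lt_trans _ _ (h * (`|w| + `|z|))).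
    by rewrite mulrDr lerD // ler_wpM2r.
  apply: (@le_lt_trans _ _ (h * c)).
    by rewrite ler_pM2l // (le_trans wz) // /c -addrA lerDr.
  by rewrite /h divfK ?gt_eqF // ltr_pdivrMr // ltr_pMr // ltr1n.
have [|r [s [rh sh E1]]] := @second_difference x u v h (ltW h0).
  by move=> r s rh sh; apply: (Hd _ _).2.2; apply: inb.
have [|r' [s' [rh' sh' E2]]] := @second_difference x v u h (ltW h0).
  by move=> r' s' rh' sh'; apply: (Hd _ _).2.2; apply: inb => //; rewrite addrC.
have E : F v u (x + r *: u + s *: v) = F u v (x + r' *: v + s' *: u).
  have Ep : f (x + h *: u + h *: v) = f (x + h *: v + h *: u).
    by congr (f _); exact: addrAC.
  exact: second_difference_eq Ep E1 E2 (gt_eqF h0).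
have wz : `|v| + `|u| <= `|u| + `|v| by rewrite addrC.
have b1 := (Hd _ (inb u v r s (lexx _) rh sh)).2.1.
have b2 := (Hd _ (inb v u r' s' wz rh' sh')).1.
exact: close_eq E b2 b1.
Qed.

End Schwarz.

Lemma derive_comm_mx (R : realType) (V : normedModType R) m n (A : set V)
    (F : V -> 'M[R]_(m, n)) x u v : open A -> Ck_on 2 A F -> A x ->
  'D_u (fun y => 'D_v F y) x = 'D_v (fun y => 'D_u F y) x.
Proof.
move=> oA CF Ax; apply/matrixP => i j.
have dD w : differentiable (fun z => 'D_w F z) x.
  exact: Ck_on_differentiable (Ck_on_derive w CF) Ax.
apply: etrans (derive_entry _ _ _ (dD v)) _.
apply: etrans _ (esym (derive_entry _ _ _ (dD u))).
have E w y : A y -> ('D_w F y) i j = 'D_w (fun z => F z i j) y.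
  by move=> Ay; rewrite derive_entry //; exact: Ck_on_differentiable CF Ay.
apply: etrans (derive_open_eq u oA Ax (E v)) _.
apply: etrans _ (esym (derive_open_eq v oA Ax (E u))).
exact: (derive_comm oA (Ck_on_entry i j oA CF) u v Ax).
Qed.

(** * Products, determinants, inverses and square roots *)

Section ProductDerivative.
Variables (R : realType) (V : normedModType R) (x v : V).

Lemma is_derive_bigprod (I : eqType) (r : seq I) (F : I -> V -> R) (dF : I -> R) :
  uniq r -> (forall i, is_derive x v (F i) (dF i)) ->
  is_derive x v (fun y => \prod_(i <- r) F i y)
    (\sum_(i <- r) dF i * \prod_(k <- r | k != i) F k x).
Proof.
move=> + HF; elim: r => [_|i r IH /= /andP[ir ur]].
  rewrite big_nil (_ : (fun y => _) = cst 1); first exact: is_derive_cst.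
  by apply/funext => y; rewrite big_nil.
have E : (fun y => \prod_(k <- i :: r) F k y) = F i * (fun y => \prod_(k <- r) F k y).
  by apply/funext => y; rewrite big_cons.
rewrite E; have h := is_deriveM (HF i) (IH ur).
apply: is_derive_eq h _; rewrite big_cons big_cons eqxx /= addrC; congr (_ + _).
  rewrite -[LHS]/(_ * _) mulrC; congr (_ * _).
  rewrite big_seq [RHS]big_seq_cond; apply: eq_bigl => k.
  by case kr : (k \in r) => //=; apply/esym/negP => /eqP ki; rewrite -ki kr in ir.
rewrite -[LHS]/(_ * _) big_distrr /= big_seq [RHS]big_seq; apply: eq_bigr => k kr.
rewrite big_cons; have -> /= : i != k by apply/negP => /eqP ik; rewrite ik kr in ir.
by rewrite mulrCA.
Qed.

Lemma is_derive_bigsum (I : Type) (r : seq I) (P : pred I) (F : I -> V -> R) (dF : I -> R) :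
  (forall i, P i -> is_derive x v (F i) (dF i)) ->
  is_derive x v (fun y => \sum_(i <- r | P i) F i y) (\sum_(i <- r | P i) dF i).
Proof.
move=> HF; elim: r => [|i r IH].
  rewrite big_nil (_ : (fun y => _) = cst 0); first exact: is_derive_cst.
  by apply/funext => y; rewrite big_nil.
case Pi : (P i).
  rewrite big_cons Pi.
  have -> : (fun y => \sum_(k <- i :: r | P k) F k y) =
      F i + (fun y => \sum_(k <- r | P k) F k y).
    by apply/funext => y; rewrite big_cons Pi.
  exact: is_deriveD (HF i Pi) IH.
rewrite big_cons Pi.
have -> // : (fun y => \sum_(k <- i :: r | P k) F k y) =
    (fun y => \sum_(k <- r | P k) F k y).
by apply/funext => y; rewrite big_cons Pi.
Qed.

Lemma is_derive_det n (G : V -> 'M[R]_n) (dG : 'M[R]_n) :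
  (forall i j, is_derive x v (fun y => G y i j) (dG i j)) ->
  is_derive x v (fun y => \det (G y))
    (\sum_i \sum_j dG i j * cofactor (G x) i j).
Proof.
move=> HG.
(* [H i] is [G x] with row [i] replaced by that of [dG]. Expanded along this row its determinant is
   the inner cofactor sum; expanded over permutations it gives the terms of the product rule. *)
pose H i : 'M[R]_n := \matrix_(k, l) if k == i then dG k l else G x k l.
have EH i : \sum_j dG i j * cofactor (G x) i j = \det (H i).
  rewrite (expand_det_row _ i); apply: eq_bigr => j _.
  rewrite mxE eqxx; congr (_ * _); rewrite /cofactor; congr (_ * \det _).
  by apply/matrixP => k l; rewrite !mxE eq_sym (negbTE (neq_lift _ _)).
have -> : \sum_i \sum_j dG i j * cofactor (G x) i j =
    \sum_(s : {perm 'I_n}) (-1) ^+ s * \sum_i dG i (s i) * \prod_(k | k != i) G x k (s k).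
  under eq_bigr do rewrite EH /determinant.
  rewrite exchange_big; apply: eq_bigr => s _; rewrite big_distrr /=.
  apply: eq_bigr => i _; congr (_ * _).
  rewrite (bigD1 i) //= mxE eqxx; congr (_ * _).
  by apply: eq_bigr => k ki; rewrite mxE (negbTE ki).
apply: is_derive_bigsum => s _.
have h := is_derive_bigprod (F := fun i y => G y i (s i)) (index_enum_uniq _)
  (fun i => HG i (s i)).
exact: is_deriveZ h.
Qed.

End ProductDerivative.

Section CkMatrix.
Variables (R : realType) (V : normedModType R) (A : set V).
Hypothesis oA : open A.

Lemma Ck_on_det k n (G : V -> 'M[R]_n) :
  (forall i j, Ck_on k A (fun x => G x i j)) -> Ck_on k A (fun x => \det (G x)).
Proof.
move=> CG; apply: Ck_on_sum => // s _; apply: Ck_onM => //; first exact: Ck_on_cst.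
by apply: Ck_on_prod => // i _; exact: CG.
Qed.

(** Cramer's rule: an entry of the inverse is a cofactor divided by the determinant. *)
Lemma Ck_on_invmx k n (G : V -> 'M[R]_n) :
  (forall x, A x -> G x \in unitmx) ->
  (forall i j, Ck_on k A (fun x => G x i j)) ->
  forall i j, Ck_on k A (fun x => invmx (G x) i j).
Proof.
move=> uG CG i j.
have Ccof : Ck_on k A (fun x => cofactor (G x) j i).
  apply: Ck_onM => //; first exact: Ck_on_cst.
  apply: Ck_on_det => a b.
  have -> : (fun x => row' j (col' i (G x)) a b) = (fun x => G x (lift j a) (lift i b)).
    by apply/funext => x; rewrite !mxE.
  exact: CG.
have d0 x : A x -> \det (G x) != 0 by move=> /uG; rewrite unitmxE unitfE.
apply: Ck_on_eq (Ck_onM oA (Ck_onV oA d0 (Ck_on_det CG)) Ccof) => // x Ax.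
by rewrite /invmx uG // !mxE.
Qed.

(** The derivative of the square root contains the square root itself in the denominator, at one
    order less, which the induction on [k] supplies. *)
Lemma Ck_on_sqrt k (f : V -> R) : (forall x, A x -> 0 < f x) ->
  Ck_on k A f -> Ck_on k A (fun x => Num.sqrt (f x)).
Proof.
move=> f0; elim: k => [|k IH].
  move=> cf x Ax; apply: (@continuous_comp _ _ _ f Num.sqrt); first exact: cf.
  exact: sqrt_continuous.
move=> Cf1; have [df Cf] := Cf1.
have ds x : A x -> differentiable (Num.sqrt : R -> R) (f x).
  by move=> Ax; apply/derivable1_diffP; have [] := is_derive1_sqrt (f0 x Ax).
split=> [x Ax|v].
  by apply: (@differentiable_comp _ _ _ _ f Num.sqrt); [exact: df|exact: ds].
have h := IH (Ck_onS Cf1).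
have s0 x : A x -> 2 * Num.sqrt (f x) != 0.
  by move=> Ax; rewrite mulf_neq0 // gt_eqF // sqrtr_gt0 f0.
have h2 := Ck_onM oA (Ck_on_cst k A (2 : R)) h.
apply: Ck_on_eq (Ck_onM oA (Cf v) (Ck_onV oA s0 h2)) => // y Ay.
have [h1 h3] := is_derive1_sqrt (f0 y Ay).
have dy := ds y Ay.
apply/esym; apply: etrans (derive_comp_diff v (df y Ay) dy) _.
move: ('D_v f y) => c; have Ec : c = c *: (1 : R) by rewrite [RHS]mulr1.
rewrite (deriveE _ dy) [in LHS]Ec linearZ -(deriveE _ dy) h3.
by [].
Qed.

End CkMatrix.

Lemma is_derive_entry (R : realType) (V : normedModType R) m n
    (F : V -> 'M[R]_(m, n)) (x v : V) i j : derivable F x v ->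
  is_derive x v (fun y => F y i j) (('D_v F x) i j).
Proof.
move=> dF; rewrite (derive_mx dF) mxE; apply: derivableP.
exact: (derivable_mxP _ _ _).1 dF i j.
Qed.

(** * Bilinear forms and their derivatives *)

Section Pairing.
Variables (R : realType) (N : nat).
Implicit Types (G H : 'M[R]_N) (u v w : 'rV[R]_N) (a : R).

Lemma pairing_def G u v : pairing G u v = (u *m G *m v^T) 0 0.
Proof. by []. Qed.

Lemma pairingE G u v : pairing G u v = \sum_i \sum_j u 0 i * G i j * v 0 j.
Proof.
rewrite /pairing mxE exchange_big; apply: eq_bigr => j _.
by rewrite mxE big_distrl; apply: eq_bigr => i _; rewrite mxE.
Qed.

Lemma pairingDl G u v w : pairing G (u + v) w = pairing G u w + pairing G v w.
Proof. by rewrite /pairing !mulmxDl mxE. Qed.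

Lemma pairingDr G u v w : pairing G u (v + w) = pairing G u v + pairing G u w.
Proof. by rewrite /pairing raddfD mulmxDr mxE. Qed.

Lemma pairingZl G a u v : pairing G (a *: u) v = a * pairing G u v.
Proof. by rewrite /pairing -!scalemxAl mxE. Qed.

Lemma pairingZr G a u v : pairing G u (a *: v) = a * pairing G u v.
Proof. by rewrite /pairing linearZ -scalemxAr mxE. Qed.

Lemma pairingNl G u v : pairing G (- u) v = - pairing G u v.
Proof. by rewrite -scaleN1r pairingZl mulN1r. Qed.

Lemma pairingBl G u v w : pairing G (u - v) w = pairing G u w - pairing G v w.
Proof. by rewrite pairingDl pairingNl. Qed.

Lemma pairing0l G u : pairing G 0 u = 0.
Proof. by rewrite -(scale0r 0) pairingZl mul0r. Qed.

Lemma pairing0r G u : pairing G u 0 = 0.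
Proof. by rewrite -(scale0r 0) pairingZr mul0r. Qed.

Lemma pairing_suml G (I : Type) (r : seq I) (P : pred I) (F : I -> 'rV[R]_N) v :
  pairing G (\sum_(i <- r | P i) F i) v = \sum_(i <- r | P i) pairing G (F i) v.
Proof. by elim/big_rec2: _ => [|i y z _ <-]; rewrite ?pairing0l ?pairingDl. Qed.

Lemma pairing_sumr G (I : Type) (r : seq I) (P : pred I) (F : I -> 'rV[R]_N) v :
  pairing G v (\sum_(i <- r | P i) F i) = \sum_(i <- r | P i) pairing G v (F i).
Proof. by elim/big_rec2: _ => [|i y z _ <-]; rewrite ?pairing0r ?pairingDr. Qed.

Lemma pairing_sym G u v : G^T = G -> pairing G u v = pairing G v u.
Proof.
move=> GT; have E : (u *m G *m v^T)^T = v *m G *m u^T.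
  by rewrite !trmx_mul trmxK GT mulmxA.
by rewrite /pairing -E [RHS]mxE.
Qed.

Lemma pairing_delta G i j : pairing G (delta_mx 0 i) (delta_mx 0 j) = G i j.
Proof. by rewrite /pairing -rowE trmx_delta -colE !mxE. Qed.

(** Koszul's formula determines a covariant derivative only through its pairings, so equations
    between such vectors are proved by testing against every [w]. *)
Lemma pairing_nondeg G u v : G \in unitmx ->
  (forall w, pairing G u w = pairing G v w) -> u = v.
Proof.
move=> uG E; rewrite -(mulmxK uG u) -(mulmxK uG v); congr (_ *m _).
apply/rowP => j; have := E (delta_mx 0 j).
by rewrite /pairing trmx_delta -!colE !mxE.
Qed.

Lemma posdef_unitmx G : (forall v, v != 0 -> 0 < pairing G v v) -> G \in unitmx.
Proof.
move=> pG; rewrite unitmxE unitfE; apply/negP => /eqP/eqP/det0P[v v0 vG].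
by have := pG v v0; rewrite /pairing vG mul0mx mxE ltxx.
Qed.

End Pairing.

Section DerivePairing.
Variables (R : realType) (V : normedModType R) (N : nat).
Variables (G : V -> 'M[R]_N) (X Y : V -> 'rV[R]_N) (x v : V).
Hypotheses (dG : derivable G x v) (dX : derivable X x v) (dY : derivable Y x v).

Lemma is_derive_pairing :
  is_derive x v (fun y => pairing (G y) (X y) (Y y))
    (pairing ('D_v G x) (X x) (Y x) + pairing (G x) ('D_v X x) (Y x)
     + pairing (G x) (X x) ('D_v Y x)).
Proof.
have hG i j := is_derive_entry i j dG.
have hX := is_derive_entry 0 ^~ dX.
have hY := is_derive_entry 0 ^~ dY.
have -> : (fun y => pairing (G y) (X y) (Y y)) =
    fun y => \sum_i \sum_j X y 0 i * G y i j * Y y 0 j.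
  by apply/funext => y; rewrite pairingE.
have h : is_derive x v (fun y => \sum_i \sum_j X y 0 i * G y i j * Y y 0 j)
  (\sum_i \sum_j ((X x 0 i * G x i j) *: 'D_v Y x 0 j +
    Y x 0 j *: (X x 0 i *: 'D_v G x i j + G x i j *: 'D_v X x 0 i))).
  apply: is_derive_bigsum => i _; apply: is_derive_bigsum => j _.
  exact: (is_deriveM (is_deriveM (hX i) (hG i j)) (hY j)).
apply: is_derive_eq h _; rewrite !pairingE -!big_split /=.
apply: eq_bigr => i _; rewrite -!big_split; apply: eq_bigr => j _ /=.
rewrite /GRing.scale /=; ring.
Qed.

Lemma derive_pairing : 'D_v (fun y => pairing (G y) (X y) (Y y)) x =
  pairing ('D_v G x) (X x) (Y x) + pairing (G x) ('D_v X x) (Y x)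
  + pairing (G x) (X x) ('D_v Y x).
Proof. by have [_ ->] := is_derive_pairing. Qed.

End DerivePairing.

Lemma Ck_on_pairing (R : realType) (V : normedModType R) N k (A : set V)
    (G : V -> 'M[R]_N) (X Y : V -> 'rV[R]_N) : open A ->
  (forall i j, Ck_on k A (fun x => G x i j)) ->
  (forall j, Ck_on k A (fun x => X x 0 j)) ->
  (forall j, Ck_on k A (fun x => Y x 0 j)) ->
  Ck_on k A (fun x => pairing (G x) (X x) (Y x)).
Proof.
move=> oA CG CX CY.
apply: (@Ck_on_eq _ _ _ _ _ (fun y => \sum_i \sum_j X y 0 i * G y i j * Y y 0 j)).
- exact: oA.
- by move=> y _; rewrite pairingE.
apply: Ck_on_sum => // i _; apply: Ck_on_sum => // j _.
by do 2 apply: Ck_onM => //.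
Qed.

Lemma Ck_on_derive_field (R : realType) N k (A : set 'rV[R]_N)
    (f : 'rV[R]_N -> R) (X : 'rV[R]_N -> 'rV[R]_N) : open A ->
  Ck_on k.+1 A f -> (forall j, Ck_on k A (fun x => X x 0 j)) ->
  Ck_on k A (fun x => 'D_(X x) f x).
Proof.
move=> oA Cf CX.
apply: (@Ck_on_eq _ _ _ _ _ (fun y => \sum_j X y 0 j * 'D_(delta_mx 0 j) f y)).
- exact: oA.
- by move=> y Ay; rewrite (derive_rV (X y)) //; exact: Ck_on_differentiable Cf Ay.
by apply: Ck_on_sum => // j _; apply: Ck_onM => //; exact: Ck_on_derive.
Qed.

(** * The Levi-Civita connection of a metric on an open set *)

Lemma row_mul_tr (R : realType) N (F : 'I_N -> R) (w : 'rV[R]_N) :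
  ((\row_l F l) *m w^T) 0 0 = \sum_l F l * w 0 l.
Proof. by rewrite mxE; apply: eq_bigr => l _; rewrite !mxE. Qed.

Section PointConnection.
Variables (R : realType) (N : nat) (g : 'M[R]_N) (D : 'rV[R]_N -> 'M[R]_N).
Hypotheses (ug : g \in unitmx) (symg : g^T = g) (symD : forall v, (D v)^T = D v).
Hypothesis linD : forall (I : Type) (r : seq I) (c : I -> R) (f : I -> 'rV[R]_N),
  D (\sum_(i <- r) c i *: f i) = \sum_(i <- r) c i *: D (f i).

Local Notation e_ := (@delta_mx R 1 N 0).

(** The linear algebra of the Levi-Civita connection at a single point: [g] is the metric there and
    [D v] stands for its derivative along [v]. [christoffel] is the case where [D v] is
    ['D_v G x]. *)
Definition connection (u v : 'rV[R]_N) : 'rV[R]_N :=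
  2^-1 *: (\row_l (pairing (D u) v (delta_mx 0 l) + pairing (D v) u (delta_mx 0 l)
                   - pairing (D (delta_mx 0 l)) u v) *m invmx g).

Lemma pairing_D_sum (I : Type) (r : seq I) (c : I -> R) (f : I -> 'rV[R]_N) u v :
  pairing (D (\sum_(i <- r) c i *: f i)) u v = \sum_(i <- r) c i * pairing (D (f i)) u v.
Proof.
rewrite linD pairing_def mulmx_sumr mulmx_suml summxE.
by apply: eq_bigr => l _; rewrite -scalemxAr -scalemxAl mxE -pairing_def.
Qed.

Lemma pairing_row H u w : pairing H u w = \sum_l w 0 l * pairing H u (e_ l).
Proof.
by rewrite [w in LHS]row_sum_delta pairing_sumr; apply: eq_bigr => l _; rewrite pairingZr.
Qed.

(** The definition imposes Koszul's formula on basis vectors; linearity of [D] extends it to every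
    [w]. *)
Lemma connectionP u v w : pairing g (connection u v) w =
  2^-1 * (pairing (D u) v w + pairing (D v) u w - pairing (D w) u v).
Proof.
rewrite pairingZl [X in _ * X = _]pairing_def mulmxKV ?ug //; congr (_ * _).
rewrite row_mul_tr [in pairing (D w) u v](row_sum_delta w) pairing_D_sum.
rewrite (pairing_row _ v w) (pairing_row _ u w) -big_split -sumrB /=.
by apply: eq_bigr => l _; rewrite -mulrDr -mulrBr mulrC.
Qed.

Lemma connection_sym u v : connection u v = connection v u.
Proof.
apply: (pairing_nondeg ug) => w; rewrite !connectionP //.
by rewrite (pairing_sym u v (symD w)) (addrC (pairing (D u) v w)).
Qed.

Lemma connection_compat u v w :
  pairing (D u) v w = pairing g (connection u v) w + pairing g v (connection u w).
Proof.
rewrite (pairing_sym v _ symg) !connectionP.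
by rewrite (pairing_sym w v (symD u)); lra.
Qed.

Lemma connection_sumr (I : Type) (r : seq I) (c : I -> R) (f : I -> 'rV[R]_N) u :
  connection u (\sum_(i <- r) c i *: f i) = \sum_(i <- r) c i *: connection u (f i).
Proof.
apply: (pairing_nondeg ug) => w; rewrite connectionP pairing_D_sum !pairing_suml.
rewrite pairing_sumr -big_split -sumrB big_distrr /=; apply: eq_bigr => i _.
rewrite (pairingZl g (c i) (connection u (f i))) connectionP.
rewrite (pairingZl _ (c i) (f i)) pairingZr; ring.
Qed.

Lemma connection_suml (I : Type) (r : seq I) (c : I -> R) (f : I -> 'rV[R]_N) u :
  connection (\sum_(i <- r) c i *: f i) u = \sum_(i <- r) c i *: connection (f i) u.
Proof.
by rewrite connection_sym connection_sumr; apply: eq_bigr => i _; rewrite connection_sym.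
Qed.

Lemma connectionDr u v w : connection u (v + w) = connection u v + connection u w.
Proof.
have := connection_sumr [:: v; w] (fun=> 1) id u.
by rewrite !big_cons !big_nil !addr0 !scale1r.
Qed.

(** Each component becomes a bilinear form in [u] and [v] with a matrix of coefficients, so the
    product rule for pairings applies when [u] and [v] are replaced by variable fields. *)
Lemma connection_mxE u v j : connection u v 0 j =
  pairing (\matrix_(k, l) connection (e_ k) (e_ l) 0 j) u v.
Proof.
rewrite [in LHS](row_sum_delta u) connection_suml summxE pairingE.
apply: eq_bigr => k _; rewrite mxE [in LHS](row_sum_delta v) connection_sumr.
rewrite summxE big_distrr /=; apply: eq_bigr => l _.
by rewrite !mxE mulrA mulrAC.
Qed.

End PointConnection.

Section LocalGeometry.
Variables (R : realType) (N : nat) (U : set 'rV[R]_N) (G : 'rV[R]_N -> 'M[R]_N).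
Hypotheses (oU : open U) (CG : smooth_on U G).
Hypotheses (symG : forall x, U x -> (G x)^T = G x).
Hypotheses (posG : forall x, U x -> forall v, v != 0 -> 0 < pairing (G x) v v).

(** Stated entry by entry because the sums and products of the C^k calculus above are for
    real-valued functions. *)
Definition smooth_entries (X : 'rV[R]_N -> 'rV[R]_N) :=
  forall k j, Ck_on k U (fun y => X y 0 j).

Definition covariant (X Y : 'rV[R]_N -> 'rV[R]_N) (y : 'rV[R]_N) : 'rV[R]_N :=
  'D_(X y) Y y + christoffel G (X y) (Y y) y.

Local Notation chr := (christoffel G).
Local Notation e_ := (@delta_mx R 1 N 0).

Let dG y : U y -> differentiable G y.
Proof. by move=> Uy; exact: Ck_on_differentiable (CG 1) Uy. Qed.

Let uG y : U y -> G y \in unitmx.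
Proof. by move=> Uy; apply: posdef_unitmx; exact: posG. Qed.

Lemma smooth_entries_differentiable X y j : smooth_entries X -> U y ->
  differentiable (fun z => X z 0 j) y.
Proof. by move=> CX Uy; exact: Ck_on_differentiable (CX 1 j) Uy. Qed.

Lemma smooth_entries_derivable X y v : smooth_entries X -> U y -> derivable X y v.
Proof.
move=> CX Uy; apply/derivable_mxP => i j; rewrite ord1.
exact/diff_derivable/smooth_entries_differentiable.
Qed.

Lemma smooth_on_entries (X : 'rV[R]_N -> 'rV[R]_N) :
  smooth_on U X -> smooth_entries X.
Proof. by move=> CX k j; exact: Ck_on_entry oU (CX k). Qed.

Lemma derive_metric_sym v y : U y -> ('D_v G y)^T = 'D_v G y.
Proof.
move=> Uy; apply/matrixP => i j; rewrite mxE.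
apply: etrans (derive_entry v j i (dG Uy)) _.
apply: etrans _ (esym (derive_entry v i j (dG Uy))).
apply: derive_open_eq oU Uy _ => z Uz.
by rewrite -[in LHS](symG Uz) mxE.
Qed.

Let linDG y : U y -> forall (I : Type) (r : seq I) (c : I -> R) (f : I -> 'rV[R]_N),
  'D_(\sum_(i <- r) c i *: f i) G y = \sum_(i <- r) c i *: 'D_(f i) G y.
Proof. by move=> Uy I r c f; exact: derive_sum_dir (dG Uy). Qed.

Lemma christoffelP u v w y : U y ->
  pairing (G y) (chr u v y) w = 2^-1 * (pairing ('D_u G y) v w
    + pairing ('D_v G y) u w - pairing ('D_w G y) u v).
Proof. by move=> Uy; exact (connectionP (uG Uy) (linDG Uy) u v w). Qed.

Lemma christoffel_sym u v y : U y -> chr u v y = chr v u y.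
Proof.
move=> Uy.
exact (connection_sym (uG Uy) (fun v => derive_metric_sym v Uy) (linDG Uy) u v).
Qed.

Lemma christoffel_compat u v w y : U y ->
  pairing ('D_u G y) v w =
  pairing (G y) (chr u v y) w + pairing (G y) v (chr u w y).
Proof.
move=> Uy; exact (connection_compat (uG Uy) (symG Uy)
  (fun v => derive_metric_sym v Uy) (linDG Uy) u v w).
Qed.

Lemma christoffel_sumr (I : Type) (r : seq I) (c : I -> R) (f : I -> 'rV[R]_N) u y :
  U y -> chr u (\sum_(i <- r) c i *: f i) y = \sum_(i <- r) c i *: chr u (f i) y.
Proof. by move=> Uy; exact (connection_sumr (uG Uy) (linDG Uy) r c f u). Qed.

Lemma christoffel_suml (I : Type) (r : seq I) (c : I -> R) (f : I -> 'rV[R]_N) u y :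
  U y -> chr (\sum_(i <- r) c i *: f i) u y = \sum_(i <- r) c i *: chr (f i) u y.
Proof.
move=> Uy; exact (connection_suml (uG Uy) (fun v => derive_metric_sym v Uy)
  (linDG Uy) r c f u).
Qed.

Lemma christoffelDr u v w y : U y -> chr u (v + w) y = chr u v y + chr u w y.
Proof. by move=> Uy; exact (connectionDr (uG Uy) (linDG Uy) u v w). Qed.

Definition christoffel_mx (j : 'I_N) (y : 'rV[R]_N) : 'M[R]_N :=
  \matrix_(k, l) chr (e_ k) (e_ l) y 0 j.

Lemma christoffel_mxE u v y j : U y -> chr u v y 0 j = pairing (christoffel_mx j y) u v.
Proof.
move=> Uy; exact (connection_mxE (uG Uy) (fun v => derive_metric_sym v Uy)
  (linDG Uy) u v j).
Qed.

Lemma Ck_on_christoffel k u v j : Ck_on k U (fun y => chr u v y 0 j).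
Proof.
apply: (@Ck_on_eq _ _ _ _ _ (fun y => 2^-1 * \sum_l
  (pairing ('D_u G y) v (e_ l) + pairing ('D_v G y) u (e_ l)
   - pairing ('D_(e_ l) G y) u v) * invmx (G y) l j)) => //.
  move=> y Uy; rewrite /christoffel [RHS]mxE; congr (_ * _); rewrite [RHS]mxE.
  by apply: eq_bigr => l _; rewrite !mxE.
apply: Ck_onM => //; first exact: Ck_on_cst.
apply: Ck_on_sum => // l _; apply: Ck_onM => //; last first.
  apply: Ck_on_invmx => // a b; exact: Ck_on_entry oU (CG k).
have CD w a b : Ck_on k U (fun y => 'D_w G y a b).
  exact: Ck_on_entry oU (Ck_on_derive w (CG k.+1)).
apply: Ck_onB => //; last first.
  by apply: Ck_on_pairing => // i; exact: Ck_on_cst.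
by apply: Ck_onD => //; apply: Ck_on_pairing => // i; exact: Ck_on_cst.
Qed.

Lemma smooth_entries_covariant X Y : smooth_entries X -> smooth_entries Y ->
  smooth_entries (covariant X Y).
Proof.
move=> CX CY k j.
apply: (@Ck_on_eq _ _ _ _ _ (fun y => 'D_(X y) (fun z => Y z 0 j) y
  + pairing (christoffel_mx j y) (X y) (Y y))) => //.
  move=> y Uy; rewrite mxE -(christoffel_mxE _ _ _ Uy); congr (_ + _).
  by have [_ ->] := is_derive_entry 0 j (@smooth_entries_derivable Y y (X y) CY Uy).
apply: Ck_onD => //; first exact: Ck_on_derive_field.
apply: Ck_on_pairing => // a b.
by apply: Ck_on_eq (Ck_on_christoffel k (e_ a) (e_ b) j) => // y _; rewrite [RHS]mxE.
Qed.

Lemma derive_pairing_compat Y Z w x : smooth_entries Y -> smooth_entries Z -> U x ->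
  'D_w (fun y => pairing (G y) (Y y) (Z y)) x =
  pairing (G x) ('D_w Y x + chr w (Y x) x) (Z x)
  + pairing (G x) (Y x) ('D_w Z x + chr w (Z x) x).
Proof.
move=> CY CZ Ux.
have dGw : derivable G x w by apply: diff_derivable; exact: dG.
rewrite (derive_pairing dGw (@smooth_entries_derivable Y x w CY Ux)
  (@smooth_entries_derivable Z x w CZ Ux)).
rewrite (christoffel_compat _ _ _ Ux) pairingDl pairingDr; ring.
Qed.

End LocalGeometry.

(** In coordinates the moving direction [X y] becomes a list of coefficients, to which the product
    rule applies; the last term is the contribution of their variation. *)
Lemma derive_derive_field (R : realType) (N : nat) (U : set 'rV[R]_N)
    (f : 'rV[R]_N -> R) (X : 'rV[R]_N -> 'rV[R]_N) (u x : 'rV[R]_N) :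
  open U -> Ck_on 2 U f -> smooth_entries U X -> U x ->
  'D_u (fun y => 'D_(X y) f y) x =
  'D_u (fun y => 'D_(X x) f y) x + 'D_('D_u X x) f x.
Proof.
move=> oU Cf CX Ux.
have df y : U y -> differentiable f y by move=> Uy; exact: Ck_on_differentiable Cf Uy.
have dDf j : derivable (fun y => 'D_(delta_mx 0 j) f y) x u.
  by apply: diff_derivable; exact: Ck_on_differentiable (Ck_on_derive _ Cf) Ux.
have dX : derivable X x u by exact: smooth_entries_derivable CX Ux.
have hD j := derivableP (dDf j).
have hX j := is_derive_entry 0 j dX.
have E (w : 'rV[R]_N) y : U y -> 'D_w f y = \sum_j w 0 j * 'D_(delta_mx 0 j) f y.
  by move=> Uy; rewrite (derive_rV w (df y Uy)).
rewrite (derive_open_eq u oU Ux (fun y Uy => E (X y) y Uy)).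
rewrite (derive_open_eq u oU Ux (fun y Uy => E (X x) y Uy)) (E _ _ Ux).
have h1 : is_derive x u (fun y => \sum_j X y 0 j * 'D_(delta_mx 0 j) f y)
    (\sum_j (X x 0 j *: 'D_u (fun y => 'D_(delta_mx 0 j) f y) x
      + 'D_(delta_mx 0 j) f x *: 'D_u X x 0 j)).
  by apply: is_derive_bigsum => j _; exact: is_deriveM (hX j) (hD j).
have h2 : is_derive x u (fun y => \sum_j X x 0 j * 'D_(delta_mx 0 j) f y)
    (\sum_j X x 0 j *: 'D_u (fun y => 'D_(delta_mx 0 j) f y) x).
  by apply: is_derive_bigsum => j _; exact: is_deriveZ (hD j).
have [_ ->] := h1; have [_ ->] := h2.
by rewrite big_split /=; congr (_ + _); apply: eq_bigr => j _; rewrite [LHS]mulrC.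
Qed.

(** * Curvature along commuting fields *)

Section Curvature.
Variables (R : realType) (N : nat) (U : set 'rV[R]_N) (G : 'rV[R]_N -> 'M[R]_N).
Hypotheses (oU : open U) (CG : smooth_on U G).
Hypotheses (symG : forall x, U x -> (G x)^T = G x).
Hypotheses (posG : forall x, U x -> forall v, v != 0 -> 0 < pairing (G x) v v).

Local Notation chr := (christoffel G).
Local Notation cov := (covariant G).

Lemma christoffel_derivable u v w x : U x -> derivable (chr u v) x w.
Proof.
move=> Ux; apply/derivable_mxP => i j; rewrite ord1; apply: diff_derivable.
exact: Ck_on_differentiable (Ck_on_christoffel oU CG posG 1 u v j) Ux.
Qed.

Lemma derive_covariant X Y u x j : smooth_entries U X -> smooth_entries U Y -> U x ->
  'D_u (cov X Y) x 0 j =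
  'D_u (fun y => 'D_(X x) (fun z => Y z 0 j) y) x
  + 'D_('D_u X x) (fun z => Y z 0 j) x + 'D_u (chr (X x) (Y x)) x 0 j
  + chr ('D_u X x) (Y x) x 0 j + chr (X x) ('D_u Y x) x 0 j.
Proof.
move=> CX CY Ux.
have dX : derivable X x u by exact: smooth_entries_derivable CX Ux.
have dY : derivable Y x u by exact: smooth_entries_derivable CY Ux.
have Ccov := smooth_entries_covariant oU CG symG posG CX CY.
have dcov : derivable (cov X Y) x u by exact: smooth_entries_derivable Ccov Ux.
have [_ <-] := is_derive_entry 0 j dcov.
pose Gam y := christoffel_mx G j y.
have E y : U y -> cov X Y y 0 j =
    'D_(X y) (fun z => Y z 0 j) y + pairing (Gam y) (X y) (Y y).
  move=> Uy; rewrite /covariant mxE -(christoffel_mxE oU CG symG posG _ _ _ Uy).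
  congr (_ + _).
  by have [_ ->] := is_derive_entry 0 j (@smooth_entries_derivable _ _ _ Y y (X y) CY Uy).
rewrite (derive_open_eq u oU Ux E).
have dGam : derivable Gam x u.
  apply/derivable_mxP => a b.
  rewrite (_ : (fun y => Gam y a b) = (fun y => chr (delta_mx 0 a) (delta_mx 0 b) y 0 j)).
    apply: diff_derivable.
    exact: Ck_on_differentiable (Ck_on_christoffel oU CG posG 1 _ _ j) Ux.
  by apply/funext => y; rewrite mxE.
have d1 : derivable (fun y => 'D_(X y) (fun z => Y z 0 j) y) x u.
  apply: diff_derivable; apply: (@Ck_on_differentiable _ _ _ 0 U) Ux.
  exact: Ck_on_derive_field oU (CY 2 j) (CX 1).
have hp := is_derive_pairing dGam dX dY.
have h := is_deriveD (derivableP d1) hp.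
have [_ Eh] := h; apply: etrans Eh _.
rewrite (derive_derive_field u oU (CY 2 j) CX Ux) -!addrA; congr (_ + (_ + _)).
rewrite !(christoffel_mxE oU CG symG posG _ _ _ Ux) !addrA; congr (_ + _ + _).
have [_ <-] := is_derive_entry 0 j (@christoffel_derivable (X x) (Y x) u x Ux).
have Ec y : U y -> chr (X x) (Y x) y 0 j = pairing (Gam y) (X x) (Y x).
  by move=> Uy; rewrite -(christoffel_mxE oU CG symG posG _ _ _ Uy).
rewrite (derive_open_eq u oU Ux Ec).
have hc := is_derive_pairing dGam (derivable_cst (X x) x u) (derivable_cst (Y x) x u).
have [_ ->] := hc.
by rewrite !derive_cst pairing0l pairing0r !addr0.
Qed.

(** [curvature] is defined with constant fields; its tensoriality gives the formula for variable
    ones. The commutation hypothesis says that [[X, Y]] vanishes at [x], so there is no term with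
    the derivative along the bracket. *)
Lemma curvature_covariant X Y Z x :
  smooth_entries U X -> smooth_entries U Y -> smooth_entries U Z -> U x ->
  'D_(X x) Y x = 'D_(Y x) X x ->
  curvature G x (X x) (Y x) (Z x) =
  cov X (cov Y Z) x - cov Y (cov X Z) x.
Proof.
move=> CX CY CZ Ux comm; apply/rowP => j.
have rD (a b : 'rV[R]_N) : (a + b) 0 j = a 0 j + b 0 j by rewrite mxE.
have sum7 (a b c d p q r t1 t2 : R) : q = a + b + c + d + p -> r = t1 + t2 ->
    q + r = a + b + c + d + p + t1 + t2 by move=> -> ->; rewrite !addrA.
(* Each iterated derivative expands into seven terms: [s] are second derivatives of [Z], equal by
   Schwarz; [d] and [e] contain the derivative of one field along the other, equal by commutation;
   [k1] and [k2] change places. The four remaining terms are the curvature. *)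
have cancel7 (p q s1 s2 d1 d2 c1 c2 e1 e2 k1 k2 g1 g2 : R) :
    p = s1 + d1 + c1 + e1 + k1 + k2 + g1 -> q = s2 + d2 + c2 + e2 + k2 + k1 + g2 ->
    s1 = s2 -> d1 = d2 -> e1 = e2 -> c1 + g1 - c2 - g2 = p - q.
  by move=> -> -> -> -> ->; ring.
have rB (a b : 'rV[R]_N) : (a - b) 0 j = a 0 j - b 0 j by rewrite !mxE.
have r4 (a b c d : 'rV[R]_N) : (a + b - c - d) 0 j = a 0 j + b 0 j - c 0 j - d 0 j.
  by rewrite !mxE.
have expand A B : smooth_entries U A -> smooth_entries U B ->
    cov A (cov B Z) x 0 j =
    'D_(A x) (fun y => 'D_(B x) (fun z => Z z 0 j) y) x
    + 'D_('D_(A x) B x) (fun z => Z z 0 j) x + 'D_(A x) (chr (B x) (Z x)) x 0 j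
    + chr ('D_(A x) B x) (Z x) x 0 j + chr (B x) ('D_(A x) Z x) x 0 j
    + chr (A x) ('D_(B x) Z x) x 0 j + chr (A x) (chr (B x) (Z x) x) x 0 j.
  move=> CA CB.
  have E0 : cov A (cov B Z) x 0 j =
      'D_(A x) (cov B Z) x 0 j + chr (A x) (cov B Z x) x 0 j.
    by rewrite {1}/covariant; exact: rD.
  apply: etrans E0 _.
  have E := christoffelDr CG posG (A x) ('D_(B x) Z x) (chr (B x) (Z x) x) Ux.
  have {}E : chr (A x) (cov B Z x) x 0 j =
      chr (A x) ('D_(B x) Z x) x 0 j + chr (A x) (chr (B x) (Z x) x) x 0 j.
    exact: etrans (congr1 (fun w : 'rV[R]_N => w 0 j) E) (rD _ _).
  exact: sum7 (derive_covariant _ _ CB CZ Ux) E.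
apply: etrans _ (esym (rB (cov X (cov Y Z) x) _)).
apply: etrans (r4 _ _ _ _) _.
refine (cancel7 _ _ _ _ _ _ _ _ _ _ _ _ _ _ (expand X Y CX CY) (expand Y X CY CX) _ _ _).
- exact: (derive_comm oU (CZ 2 j) (X x) (Y x) Ux).
- by rewrite comm.
- by rewrite comm.
Qed.

End Curvature.

Definition lie_fun (R : realType) N (X : 'rV[R]_N -> 'rV[R]_N) (f : 'rV[R]_N -> R)
  (y : 'rV[R]_N) : R := 'D_(X y) f y.

Section SectionalCurvature.
Variables (R : realType) (N : nat) (U : set 'rV[R]_N) (G : 'rV[R]_N -> 'M[R]_N).
Hypotheses (oU : open U) (CG : smooth_on U G).
Hypotheses (symG : forall x, U x -> (G x)^T = G x).
Hypotheses (posG : forall x, U x -> forall v, v != 0 -> 0 < pairing (G x) v v).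

Local Notation chr := (christoffel G).
Local Notation cov := (covariant G).

Lemma Ck_on_gram k X Y : smooth_entries U X -> smooth_entries U Y ->
  Ck_on k U (fun y => pairing (G y) (X y) (Y y)).
Proof.
by move=> CX CY; apply: Ck_on_pairing => // i j; exact: Ck_on_entry oU (CG k).
Qed.

Lemma covariant_sym X Y y : U y -> 'D_(X y) Y y = 'D_(Y y) X y ->
  cov X Y y = cov Y X y.
Proof.
by move=> Uy E; rewrite /covariant E (christoffel_sym oU CG symG posG).
Qed.

Section Pair.
Variables X Y : 'rV[R]_N -> 'rV[R]_N.
Hypotheses (CX : smooth_entries U X) (CY : smooth_entries U Y).
Hypothesis XY : forall y, U y -> 'D_(X y) Y y = 'D_(Y y) X y.
Hypothesis orthXY : forall y, U y -> pairing (G y) (X y) (Y y) = 0.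

Let halve (a b c : R) : a = b -> b + a = c -> a = 2^-1 * c.
Proof. by move=> -> <-; lra. Qed.

Lemma pairing_cov_dir y : U y ->
  pairing (G y) (cov X Y y) (X y) = 2^-1 * lie_fun Y (fun z => pairing (G z) (X z) (X z)) y.
Proof.
move=> Uy; rewrite (covariant_sym Uy (XY Uy)).
apply: (halve (pairing_sym _ _ (symG Uy))); apply: etrans (addrC _ _) _.
exact: esym (derive_pairing_compat oU CG symG posG (Y y) CX CX Uy).
Qed.

Lemma pairing_cov_self y : U y ->
  pairing (G y) (cov Y Y y) (X y) =
  - (2^-1 * lie_fun X (fun z => pairing (G z) (Y z) (Y z)) y).
Proof.
move=> Uy.
have E1 := derive_pairing_compat oU CG symG posG (Y y) CY CX Uy.
have E0 : 'D_(Y y) (fun z => pairing (G z) (Y z) (X z)) y = 0.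
  apply: etrans (derive_cst (0 : R) y (Y y)).
  apply: derive_open_eq oU Uy _ => z Uz.
  by rewrite (pairing_sym _ _ (symG Uz)) orthXY.
have E2 := derive_pairing_compat oU CG symG posG (X y) CY CY Uy.
have E3 := pairing_sym (Y y) (cov X Y y) (symG Uy).
have E4 : pairing (G y) (Y y) (cov Y X y) = pairing (G y) (Y y) (cov X Y y).
  by rewrite (covariant_sym Uy (XY Uy)).
have aux (a b c d z l : R) : z = 0 -> z = a + b -> b = c -> l = d + c -> c = d ->
  a = - (2^-1 * l) by move=> z0 E bc l1 cd; rewrite l1; move: E; rewrite z0 bc cd; lra.
exact: aux E0 E1 E4 E2 E3.
Qed.

(** Moving the outer covariant derivatives onto the pairing leaves [X] applied to the product of
    [cov Y Y] with [X], and [Y] applied to that of [cov X Y] with [X]. By orthogonality and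
    commutation both products are halves of derivatives of squared lengths, whence the second
    derivatives. *)
Lemma sectional_curvature x : U x ->
  pairing (G x) (curvature G x (X x) (Y x) (Y x)) (X x) =
  - (2^-1 * lie_fun X (lie_fun X (fun z => pairing (G z) (Y z) (Y z))) x)
  - 2^-1 * lie_fun Y (lie_fun Y (fun z => pairing (G z) (X z) (X z))) x
  + pairing (G x) (cov X Y x) (cov X Y x) - pairing (G x) (cov X X x) (cov Y Y x).
Proof.
move=> Ux.
rewrite (curvature_covariant oU CG symG posG CX CY CY Ux (XY Ux)) pairingBl.
have CYY := smooth_entries_covariant oU CG symG posG CY CY.
have CXY := smooth_entries_covariant oU CG symG posG CX CY.
have E1 := derive_pairing_compat oU CG symG posG (X x) CYY CX Ux.
have E2 := derive_pairing_compat oU CG symG posG (Y x) CXY CX Ux.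
have dL (u Z : 'rV[R]_N -> 'rV[R]_N) : smooth_entries U Z -> smooth_entries U u ->
    forall v, derivable (lie_fun Z (fun z => pairing (G z) (u z) (u z))) x v.
  move=> CZ Cu v; apply: diff_derivable; apply: (@Ck_on_differentiable _ _ _ 0 U) Ux.
  exact: Ck_on_derive_field oU (Ck_on_gram 2 Cu Cu) (CZ 1).
have D1 : 'D_(X x) (fun y => pairing (G y) (cov Y Y y) (X y)) x =
    - (2^-1 * lie_fun X (lie_fun X (fun z => pairing (G z) (Y z) (Y z))) x).
  apply: etrans (derive_open_eq (X x) oU Ux pairing_cov_self) _.
  have h := is_deriveN (is_deriveZ 2^-1 (derivableP (dL Y X CX CY (X x)))).
  by have [_ E] := h; exact: E.
have D2 : 'D_(Y x) (fun y => pairing (G y) (cov X Y y) (X y)) x =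
    2^-1 * lie_fun Y (lie_fun Y (fun z => pairing (G z) (X z) (X z))) x.
  apply: etrans (derive_open_eq (Y x) oU Ux pairing_cov_dir) _.
  have h := is_deriveZ 2^-1 (derivableP (dL X Y CY CX (Y x))).
  by have [_ E] := h; exact: E.
have E3 : pairing (G x) (cov X Y x) (cov Y X x) = pairing (G x) (cov X Y x) (cov X Y x).
  by rewrite (covariant_sym Ux (XY Ux)).
have E4 := pairing_sym (cov Y Y x) (cov X X x) (symG Ux).
have aux (k1 k2 l1 l2 d1 d2 q1 q2 q2' q1' : R) : d1 = k1 + q1 -> d2 = k2 + q2 ->
    d1 = l1 -> d2 = l2 -> q2 = q2' -> q1 = q1' -> k1 - k2 = l1 - l2 + q2' - q1'.
  by move=> -> -> <- <- -> ->; ring.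
exact: aux E1 E2 D1 D2 E3 E4.
Qed.

End Pair.
End SectionalCurvature.

Lemma sum4E (R : realType) (s : nat) (A B : 'I_s -> R) (F : 'I_s -> 'I_s -> R) :
  (\sum_p \sum_q A p * B q * F p q) = \sum_p A p * \sum_q B q * F p q.
Proof.
by apply: eq_bigr => p _; rewrite big_distrr; apply: eq_bigr => q _; rewrite /= mulrA.
Qed.

(** * Combinations of commuting fields with constant coefficients *)

Section Combinations.
Variables (R : realType) (N s : nat) (U : set 'rV[R]_N) (G : 'rV[R]_N -> 'M[R]_N).
Hypotheses (oU : open U) (CG : smooth_on U G).
Hypotheses (symG : forall x, U x -> (G x)^T = G x).
Hypotheses (posG : forall x, U x -> forall v, v != 0 -> 0 < pairing (G x) v v).
Variable X : 'I_s -> 'rV[R]_N -> 'rV[R]_N.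
Hypothesis CX : forall p, smooth_entries U (X p).
Hypothesis XX : forall p q y, U y -> 'D_(X p y) (X q) y = 'D_(X q y) (X p) y.

Local Notation chr := (christoffel G).
Local Notation cov := (covariant G).
Implicit Types A B : 'I_s -> R.

(** A frame vector at one point is extended to a field with constant coefficients. Such fields still
    commute and still respect the orthogonality of the two families, though they are orthonormal
    only at that point. *)
Definition comb A (y : 'rV[R]_N) : 'rV[R]_N := \sum_p A p *: X p y.

Definition gram p q (y : 'rV[R]_N) : R := pairing (G y) (X p y) (X q y).

Definition second_lie p q i j := lie_fun (X p) (lie_fun (X q) (gram i j)).

Lemma smooth_entries_comb A : smooth_entries U (comb A).
Proof.
move=> k j; apply: (@Ck_on_eq _ _ _ _ _ (fun y => \sum_p A p * X p y 0 j)) => //.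
  by move=> y _; rewrite summxE; apply: eq_bigr => p _; rewrite [RHS]mxE.
apply: Ck_on_sum => // p _; apply: Ck_onM => //; [exact: Ck_on_cst|exact: CX].
Qed.

Lemma derive_comb A w y : U y -> 'D_w (comb A) y = \sum_p A p *: 'D_w (X p) y.
Proof.
move=> Uy.
have E : comb A = \sum_p (A p *: X p) by apply/funext => z; rewrite fct_sumE.
have d p : derivable (X p) y w by exact: smooth_entries_derivable (CX p) Uy.
rewrite E derive_sum; last by move=> p; exact: derivableZ.
by apply: eq_bigr => p _; rewrite (deriveZ _ (d p)).
Qed.

Let dX p y i j : U y -> differentiable (fun z => X p z i j) y.
Proof. by rewrite ord1 => Uy; exact: smooth_entries_differentiable (CX p) Uy. Qed.

Lemma derive_comb_dir A p y : U y ->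
  'D_(comb A y) (X p) y = \sum_q A q *: 'D_(X q y) (X p) y.
Proof.
move=> Uy; apply/rowP => j; rewrite summxE.
have dx v : derivable (X p) y v by exact: smooth_entries_derivable (CX p) Uy.
have [_ <-] := is_derive_entry 0 j (dx (comb A y)).
rewrite (derive_sum_dir _ _ _ _ (dX p 0 j Uy)); apply: eq_bigr => q _.
rewrite mxE; have [_ ->] := is_derive_entry 0 j (dx (X q y)); exact: erefl.
Qed.

Lemma derive_comb2 A B y : U y ->
  'D_(comb A y) (comb B) y = \sum_p \sum_q (A p * B q) *: 'D_(X p y) (X q) y.
Proof.
move=> Uy; rewrite (derive_comb _ _ Uy) exchange_big; apply: eq_bigr => q _.
rewrite (derive_comb_dir _ _ Uy) scaler_sumr; apply: eq_bigr => p _.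
by rewrite scalerA mulrC.
Qed.

Lemma comb_commute A B y : U y -> 'D_(comb A y) (comb B) y = 'D_(comb B y) (comb A) y.
Proof.
move=> Uy; rewrite !derive_comb2 // exchange_big; apply: eq_bigr => q _.
by apply: eq_bigr => p _; rewrite mulrC XX.
Qed.

Lemma covariant_comb A B y : U y ->
  cov (comb A) (comb B) y = \sum_p \sum_q (A p * B q) *: cov (X p) (X q) y.
Proof.
move=> Uy; rewrite {1}/covariant derive_comb2 //.
rewrite [X in chr X](_ : comb A y = \sum_p A p *: X p y) //.
rewrite (christoffel_suml oU CG symG posG _ _ _ _ Uy) -big_split; apply: eq_bigr => p _.
rewrite /= [comb B y](_ : _ = \sum_q B q *: X q y) //.
rewrite (christoffel_sumr CG posG _ _ _ _ Uy) scaler_sumr -big_split.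
by apply: eq_bigr => q _; rewrite /= scalerA -scalerDr.
Qed.

Lemma lie_fun_comb A f y : differentiable f y ->
  lie_fun (comb A) f y = \sum_p A p * lie_fun (X p) f y.
Proof. by move=> df; rewrite /lie_fun (derive_sum_dir _ _ _ _ df). Qed.

Lemma gram_comb A B y :
  pairing (G y) (comb A y) (comb B y) = \sum_p \sum_q A p * B q * gram p q y.
Proof.
rewrite sum4E pairing_suml; apply: eq_bigr => p _; rewrite pairingZl; congr (_ * _).
by rewrite pairing_sumr; apply: eq_bigr => q _; rewrite pairingZr.
Qed.

Lemma Ck_on_gramX k p q : Ck_on k U (gram p q).
Proof. exact (Ck_on_gram oU CG k (CX p) (CX q)). Qed.

Lemma Ck_on_lie_gram k p i j : Ck_on k U (lie_fun (X p) (gram i j)).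
Proof. exact (Ck_on_derive_field oU (Ck_on_gramX k.+1 i j) (CX p k)). Qed.

Lemma Ck_on_second_lie k p q i j : Ck_on k U (second_lie p q i j).
Proof. exact (Ck_on_derive_field oU (Ck_on_lie_gram k.+1 q i j) (CX p k)). Qed.

Lemma second_lie_comb A B x : U x ->
  lie_fun (comb A) (lie_fun (comb A) (fun z => pairing (G z) (comb B z) (comb B z))) x =
  \sum_p \sum_q \sum_i \sum_j A p * A q * B i * B j * second_lie p q i j x.
Proof.
move=> Ux.
have dg i j y : U y -> differentiable (gram i j) y.
  by move=> Uy; exact: Ck_on_differentiable (Ck_on_gramX 1 i j) Uy.
have dl q i j y : U y -> differentiable (lie_fun (X q) (gram i j)) y.
  by move=> Uy; exact: Ck_on_differentiable (Ck_on_lie_gram 1 q i j) Uy.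
have E1 y : U y ->
    lie_fun (comb A) (fun z => pairing (G z) (comb B z) (comb B z)) y =
    \sum_q \sum_i \sum_j A q * B i * B j * lie_fun (X q) (gram i j) y.
  move=> Uy.
  have C : Ck_on 1 U (fun z => pairing (G z) (comb B z) (comb B z)).
    exact (Ck_on_gram oU CG 1%N (smooth_entries_comb B) (smooth_entries_comb B)).
  rewrite lie_fun_comb; last exact: Ck_on_differentiable C Uy.
  apply: eq_bigr => q _.
  have h : is_derive y (X q y) (fun z => \sum_i \sum_j B i * B j * gram i j z)
      (\sum_i \sum_j B i * B j * lie_fun (X q) (gram i j) y).
    apply: is_derive_bigsum => i _; apply: is_derive_bigsum => j _.
    exact: is_deriveZ (derivableP (diff_derivable (dg i j y Uy))).
  have {1}-> : (fun z => pairing (G z) (comb B z) (comb B z)) =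
      (fun z => \sum_i \sum_j B i * B j * gram i j z).
    by apply/funext => z; rewrite gram_comb.
  rewrite {1}/lie_fun; have [_ ->] := h.
  rewrite big_distrr; apply: eq_bigr => i _; rewrite big_distrr; apply: eq_bigr => j _.
  by rewrite /= !mulrA.
have C2 : Ck_on 1 U (fun y =>
    \sum_q \sum_i \sum_j A q * B i * B j * lie_fun (X q) (gram i j) y).
  do 3 (apply: Ck_on_sum => // ? _); apply: Ck_onM => //; first exact: Ck_on_cst.
  exact: Ck_on_lie_gram.
apply: etrans (derive_open_eq (comb A x) oU Ux E1) _.
apply: etrans (lie_fun_comb A (Ck_on_differentiable C2 Ux)) _.
apply: eq_bigr => p _.
have h : is_derive x (X p x)
    (fun y => \sum_q \sum_i \sum_j A q * B i * B j * lie_fun (X q) (gram i j) y)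
    (\sum_q \sum_i \sum_j A q * B i * B j * second_lie p q i j x).
  do 3 (apply: is_derive_bigsum => ? _).
  exact: is_deriveZ (derivableP (diff_derivable (dl _ _ _ _ Ux))).
rewrite {1}/lie_fun; have [_ ->] := h.
rewrite big_distrr; apply: eq_bigr => q _; rewrite big_distrr; apply: eq_bigr => i _.
by rewrite /= big_distrr; apply: eq_bigr => j _; rewrite /= !mulrA.
Qed.

End Combinations.

(** * Orthonormal frames and Gram matrices *)

Lemma row_free_mul0 (F : fieldType) p m n (A : 'M[F]_(m, n)) (v : 'M[F]_(p, m)) :
  row_free A -> v *m A = 0 -> v = 0.
Proof. by move=> fA /eqP; rewrite mulmx_free_eq0 // => /eqP. Qed.

Section Frames.
Variables (R : realType) (N : nat) (G : 'M[R]_N).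
Hypotheses (symG : G^T = G) (posG : forall v, v != 0 -> 0 < pairing G v v).

(** The first row is treated last: the rows below it are made orthonormal by induction, then it is
    projected off their span and normalised. *)
Lemma gram_schmidt k (A : 'M[R]_(k, N)) : row_free A ->
  exists2 E : 'M[R]_(k, N), (E == A)%MS & E *m G *m E^T = 1%:M.
Proof.
elim: k A => [|k IH] A fA.
  exists A; first exact/andP.
  by apply/matrixP => -[].
rewrite -[k.+1]/(1 + k)%N in A fA *.
have [fa fA'] : row_free (usubmx A) /\ row_free (dsubmx A).
  rewrite -!kermx_eq0; split; apply/eqP/row_matrixP => i; rewrite row0;
    set v := row i _.
    have : row_mx v 0 *m A = 0.
      rewrite -[A in LHS]vsubmxK mul_row_col mul0mx addr0.
      by apply/sub_kermxP; exact: row_sub.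
    by move/(row_free_mul0 fA)/(congr1 lsubmx); rewrite row_mxKl linear0.
  have : row_mx 0 v *m A = 0.
    rewrite -[A in LHS]vsubmxK mul_row_col mul0mx add0r.
    by apply/sub_kermxP; exact: row_sub.
  by move/(row_free_mul0 fA)/(congr1 rsubmx); rewrite row_mxKr linear0.
have [E' /eqmxP EA' oE'] := IH _ fA'.
set a := usubmx A in fa *.
pose b := a - a *m G *m E'^T *m E'.
have bE : b *m G *m E'^T = 0.
  by rewrite !mulmxBl -!mulmxA (mulmxA E') oE' mulmx1 subrr.
have bsub : (a *m G *m E'^T *m E' <= dsubmx A)%MS.
  by rewrite -EA' submxMl.
(* If [b] were 0, the first row of [A] would be a combination of the others, against freeness. *)
have b0 : b != 0.
  apply/negP => /eqP b0; have ab : a = a *m G *m E'^T *m E'.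
    by apply/eqP; rewrite -subr_eq0 -/b b0.
  have /submxP[c ac] : (a <= dsubmx A)%MS by rewrite ab.
  have : row_mx 1%:M (- c) *m A = 0.
    by rewrite -[A]vsubmxK mul_row_col mul1mx mulNmx -ac subrr.
  move/(row_free_mul0 fA)/(congr1 lsubmx); rewrite row_mxKl linear0 => /matrixP/(_ 0 0).
  by rewrite !mxE => /eqP; rewrite oner_eq0.
have bb := posG b0.
pose n := (Num.sqrt (pairing G b b))^-1.
have n0 : n != 0 by rewrite invr_neq0 // gt_eqF // sqrtr_gt0.
exists (col_mx (n *: b) E').
  apply/eqmxP; apply: eqmx_trans (eqmx_sym (addsmxE _ _)) _.
  apply: eqmx_trans (adds_eqmx (eqmx_scale b n0) EA') _.
  rewrite -[A in X in (_ :=: X)%MS]vsubmxK; apply: eqmx_trans _ (addsmxE _ _).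
  apply/eqmxP; rewrite !addsmx_sub !addsmxSr !andbT /=; apply/andP; split.
    by rewrite addmx_sub ?addsmxSl // eqmx_opp (submx_trans bsub) ?addsmxSr.
  have Ea : usubmx A = b + a *m G *m E'^T *m E' by rewrite subrK.
  rewrite [X in (X <= _)%MS]Ea.
  by rewrite addmx_sub ?addsmxSl // (submx_trans bsub) ?addsmxSr.
rewrite mul_col_mx tr_col_mx mul_col_row oE' -!scalemxAl bE scaler0.
have -> : E' *m G *m (n *: b)^T = 0.
  apply: trmx_inj; rewrite linear0 trmx_mul trmxK trmx_mul symG.
  by rewrite -scalemxAl mulmxA bE scaler0.
have -> : n *: (b *m G *m (n *: b)^T) = 1%:M.
  rewrite linearZ -scalemxAr scalerA [b *m G *m b^T]mx11_scalar -pairing_def.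
  rewrite scale_scalar_mx -expr2 /n exprVn sqr_sqrtr; last exact: ltW.
  by rewrite mulVf ?gt_eqF.
by rewrite -scalar_mx_block.
Qed.

(** Gram-Schmidt applied to a row basis shows that the set in [orthonormal_frame] is inhabited, so
    the default 0 of [xget] is never the value. *)
Lemma orthonormal_frameP (A : 'M[R]_N) :
  (orthonormal_frame G A == A)%MS /\
  orthonormal_frame G A *m G *m (orthonormal_frame G A)^T = 1%:M.
Proof.
have [E EA oE] := gram_schmidt (row_base_free A).
have h : [set E : 'M[R]_(\rank A, N) | (E == A)%MS /\ E *m G *m E^T = 1%:M] E.
  by split=> //; apply/eqmxP/(eqmx_trans (eqmxP EA))/eq_row_base.
exact: (xgetPex 0 (ex_intro _ E h)).
Qed.

Variables (s : nat) (P : pred 'I_s) (X : 'I_s -> 'rV[R]_N).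
Hypothesis freeX : row_free (\matrix_p X p).
Local Notation D := (\sum_(p < s | P p) <<X p>>)%MS.
Local Notation Xi := (\matrix_p X p).

Lemma span_coef (u : 'rV[R]_N) : (u <= D)%MS ->
  exists2 a : 'I_s -> R, (forall p, ~~ P p -> a p = 0) & u = \sum_p a p *: X p.
Proof.
move=> /sub_sumsmxP[c ->].
have h p : exists a, c p *m <<X p>>%MS = a *: X p.
  by apply/sub_rVP; rewrite (submx_trans (submxMl _ _)) // genmxE.
exists (fun p => if P p then sval (cid (h p)) else 0).
  by move=> p /negbTE ->.
rewrite big_mkcond; apply: eq_bigr => p _; case: ifP => Pp; rewrite ?scale0r //.
exact: svalP (cid (h p)).
Qed.

(** For the last clause, [X b] lies in the span, so its expansion in the orthonormal frame is
    [X b *m G *m E^T *m E]; written in the free family [X], its coefficients are row [b] of the Gram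
    matrix times [A^T *m A]. *)
Lemma frame_coef r (E : 'M[R]_(r, N)) : (E == D)%MS -> E *m G *m E^T = 1%:M ->
  exists A : 'M[R]_(r, s), [/\ E = A *m Xi, forall a p, ~~ P p -> A a p = 0 &
    forall b, P b -> row b (Xi *m G *m Xi^T *m (A^T *m A)) = delta_mx 0 b].
Proof.
move=> /eqmxP ED oE.
have h a : exists c : 'I_s -> R,
    (forall p, ~~ P p -> c p = 0) /\ row a E = \sum_p c p *: X p.
  have [|c c0 Ec] := @span_coef (row a E); first by rewrite -ED row_sub.
  by exists c.
pose A := \matrix_(a, p) sval (cid (h a)) p.
have EA : E = A *m Xi.
  apply/row_matrixP => a; rewrite row_mul mulmx_sum_row.
  have [_ ->] := svalP (cid (h a)).
  by apply: eq_bigr => p _; rewrite rowK !mxE.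
exists A; split=> //.
  by move=> a p Pp; rewrite mxE; have [-> ] := svalP (cid (h a)).
move=> b Pb.
have bD : (X b <= E)%MS.
  by rewrite ED (sumsmx_sup b) // genmxE.
have /submxP[c Xc] := bD.
have cE : c = X b *m G *m E^T by rewrite Xc -!mulmxA (mulmxA E) oE mulmx1.
apply: (row_free_inj freeX); rewrite -rowE rowK [RHS]Xc cE EA.
have -> : X b = row b Xi by rewrite rowK.
by rewrite -!row_mul trmx_mul !mulmxA.
Qed.

End Frames.

(** Orthogonality makes [gam] block diagonal. Each of [A^T *m A] and [B^T *m B] lives in one block
    and inverts it, so their sum inverts [gam]. *)
Lemma frame_gram_inverse (R : realType) N s m (G : 'M[R]_N) (X : 'I_s -> 'rV[R]_N)
    r1 r2 (A : 'M[R]_(r1, s)) (B : 'M[R]_(r2, s)) :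
  let Xi := \matrix_p X p in let gam := Xi *m G *m Xi^T in
  (forall p i : 'I_s, (p < m)%N -> (m <= i)%N -> gam p i = 0 /\ gam i p = 0) ->
  (forall a (p : 'I_s), ~~ (p < m)%N -> A a p = 0) ->
  (forall a (p : 'I_s), ~~ (m <= p)%N -> B a p = 0) ->
  (forall b : 'I_s, (b < m)%N -> row b (gam *m (A^T *m A)) = delta_mx 0 b) ->
  (forall b : 'I_s, (m <= b)%N -> row b (gam *m (B^T *m B)) = delta_mx 0 b) ->
  A^T *m A + B^T *m B = invmx gam.
Proof.
move=> Xi gam orth A0 B0 hA hB.
have H : gam *m (A^T *m A + B^T *m B) = 1%:M.
  apply/row_matrixP => b; rewrite mulmxDr row1 linearD /=.
  have [bm|mb] := ltnP b m.
    rewrite hA // [X in _ + X](_ : _ = 0) ?addr0 //; apply/rowP => j; rewrite !mxE.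
    apply: big1 => k _; have [km|mk] := ltnP k m; last by rewrite (orth b k bm mk).1 mul0r.
    by rewrite [(B^T *m B) k j]mxE big1 ?mulr0 // => a _; rewrite mxE B0 ?mul0r // -ltnNge.
  rewrite hB // [X in X + _](_ : _ = 0) ?add0r //; apply/rowP => j; rewrite !mxE.
  apply: big1 => k _; have [km|mk] := ltnP k m; first by rewrite (orth k b km mb).2 mul0r.
  by rewrite [(A^T *m A) k j]mxE big1 ?mulr0 // => a _; rewrite mxE A0 ?mul0r // -leqNgt.
have [ug _] := mulmx1_unit H.
by rewrite -[LHS](mulKmx ug) H mulmx1.
Qed.

(** * Rearrangement of fourfold sums *)

Section SumExchange.
Variables (R : realType) (s : nat).

Lemma sum4_in r (f : 'I_r -> 'I_s -> 'I_s -> 'I_s -> 'I_s -> R) :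
  \sum_a \sum_p \sum_q \sum_i \sum_j f a p q i j =
  \sum_p \sum_q \sum_i \sum_j \sum_a f a p q i j.
Proof.
rewrite exchange_big; apply: eq_bigr => p _.
rewrite exchange_big; apply: eq_bigr => q _.
by rewrite exchange_big; apply: eq_bigr => i _; rewrite exchange_big.
Qed.

Lemma sum4_swap (f : 'I_s -> 'I_s -> 'I_s -> 'I_s -> R) :
  \sum_i \sum_j \sum_p \sum_q f p q i j = \sum_p \sum_q \sum_i \sum_j f p q i j.
Proof.
under eq_bigr do rewrite exchange_big; rewrite exchange_big; apply: eq_bigr => p _.
under eq_bigr do rewrite exchange_big; by rewrite exchange_big.
Qed.

Lemma sum4_mid (f : 'I_s -> 'I_s -> 'I_s -> 'I_s -> R) :
  \sum_p \sum_i \sum_q \sum_j f p q i j = \sum_p \sum_q \sum_i \sum_j f p q i j.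
Proof. by apply: eq_bigr => p _; rewrite exchange_big. Qed.

Lemma eq_sum4 (f g : 'I_s -> 'I_s -> 'I_s -> 'I_s -> R) :
  (forall p q i j, f p q i j = g p q i j) ->
  \sum_p \sum_q \sum_i \sum_j f p q i j = \sum_p \sum_q \sum_i \sum_j g p q i j.
Proof. by move=> fg; do 4 (apply: eq_bigr => ? _). Qed.

Lemma sum4D (f g : 'I_s -> 'I_s -> 'I_s -> 'I_s -> R) :
  \sum_p \sum_q \sum_i \sum_j (f p q i j + g p q i j) =
  \sum_p \sum_q \sum_i \sum_j f p q i j + \sum_p \sum_q \sum_i \sum_j g p q i j.
Proof. by do 4 (rewrite -big_split; apply: eq_bigr => ? _). Qed.

Lemma sum4Z (a : R) (f : 'I_s -> 'I_s -> 'I_s -> 'I_s -> R) :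
  a * (\sum_p \sum_q \sum_i \sum_j f p q i j) =
  \sum_p \sum_q \sum_i \sum_j a * f p q i j.
Proof. by do 4 (rewrite big_distrr; apply: eq_bigr => ? _). Qed.

Lemma sum4_combine (f1 f2 f3 f4 : 'I_s -> 'I_s -> 'I_s -> 'I_s -> R) :
  - (2^-1 * (\sum_p \sum_q \sum_i \sum_j f1 p q i j))
  - 2^-1 * (\sum_p \sum_q \sum_i \sum_j f2 p q i j)
  + \sum_p \sum_q \sum_i \sum_j f3 p q i j - \sum_p \sum_q \sum_i \sum_j f4 p q i j =
  \sum_p \sum_q \sum_i \sum_j (- (2^-1 * f1 p q i j) - 2^-1 * f2 p q i j
    + f3 p q i j - f4 p q i j).
Proof.
rewrite -!mulNr -[X in _ - X]mul1r -mulNr !sum4Z -!sum4D.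
by apply: eq_sum4 => p q i j; rewrite !mulNr mul1r.
Qed.

Lemma sum4_cond (P1 P2 : pred 'I_s) (f : 'I_s -> 'I_s -> 'I_s -> 'I_s -> R) :
  \sum_(p | P1 p) \sum_(q | P1 q) \sum_(i | P2 i) \sum_(j | P2 j) f p q i j =
  \sum_p \sum_q \sum_i \sum_j
    (if [&& P1 p, P1 q, P2 i & P2 j] then f p q i j else 0).
Proof.
rewrite big_mkcond; apply: eq_bigr => p _; case: (P1 p); last first.
  by do 3 (rewrite big1 // => ? _).
rewrite big_mkcond; apply: eq_bigr => q _; case: (P1 q); last first.
  by do 2 (rewrite big1 // => ? _).
rewrite big_mkcond; apply: eq_bigr => i _; case: (P2 i); last by rewrite big1.
by rewrite big_mkcond.
Qed.

End SumExchange.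

Lemma pairing_double_sum (R : realType) (N s : nat) (G : 'M[R]_N) (a b c d : 'I_s -> R)
    (X Y : 'I_s -> 'I_s -> 'rV[R]_N) :
  pairing G (\sum_p \sum_i (a p * b i) *: X p i) (\sum_q \sum_j (c q * d j) *: Y q j) =
  \sum_p \sum_i \sum_q \sum_j a p * c q * b i * d j * pairing G (X p i) (Y q j).
Proof.
rewrite pairing_suml; apply: eq_bigr => p _; rewrite pairing_suml; apply: eq_bigr => i _.
rewrite pairing_sumr; apply: eq_bigr => q _; rewrite pairing_sumr; apply: eq_bigr => j _.
rewrite pairingZl pairingZr; ring.
Qed.

(** * Mutual curvature of two spans *)

Section MutualCurvature.
Variables (R : realType) (N s m : nat) (U : set 'rV[R]_N) (G : 'rV[R]_N -> 'M[R]_N).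
Hypotheses (oU : open U) (CG : smooth_on U G).
Hypotheses (symG : forall x, U x -> (G x)^T = G x).
Hypotheses (posG : forall x, U x -> forall v, v != 0 -> 0 < pairing (G x) v v).
Variable X : 'I_s -> 'rV[R]_N -> 'rV[R]_N.
Hypothesis CX : forall p, smooth_entries U (X p).
Hypothesis XX : forall p q y, U y -> 'D_(X p y) (X q) y = 'D_(X q y) (X p) y.
Hypothesis orthX : forall (p i : 'I_s) y, (p < m)%N -> (m <= i)%N -> U y ->
  pairing (G y) (X p y) (X i y) = 0.
Hypothesis freeX : forall y, U y -> row_free (\matrix_p X p y).

Local Notation cov := (covariant G).
Local Notation comb := (comb X).
Local Notation second_lie := (second_lie G X).

(** The factor of [A p * A q * B i * B j] in [sectional_curvature] for the fields [comb A] and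
    [comb B], left unsymmetrised: only its sum against these products is ever used. *)
Definition curvature_coef p q i j (x : 'rV[R]_N) : R :=
  - (2^-1 * second_lie p q i j x) - 2^-1 * second_lie i j p q x
  + pairing (G x) (cov (X p) (X i) x) (cov (X q) (X j) x)
  - pairing (G x) (cov (X p) (X q) x) (cov (X i) (X j) x).

Lemma sectional_comb (A B : 'I_s -> R) x : U x ->
  (forall p : 'I_s, ~~ (p < m)%N -> A p = 0) ->
  (forall p : 'I_s, ~~ (m <= p)%N -> B p = 0) ->
  pairing (G x) (curvature G x (comb A x) (comb B x) (comb B x)) (comb A x) =
  \sum_p \sum_q \sum_i \sum_j A p * A q * B i * B j * curvature_coef p q i j x.
Proof.
move=> Ux A0 B0.
have orth y : U y -> pairing (G y) (comb A y) (comb B y) = 0.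
  move=> Uy; rewrite gram_comb; apply: big1 => p _; apply: big1 => i _.
  have [pm|mp] := ltnP p m; last by rewrite A0 ?mul0r // -leqNgt.
  have [im|mi] := ltnP i m; first by rewrite B0 ?mulr0 ?mul0r // -ltnNge.
  by rewrite /gram orthX // mulr0.
have h := sectional_curvature oU CG symG posG (smooth_entries_comb oU CX A)
  (smooth_entries_comb oU CX B) (comb_commute CX XX A B) orth Ux.
rewrite h !(second_lie_comb oU CG CX _ _ Ux) !(covariant_comb oU CG symG posG CX _ _ Ux).
rewrite !pairing_double_sum [X in _ - _ + X - _]sum4_mid [X in _ - _ * X + _ - _]sum4_swap.
apply: etrans (sum4_combine _ _ _ _) _; apply: eq_sum4 => p q i j.
have aux (a b c d k1 k2 k3 k4 : R) :
    - (2^-1 * (a * b * c * d * k1)) - 2^-1 * (c * d * a * b * k2)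
    + a * b * c * d * k3 - a * c * b * d * k4 =
    a * b * c * d * (- (2^-1 * k1) - 2^-1 * k2 + k3 - k4) by ring.
exact: aux.
Qed.

Definition gram_mx x : 'M[R]_s := \matrix_(p, q) gram G X p q x.

Lemma gram_mxE x : gram_mx x = (\matrix_p X p x) *m G x *m (\matrix_p X p x)^T.
Proof.
apply/matrixP => p q; rewrite mxE /gram pairing_def mxE [RHS]mxE.
apply: eq_bigr => k _; rewrite !mxE; congr (_ * _).
by apply: eq_bigr => l _; rewrite mxE.
Qed.

(** The frames are arbitrary choices at each point, with no regularity. Summation over them leaves
    only [A^T *m A] and [B^T *m B], which are blocks of the inverse Gram matrix and hence depend
    smoothly on the point and on the metric. *)
Lemma mutual_curvature_locE x : U x ->
  mutual_curvature_loc G x (\sum_(p < s | (p < m)%N) <<X p x>>)%MS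
    (\sum_(p < s | (m <= p)%N) <<X p x>>)%MS =
  \sum_(p < s | (p < m)%N) \sum_(q < s | (q < m)%N)
    \sum_(i < s | (m <= i)%N) \sum_(j < s | (m <= j)%N)
      invmx (gram_mx x) p q * invmx (gram_mx x) i j * curvature_coef p q i j x.
Proof.
move=> Ux; rewrite /mutual_curvature_loc.
set D1 := (\sum_(p < s | (p < m)%N) _)%MS; set D2 := (\sum_(p < s | (m <= p)%N) _)%MS.
have [ED1 oE1] := orthonormal_frameP (symG Ux) (posG Ux) D1.
have [ED2 oE2] := orthonormal_frameP (symG Ux) (posG Ux) D2.
have [A [EA A0 hA]] := frame_coef (freeX Ux) ED1 oE1.
have [B [EB B0 hB]] := frame_coef (freeX Ux) ED2 oE2.
have H := @frame_gram_inverse R N s m (G x) (X^~ x) _ _ A B.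
rewrite /= -gram_mxE in H hA hB.
have {}H : A^T *m A + B^T *m B = invmx (gram_mx x).
  apply: H => // p i pm mi; rewrite !mxE /gram orthX //; split=> //.
  by rewrite (pairing_sym _ _ (symG Ux)) orthX.
have Erow r (C : 'M[R]_(r, s)) a :
    row a (C *m (\matrix_p X p x)) = comb (fun p => C a p) x.
  rewrite row_mul mulmx_sum_row; apply: eq_bigr => p _.
  by rewrite rowK mxE.
have E1 a b : pairing (G x) (curvature G x (row a (orthonormal_frame (G x) D1))
    (row b (orthonormal_frame (G x) D2)) (row b (orthonormal_frame (G x) D2)))
    (row a (orthonormal_frame (G x) D1)) =
  \sum_p \sum_q \sum_i \sum_j A a p * A a q * B b i * B b j * curvature_coef p q i j x.
  rewrite EA EB !Erow; apply: sectional_comb => //.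
    by move=> p; exact: A0.
  by move=> p; exact: B0.
under eq_bigr do under eq_bigr do rewrite E1.
under eq_bigr do rewrite sum4_in.
rewrite sum4_in [RHS]sum4_cond; apply: eq_sum4 => p q i j.
have EAA : (A^T *m A) p q = \sum_a A a p * A a q.
  by rewrite mxE; apply: eq_bigr => a _; rewrite mxE.
have EBB : (B^T *m B) i j = \sum_b B b i * B b j.
  by rewrite mxE; apply: eq_bigr => b _; rewrite mxE.
have -> : \sum_a \sum_b A a p * A a q * B b i * B b j * curvature_coef p q i j x =
    (A^T *m A) p q * (B^T *m B) i j * curvature_coef p q i j x.
  rewrite EAA EBB !big_distrl /=; apply: eq_bigr => a _.
  rewrite big_distrr big_distrl /=; apply: eq_bigr => b _; ring.
have AA0 (k l : 'I_s) : ~~ ((k < m) && (l < m))%N -> (A^T *m A) k l = 0.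
  rewrite negb_and => kl; rewrite mxE big1 // => a _; rewrite mxE.
  by case/orP: kl => h; rewrite (A0 _ _ h) ?mulr0 ?mul0r.
have BB0 (k l : 'I_s) : ~~ ((m <= k) && (m <= l))%N -> (B^T *m B) k l = 0.
  rewrite negb_and => kl; rewrite mxE big1 // => a _; rewrite mxE.
  by case/orP: kl => h; rewrite (B0 _ _ h) ?mulr0 ?mul0r.
(* Entries with both indices below [m] come from [A^T *m A] alone, those with both indices at least
   [m] from [B^T *m B] alone. *)
rewrite -H.
have -> : (A^T *m A + B^T *m B) p q = (A^T *m A) p q + (B^T *m B) p q by rewrite mxE.
have -> : (A^T *m A + B^T *m B) i j = (A^T *m A) i j + (B^T *m B) i j by rewrite mxE.
rewrite andbA; case pq : ((p < m) && (q < m))%N; last by rewrite AA0 ?pq // !mul0r.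
case ij : ((m <= i) && (m <= j))%N; last by rewrite BB0 ?ij // mulr0 mul0r.
case/andP: pq => pm qm; case/andP: ij => mi mj.
by rewrite (BB0 p q) ?(AA0 i j) ?addr0 ?add0r // ?ltnNge ?pm ?mi // leqNgt pm.
Qed.

End MutualCurvature.

(** * Metric f-K-contact manifolds *)

Section FramedAlgebra.
Variables (R : realType) (n s : nat) (F : 'M[R]_(n.*2 + s)).
Variables (X : 'I_s -> 'rV[R]_(n.*2 + s)) (a : 'I_s -> 'cV[R]_(n.*2 + s)).
Hypothesis dual : forall i j, (X j *m a i) 0 0 = (i == j)%:R.
Hypothesis rankF : \rank F = n.*2.
Hypothesis FF : F *m F = - 1%:M + \sum_i (a i *m X i).

Lemma framed_char_FF j : X j *m (F *m F) = 0.
Proof.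
rewrite FF mulmxDr mulmxN mulmx1 mulmx_sumr (bigD1 j) //= mulmxA.
rewrite [X j *m a j]mx11_scalar dual eqxx mul_scalar_mx scale1r addrA addNr add0r.
apply: big1 => i ij; rewrite mulmxA [X j *m a i]mx11_scalar dual (negbTE ij).
by rewrite mul_scalar_mx scale0r.
Qed.

(* [ker F] lies in [ker F^2], which is spanned by the [s] characteristic vectors;
   both have dimension [s]. *)
Lemma framed_char_ker j : X j *m F = 0.
Proof.
have kerFF : (kermx (F *m F) <= \matrix_i X i)%MS.
  apply/row_subP => k; set v := row k _.
  have v0 : v *m (F *m F) = 0 by apply/sub_kermxP; exact: row_sub.
  have -> : v = \sum_i (v *m a i) *m X i.
    move/eqP: v0; rewrite FF mulmxDr mulmxN mulmx1 addrC subr_eq0 => /eqP Ev.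
    by rewrite -[LHS]Ev mulmx_sumr; apply: eq_bigr => i _; rewrite mulmxA.
  apply: summx_sub => i _; apply: submx_trans (submxMl _ _) _.
  have -> : X i = row i (\matrix_k X k) by rewrite rowK.
  exact: row_sub.
have sub : (kermx F <= kermx (F *m F))%MS.
  by apply/sub_kermxP; rewrite mulmxA mulmx_ker mul0mx.
have : (kermx (F *m F) <= kermx F)%MS.
  rewrite -(geq_leqif (mxrank_leqif_sup sub)) [X in (_ <= X)%N]mxrank_ker rankF addKn.
  by rewrite (leq_trans (mxrankS kerFF)) // rank_leq_row.
move=> h; apply/sub_kermxP; apply: submx_trans h.
by apply/sub_kermxP; exact: framed_char_FF.
Qed.

(** Computing [F *m F *m F] in two ways gives equality of the sums of [F *m a i *m X i] and of
    [a i *m X i *m F]; the latter is 0 by [framed_char_ker], and multiplication by [a j] isolates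
    one term. *)
Lemma framed_form_ker j : F *m a j = 0.
Proof.
have E : \sum_i (F *m a i) *m X i = 0.
  have := congr1 (mulmx F) FF.
  rewrite mulmxA FF mulmxDl mulmxDr mulNmx mulmxN mul1mx mulmx1.
  move/addrI; rewrite mulmx_suml big1; last first.
    by move=> i _; rewrite -mulmxA framed_char_ker mulmx0.
  by move=> h; rewrite [RHS]h mulmx_sumr; apply: eq_bigr => i _; rewrite mulmxA.
have := congr1 (mulmx^~ (a j)) E; rewrite /= mul0mx mulmx_suml (bigD1 j) //= -mulmxA.
rewrite [X j *m a j]mx11_scalar dual eqxx mulmx1 big1 ?addr0 // => i ij.
rewrite -mulmxA [X i *m a j]mx11_scalar dual eq_sym (negbTE ij).
by rewrite mul_mx_scalar scale0r.
Qed.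

End FramedAlgebra.

Section KContact.

Let contact_killing_eq (R : realType) (A B p1 p2 q1 q2 r1 r2 : R) :
  A = p1 + p2 -> B = q1 + q2 -> 2^-1 * (A - B) = 0 -> r1 + r2 + q2 = 0 -> p2 = r2 ->
  p1 + r1 - q1 + 2 * r2 = 0.
Proof. lra. Qed.

Let contact_killing_cancel (R : realType) (a1 a2 a3 a4 b1 b2 b3 b4 : R) :
  a1 + a2 - a3 + 2 * a4 = 0 -> b1 + b2 - b3 + 2 * b4 = 0 ->
  a1 = b2 -> b1 = a2 -> a3 = b3 -> a4 = b4.
Proof. lra. Qed.

Variables (R : realType) (n s : nat) (M : smooth_manifold R (n.*2 + s)).
Variables (f : field M 'M[R]_(n.*2 + s)) (xi : 'I_s -> field M 'rV[R]_(n.*2 + s)).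
Variables (eta : 'I_s -> field M 'cV[R]_(n.*2 + s)) (g : field M 'M[R]_(n.*2 + s)).
Hypothesis hM : metric_f_K_contact_manifold f xi eta g.

(** The compatibility of [g] with [f], taken with second argument [xi i], has left side 0 because
    [xi i] lies in the kernel of [f]. *)
Lemma char_metric_dual c x i (u : 'rV[R]_(n.*2 + s)) : img c x ->
  pairing (g c x) u (xi i c x) = (u *m eta i c x) 0 0.
Proof.
move=> cx; have [[[[_ _ _ hF] _ hg _] _] _] := hM; have [fX dual rF FF] := hF c x cx.
have := hg c x cx u (xi i c x).
rewrite (framed_char_ker dual rF FF) pairing0r (bigD1 i) //= dual eqxx mulr1.
rewrite big1 => [|j ji]; last by rewrite dual (negbTE ji) mulr0.
by rewrite addr0 => /esym/eqP; rewrite subr_eq0 => /eqP.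
Qed.

(** Consider the form sending [u] and [v] to the product of the covariant derivative of [xi k] along
    [u] with [v]. Its skew part is the exterior derivative of [eta k], which vanishes on [xi l]
    since [f] is skew to it: [eta l] kills the image of [f]. Its symmetric part vanishes by the
    Killing equation. So [xi k] is parallel along [xi l], and the bracket is the difference of two
    zero vectors. *)
Lemma char_commute c x i j : img c x ->
  'D_(xi i c x) (xi j c) x = 'D_(xi j c x) (xi i c) x.
Proof.
move=> cx; have [[hm hd] hK] := hM; have [[_ hX hE hF] [CG sG pG _] _ _] := hm.
have [fX dual rF FF] := hF c x cx.
have oU : open (img c) := @img_open _ _ M c.
have CX k : smooth_entries (img c) (xi k c) := smooth_on_entries oU ((hX k).1 c).
have dX k v : derivable (xi k c) x v := smooth_entries_derivable (CX k) cx.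
have dG v : derivable (g c) x v.
  by apply: diff_derivable; exact: Ck_on_differentiable (CG c 1%N) cx.
have dE k v : derivable (eta k c) x v.
  by apply: diff_derivable; exact: Ck_on_differentiable ((hE k).1 c 1%N) cx.
have DE k u v : (v *m 'D_u (eta k c) x) 0 0 =
    pairing ('D_u (g c) x) v (xi k c x) + pairing (g c x) v ('D_u (xi k c) x).
  have h : is_derive x u (fun y => \sum_l v 0 l * eta k c y l 0)
      (\sum_l v 0 l * 'D_u (eta k c) x l 0).
    apply: is_derive_bigsum => l _.
    exact: is_deriveZ (is_derive_entry l 0 (dE k u)).
  rewrite mxE; have [_ <-] := h.
  have E y : img c y -> \sum_l v 0 l * eta k c y l 0 = pairing (g c y) v (xi k c y).
    by move=> cy; rewrite char_metric_dual // mxE.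
  rewrite (derive_open_eq u oU cx E).
  rewrite (derive_pairing (dG u) (derivable_cst v x u) (dX k u)) derive_cst.
  by rewrite pairing0l addr0.
have uG : g c x \in unitmx by apply: posdef_unitmx; exact: pG.
(* This is twice the pairing of [v] with the covariant derivative of [xi k] along [xi l],
   Christoffel terms written out. Those terms are symmetric in [k] and [l], so they cancel between
   the two instances used below. *)
have key k l v : pairing ('D_(xi l c x) (g c) x) v (xi k c x)
    + pairing ('D_(xi k c x) (g c) x) (xi l c x) v
    - pairing ('D_v (g c) x) (xi l c x) (xi k c x)
    + 2 * pairing (g c x) ('D_(xi l c x) (xi k c) x) v = 0.
  have e1 : ext_deriv (eta k c) x (xi l c x) v = 0.
    rewrite hd // (pairing_sym _ _ (sG c x cx)) char_metric_dual // -mulmxA.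
    by rewrite (framed_form_ker dual rF FF) mulmx0 mxE.
  exact: contact_killing_eq (DE k (xi l c x) v) (DE k v (xi l c x)) e1
    (hK k c x cx (xi l c x) v) (pairing_sym v _ (sG c x cx)).
apply: (pairing_nondeg uG) => v.
have sD w := derive_metric_sym oU (CG c) (sG c) w cx.
have e1 := key j i v; have e2 := key i j v.
have s1 := pairing_sym v (xi j c x) (sD (xi i c x)).
have s2 := pairing_sym v (xi i c x) (sD (xi j c x)).
have s3 := pairing_sym (xi i c x) (xi j c x) (sD v).
exact: contact_killing_cancel e1 e2 s1 s2 s3.
Qed.

End KContact.

(** * Invariance under changes of charts *)

Lemma derive_derive_field_mx (R : realType) (N N' : nat) (U : set 'rV[R]_N)
    (F : 'rV[R]_N -> 'rV[R]_N') (X : 'rV[R]_N -> 'rV[R]_N) (u x : 'rV[R]_N) :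
  open U -> Ck_on 2 U F -> smooth_entries U X -> U x ->
  'D_u (fun y => 'D_(X y) F y) x =
  'D_u (fun y => 'D_(X x) F y) x + 'D_('D_u X x) F x.
Proof.
move=> oU CF CX Ux; apply/rowP => j.
have CFj : Ck_on 2 U (fun y => F y 0 j) by exact: Ck_on_entry oU CF.
have dF y : U y -> differentiable F y by move=> Uy; exact: Ck_on_differentiable CF Uy.
have E w y : U y -> 'D_w F y 0 j = 'D_w (fun y => F y 0 j) y.
  by move=> Uy; exact: derive_entry (dF y Uy).
have d1 : derivable (fun y => 'D_(X y) F y) x u.
  apply/derivable_mxP => i k; rewrite ord1.
  have Ek y : U y -> 'D_(X y) (fun z => F z 0 k) y = 'D_(X y) F y 0 k.
    by move=> Uy; apply/esym; exact: derive_entry (dF y Uy).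
  apply: near_eq_derivable (open_nbhs_eq oU Ux Ek) _.
  apply: diff_derivable; apply: (@Ck_on_differentiable _ _ _ 0 U) Ux.
  exact (Ck_on_derive_field oU (Ck_on_entry 0 k oU CF) (CX 1%N)).
have d2 : differentiable (fun y => 'D_(X x) F y) x.
  exact: Ck_on_differentiable (Ck_on_derive (X x) CF) Ux.
have [_ e1] := is_derive_entry 0 j d1.
apply: etrans (esym e1) _.
apply: etrans (derive_open_eq u oU Ux (fun y Uy => E (X y) y Uy)) _.
apply: etrans (derive_derive_field u oU CFj CX Ux) _.
rewrite [RHS]mxE; congr (_ + _); last by rewrite E.
apply: etrans _ (esym (derive_entry _ _ _ d2)).
by apply: (derive_open_eq u oU Ux) => y Uy; rewrite E.
Qed.

Section Charts.
Variables (R : realType) (N : nat) (M : smooth_manifold R N).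
Implicit Types c d : chart M.

Lemma overlapP c d x : overlap c d x <-> img c x /\ dom d (param c x).
Proof.
split=> [[p [cp dp] <-]|[[p cp <-]]]; first by split; [exists p|rewrite coordK].
by rewrite coordK // => dp; exists p.
Qed.

Lemma img_param c x : img c x -> dom c (param c x).
Proof. by move=> [p cp <-]; rewrite coordK. Qed.

Lemma paramK c x : img c x -> Defs.coord c (param c x) = x.
Proof. by move=> [p cp <-]; rewrite coordK. Qed.

Lemma overlap_img c d x : overlap c d x -> img c x.
Proof. by move=> /overlapP[]. Qed.

Lemma overlap_open c d : open (overlap c d).
Proof.
rewrite openE => x /overlapP[cx dx]; rewrite /interior.
have n1 : \forall y \near x, img c y by apply: open_nbhs_nbhs; split=> //; exact: img_open.
have n2 : \forall y \near x, dom d (param c y).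
  by apply: (param_continuous cx); apply: open_nbhs_nbhs; split=> //; exact: dom_open.
by near=> y; apply/overlapP; split; near: y.
Unshelve. all: by end_near. Qed.

Lemma param_transition c d x : overlap c d x -> param d (transition c d x) = param c x.
Proof. by move=> /overlapP[cx dx]; rewrite /transition /= coordK. Qed.

Lemma img_transition c d x : overlap c d x -> img d (transition c d x).
Proof. by move=> /overlapP[cx dx]; exists (param c x). Qed.

Lemma overlap_transition c d x : overlap c d x -> overlap d c (transition c d x).
Proof.
move=> h; apply/overlapP; split; first exact: img_transition.
rewrite param_transition //; exact: img_param (overlap_img h).
Qed.

Lemma transitionK c d x : overlap c d x -> transition d c (transition c d x) = x.
Proof.
move=> h; rewrite {1}/transition /= param_transition // paramK //; exact: overlap_img h.
Qed.

Lemma transition_Ck c d k : Ck_on k (overlap c d) (transition c d).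
Proof. exact: transition_smooth. Qed.

Lemma transition_differentiable c d x : overlap c d x ->
  differentiable (transition c d) x.
Proof. by move=> h; exact: Ck_on_differentiable (transition_Ck c d 1%N) h. Qed.

(** The chain rule for the two mutually inverse transitions. It lets a vector identity in the chart
    [d] be tested only on images of vectors of the chart [c]. *)
Lemma transition_derive_surj c d x (w : 'rV[R]_N) : overlap c d x ->
  exists z, 'D_z (transition c d) x = w.
Proof.
move=> h; exists ('D_w (transition d c) (transition c d x)).
have h' := overlap_transition h.
have E := derive_comp_diff w (transition_differentiable h').
rewrite transitionK // in E; have {}E := E _ _ (transition_differentiable h).
rewrite -E; apply: etrans _ (derive_id (transition c d x) w).
refine (derive_open_eq w (@overlap_open d c) h' _) => y hy.
exact (transitionK hy).
Qed.

Definition scalar_invariant (psi : field M R) : Prop :=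
  forall c d x, overlap c d x -> psi c x = psi d (transition c d x).

Lemma scalar_invariant_derive (psi : field M R) c d x (v : 'rV[R]_N) :
  scalar_invariant psi -> differentiable (psi d) (transition c d x) -> overlap c d x ->
  'D_v (psi c) x = 'D_('D_v (transition c d) x) (psi d) (transition c d x).
Proof.
move=> ipsi dpsi h.
rewrite -(derive_comp_diff v (transition_differentiable h) dpsi).
by apply: derive_open_eq (@overlap_open c d) h _ => y hy; exact: ipsi.
Qed.

Lemma scalar_invariant_lie (psi : field M R) (X : field M 'rV[R]_N) :
  is_vector_field X -> scalar_invariant psi -> (forall d, Ck_on 1 (img d) (psi d)) ->
  scalar_invariant (fun c => lie_fun (X c) (psi c)).
Proof.
move=> [_ hX] ipsi dpsi c d x h; rewrite /lie_fun hX //.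
apply: scalar_invariant_derive => //.
exact: Ck_on_differentiable (dpsi d) (img_transition h).
Qed.

Variable G : field M 'M[R]_N.
Hypothesis hG : is_riemannian_metric G.

(** Second derivatives of the transition arise when the transformation law of the metric is
    differentiated along [X], and again when that of [X] is differentiated; symmetry of second
    derivatives identifies the two contributions. *)
Lemma lie_metric_invariant (X : field M 'rV[R]_N) c d x (u v : 'rV[R]_N) :
  is_vector_field X -> overlap c d x ->
  lie_metric (X c) (G c) x u v =
  lie_metric (X d) (G d) (transition c d x)
    ('D_u (transition c d) x) ('D_v (transition c d) x).
Proof.
move=> [CX hX] h; have [CG sG pG iG] := hG.
have oO := @overlap_open c d; pose t := transition c d.
have Ct := transition_Ck c d.
have cx := overlap_img h; have dx := img_transition h.
have dt w z : derivable (fun y => 'D_w t y) x z.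
  by apply: diff_derivable; exact: Ck_on_differentiable (Ck_on_derive w (Ct 2%N)) h.
have dGd : differentiable (G d) (t x) by exact: Ck_on_differentiable (CG d 1%N) dx.
have dtx : differentiable t x by exact: transition_differentiable.
have dGt z : derivable (G d \o t) x z.
  by apply: diff_derivable; exact: differentiable_comp.
have dGc z : derivable (G c) x z.
  by apply: diff_derivable; exact: Ck_on_differentiable (CG c 1%N) cx.
have dXd : differentiable (X d) (t x) by exact: Ck_on_differentiable (CX d 1%N) dx.
have CXc : smooth_entries (overlap c d) (X c).
  move=> k j; apply: Ck_on_sub (smooth_on_entries (@img_open _ _ M c) (CX c) k j).
  by move=> y; exact: overlap_img.
pose w := X c x.
have E1 : pairing ('D_w (G c) x) u v =
    pairing ('D_(X d (t x)) (G d) (t x)) ('D_u t x) ('D_v t x)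
    + pairing (G d (t x)) ('D_w (fun y => 'D_u t y) x) ('D_v t x)
    + pairing (G d (t x)) ('D_u t x) ('D_w (fun y => 'D_v t y) x).
  have e1 := derive_pairing (dGc w) (derivable_cst u x w) (derivable_cst v x w).
  rewrite !derive_cst pairing0l pairing0r !addr0 in e1.
  apply: etrans (esym e1) _.
  apply: etrans (derive_open_eq w oO h (fun y hy => iG c d y hy u v)) _.
  apply: etrans (derive_pairing (dGt w) (dt u w) (dt v w)) _.
  by rewrite (derive_comp_diff w dtx dGd) -[in LHS](hX c d x h).
have EX z : 'D_('D_z t x) (X d) (t x) =
    'D_w (fun y => 'D_z t y) x + 'D_('D_z (X c) x) t x.
  apply: etrans (esym (derive_comp_diff z dtx dXd)) _.
  apply: etrans (derive_open_eq z oO h (fun y hy => hX c d y hy)) _.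
  apply: etrans (derive_derive_field_mx z oO (Ct 2%N) CXc h) _.
  by rewrite (derive_comm_mx z w oO (Ct 2%N) h).
have iGx := iG c d x h.
have aux (a b1 b2 c1 c2 p1 p2 q2 s1 s2 : R) : a = p1 + b1 + b2 -> c1 = p2 -> c2 = q2 ->
    s1 = b1 + p2 -> s2 = b2 + q2 -> a + c1 + c2 = p1 + s1 + s2.
  by move=> -> -> -> -> ->; ring.
apply: (aux _ _ _ _ _ _ _ _ _ _ E1 (iGx ('D_u (X c) x) v) (iGx u ('D_v (X c) x))).
  by rewrite EX pairingDl.
by rewrite EX pairingDr.
Qed.

End Charts.

(** Koszul's formula for commuting fields. Its right side consists of quantities that transform as
    tensors or scalars, which makes [covariant] independent of the chart; it also exhibits what
    vanishes for orthonormal Killing fields. *)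
Lemma pairing_covariant (R : realType) N (U : set 'rV[R]_N) (G : 'rV[R]_N -> 'M[R]_N)
    (X Y : 'rV[R]_N -> 'rV[R]_N) y z :
  open U -> smooth_on U G -> (forall x, U x -> (G x)^T = G x) ->
  (forall x, U x -> forall v, v != 0 -> 0 < pairing (G x) v v) ->
  smooth_entries U X -> smooth_entries U Y -> U y -> 'D_(X y) Y y = 'D_(Y y) X y ->
  pairing (G y) (covariant G X Y y) z =
  2^-1 * (lie_metric X G y (Y y) z + lie_metric Y G y (X y) z
          - 'D_z (fun x => pairing (G x) (X x) (Y x)) y).
Proof.
move=> oU CG sG pG CX CY Uy XY.
have e1 := christoffelP CG pG (X y) (Y y) z Uy.
have dG : derivable G y z.
  by apply: diff_derivable; exact: Ck_on_differentiable (CG 1%N) Uy.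
have e2 := derive_pairing dG (smooth_entries_derivable (v := z) CX Uy)
  (smooth_entries_derivable (v := z) CY Uy).
have e3 : pairing (G y) (covariant G X Y y) z =
    pairing (G y) ('D_(X y) Y y) z + pairing (G y) (christoffel G (X y) (Y y) y) z.
  exact: pairingDl.
have e4 := pairing_sym (Y y) ('D_z X y) (sG y Uy).
have aux (p q r a1 a2 a3 b1 b2 b3 c d : R) : p = q + r -> r = 2^-1 * (a1 + a2 - a3) ->
    d = a3 + b1 + b2 -> c = b1 -> b3 = q ->
    p = 2^-1 * (a1 + b3 + c + (a2 + q + b2) - d).
  by move=> -> -> -> -> ->; field.
apply: aux e3 e1 e2 e4 _; by rewrite XY.
Qed.

Section CovariantInvariance.
Variables (R : realType) (N : nat) (M : smooth_manifold R N) (G : field M 'M[R]_N).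
Hypothesis hG : is_riemannian_metric G.

Lemma metric_open_data c : [/\ open (img c), smooth_on (img c) (G c),
  forall x, img c x -> (G c x)^T = G c x &
  forall x, img c x -> forall v, v != 0 -> 0 < pairing (G c x) v v].
Proof.
by have [CG sG pG _] := hG; split=> //; [exact: img_open|exact: sG|exact: pG].
Qed.

Lemma vector_field_entries (X : field M 'rV[R]_N) c : is_vector_field X ->
  smooth_entries (img c) (X c).
Proof. by move=> [CX _]; exact: (smooth_on_entries (@img_open _ _ M c) (CX c)). Qed.

Lemma gram_scalar_invariant (X Y : field M 'rV[R]_N) :
  is_vector_field X -> is_vector_field Y ->
  scalar_invariant (fun c x => pairing (G c x) (X c x) (Y c x)).
Proof.
move=> [_ hX] [_ hY] c d x h; have [_ _ _ iG] := hG.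
by rewrite (iG c d x h) -hX // -hY.
Qed.

Section Fields.
Variables X Y : field M 'rV[R]_N.
Hypotheses (hX : is_vector_field X) (hY : is_vector_field Y).
Hypothesis XY : forall c x, img c x -> 'D_(X c x) (Y c) x = 'D_(Y c x) (X c) x.

Lemma covariant_invariant c d x : overlap c d x ->
  covariant (G d) (X d) (Y d) (transition c d x) =
  'D_(covariant (G c) (X c) (Y c) x) (transition c d) x.
Proof.
move=> h; have [_ _ _ iG] := hG.
have cx := overlap_img h; have dx := img_transition h.
have [oc Cc sc pc] := metric_open_data c; have [od Cd sd pd] := metric_open_data d.
apply: (pairing_nondeg (posdef_unitmx (pd _ dx))) => w.
have [z <-] := transition_derive_surj w h.
rewrite -(iG c d x h).
have CXc := vector_field_entries c hX; have CYc := vector_field_entries c hY.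
have CXd := vector_field_entries d hX; have CYd := vector_field_entries d hY.
rewrite (pairing_covariant _ od Cd sd pd CXd CYd dx (XY dx)).
rewrite (pairing_covariant _ oc Cc sc pc CXc CYc cx (XY cx)).
have aux (a1 b1 c1 a2 b2 c2 : R) : a1 = a2 -> b1 = b2 -> c1 = c2 ->
    2^-1 * (a1 + b1 - c1) = 2^-1 * (a2 + b2 - c2) by move=> -> -> ->.
apply: aux.
- by rewrite (lie_metric_invariant hG _ _ hX h) -hY.2.
- by rewrite (lie_metric_invariant hG _ _ hY h) -hX.2.
- apply/esym; apply: (scalar_invariant_derive z (gram_scalar_invariant hX hY) _ h).
  exact: Ck_on_differentiable (Ck_on_gram od Cd 1%N CXd CYd) dx.
Qed.

End Fields.

Variables (s : nat) (X : 'I_s -> field M 'rV[R]_N).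
Hypothesis hX : forall p, is_vector_field (X p).
Hypothesis XX : forall p q c x, img c x ->
  'D_(X p c x) (X q c) x = 'D_(X q c x) (X p c) x.

Lemma second_lie_invariant p q i j :
  scalar_invariant (fun c => second_lie (G c) (fun k => X k c) p q i j).
Proof.
have C d k l : forall r, Ck_on r (img d) (gram (G d) (fun k => X k d) k l).
  have [od Cd sd pd] := metric_open_data d => r.
  exact: (Ck_on_gramX od Cd (fun p => vector_field_entries d (hX p))).
have C1 d k i' j' : Ck_on 1 (img d) (lie_fun (X k d) (gram (G d) (fun k => X k d) i' j')).
  have [od Cd sd pd] := metric_open_data d.
  exact: (Ck_on_lie_gram od Cd (fun p => vector_field_entries d (hX p))).
apply: (scalar_invariant_lie (hX p)) => [|d]; last exact: C1.
apply: (scalar_invariant_lie (hX q)) => [|d]; last exact: C.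
exact: gram_scalar_invariant (hX i) (hX j).
Qed.

Lemma curvature_coef_invariant p q i j :
  scalar_invariant (fun c => curvature_coef (G c) (fun k => X k c) p q i j).
Proof.
move=> c d x h; rewrite /curvature_coef.
have e1 := second_lie_invariant p q i j h; have e2 := second_lie_invariant i j p q h.
have E k l k' l' : pairing (G c x) (covariant (G c) (X k c) (X l c) x)
    (covariant (G c) (X k' c) (X l' c) x) =
  pairing (G d (transition c d x)) (covariant (G d) (X k d) (X l d) (transition c d x))
    (covariant (G d) (X k' d) (X l' d) (transition c d x)).
  rewrite (covariant_invariant (hX k) (hX l) (XX k l) h).
  rewrite (covariant_invariant (hX k') (hX l') (XX k' l') h).
  by have [_ _ _ iG] := hG; exact: iG.
have aux (a1 b1 c1 d1 a2 b2 c2 d2 : R) : a1 = a2 -> b1 = b2 -> c1 = c2 -> d1 = d2 ->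
    - (2^-1 * a1) - 2^-1 * b1 + c1 - d1 = - (2^-1 * a2) - 2^-1 * b2 + c2 - d2.
  by move=> -> -> -> ->.
exact: aux e1 e2 (E _ _ _ _) (E _ _ _ _).
Qed.

Lemma gram_mx_invariant c d x : overlap c d x ->
  gram_mx (G c) (fun k => X k c) x = gram_mx (G d) (fun k => X k d) (transition c d x).
Proof.
move=> h; apply/matrixP => p q; rewrite !mxE.
exact: (gram_scalar_invariant (hX p) (hX q) h).
Qed.

End CovariantInvariance.

(** * Lebesgue measure on row vectors *)

Section Borel.

Lemma borel_open_measurable (T : ptopologicalType) (A : set (borel T)) :
  @open T A -> measurable A.
Proof. exact: sub_gen_smallest. Qed.

Lemma borel_closed_measurable (T : ptopologicalType) (A : set (borel T)) :
  @closed T A -> measurable A.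
Proof.
move=> cA; rewrite -(setCK A); apply: measurableC; apply: borel_open_measurable.
exact: closed_openC.
Qed.

Lemma borel_continuous_measurable (T S : ptopologicalType) (f : T -> S) :
  continuous f -> measurable_fun (setT : set (borel T)) (f : borel T -> borel S).
Proof.
move=> cf; apply: (@measurability _ _ (borel T) (borel S) setT f (@open S)) => //.
move=> _ [B oB <-]; rewrite setTI; apply: borel_open_measurable.
by apply: open_comp => // x _; exact: cf.
Qed.

Lemma borel_real_measurable (R : realType) (T : ptopologicalType) (D : set (borel T))
    (f : T -> R) : measurable D ->
  (forall x, D x -> {for x, continuous f}) ->
  @open T D -> measurable_fun D (f : borel T -> R).
Proof.
move=> mD cf oD; refine (measurability _ (RGenOpens.measurableE R) _).
move=> _ [B [x [y ->]] <-]; apply: borel_open_measurable.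
rewrite openE => z [Dz fz]; rewrite /interior.
have n1 : \forall w \near z, D w by apply: open_nbhs_nbhs; split.
have n2 : \forall w \near z, `]x, y[%classic (f w).
  by apply: (cf z Dz); apply: open_nbhs_nbhs; split=> //; exact: interval_open.
by apply: filterS2 n1 n2 => w; split.
Qed.

Lemma borel_continuous_real (R : realType) (T : ptopologicalType) (f : T -> R) :
  continuous f -> measurable_fun (setT : set (borel T)) (f : borel T -> R).
Proof.
move=> cf; apply: borel_real_measurable => //; [by move=> x _; exact: cf|exact: openT].
Qed.

End Borel.

Section LebesgueRV.
Variable R : realType.
Local Notation BV N := (borel 'rV[R]_N).
Local Notation RM := (measurableTypeR R).

Lemma rV_ballE N (x y : 'rV[R]_N) (e : R) : 0 < e ->
  ball x e y <-> forall j, ball (x 0 j) e (y 0 j).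
Proof.
move=> e0; split=> [[_ h] j|h]; first exact: h.
by split=> // i j; rewrite !ord1.
Qed.

(** Countability of the rational balls is what reduces preimages of open sets to countable unions of
    measurable rectangles. *)
Lemma rV_open_bigcup N (A : set 'rV[R]_N) : open A ->
  A = \bigcup_(q in [set q : 'rV[rat]_N * rat |
        ball (map_mx ratr q.1 : 'rV[R]_N) (ratr q.2) `<=` A])
      ball (map_mx ratr q.1 : 'rV[R]_N) (ratr q.2).
Proof.
move=> oA; apply/seteqP; split=> [x Ax|x [q qA]]; last exact: qA.
have /nbhs_ballP[e /= e0 eA] : nbhs x A by apply: open_nbhs_nbhs; split.
have e2 : 0 < e / 2 by rewrite divr_gt0.
have /rat_in_itvoo[r /itvP re] := e2.
have r0 : 0 < ratr r :> R by rewrite re.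
have hq j : exists q : rat, ball (x 0 j) (ratr r) (ratr q).
  have [y [by_ [q _ qy]]] := @dense_rat R _ (ex_intro _ _ (ballxx (x 0 j) r0))
    (ball_open (x 0 j) (ratr r)).
  by exists q; rewrite qy.
pose q := \row_j sval (cid (hq j)).
have xq : ball x (ratr r) (map_mx ratr q : 'rV[R]_N).
  by apply/rV_ballE => // j; rewrite !mxE; exact: svalP (cid (hq j)).
exists (q, r); last exact: ball_sym.
move=> y /= qy; apply: eA; have := ball_triangle xq qy; apply: le_ball.
by rewrite [leRHS]splitr lerD // ltW // re.
Qed.

(** The same [row_mx] as in [lebesgue_integral_rV], as a function of a pair, so that a product
    measure can be pushed forward along it. *)
Definition cons_rV N (z : RM * BV N) : BV N.+1 := row_mx (z.1%:M : 'rV[R]_1) z.2.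

Definition uncons_rV N (x : BV N.+1) : RM * BV N := (x 0 0, \row_j x 0 (lift 0 j)).

Lemma cons_rV0 N (z : RM * BV N) : cons_rV z 0 0 = z.1.
Proof.
have -> : (0 : 'I_N.+1) = lshift N (0 : 'I_1) by apply/val_inj.
by apply: etrans (row_mxEl _ _ _ _) _; rewrite mxE eqxx.
Qed.

Lemma cons_rV_lift N (z : RM * BV N) j : cons_rV z 0 (lift 0 j) = z.2 0 j.
Proof.
have -> : lift (0 : 'I_N.+1) j = rshift 1 j by apply/val_inj.
exact: row_mxEr.
Qed.

Lemma cons_rVK N : cancel (@cons_rV N) (@uncons_rV N).
Proof.
move=> [t y]; rewrite /uncons_rV cons_rV0; congr (_, _); apply/rowP => j.
by rewrite mxE cons_rV_lift.
Qed.

Lemma cons_rV_preimage_ball N (x : 'rV[R]_N.+1) e : 0 < e ->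
  @cons_rV N @^-1` ball x e =
  ball (x 0 0) e `*` ball (\row_j x 0 (lift 0 j) : 'rV[R]_N) e.
Proof.
move=> e0; apply/seteqP; split=> [[t y]|[t y] /= [xt xy]].
  move=> /(rV_ballE _ _ e0) h; split.
    by have := h 0; rewrite cons_rV0.
  by apply/rV_ballE => // j; rewrite mxE; have := h (lift 0 j); rewrite cons_rV_lift.
apply/rV_ballE => // j; case: (unliftP 0 j) => [k ->|->]; last by rewrite cons_rV0.
by rewrite cons_rV_lift; have /(rV_ballE _ _ e0)/(_ k) := xy; rewrite mxE.
Qed.

Lemma measurable_cons_rV N : measurable_fun setT (@cons_rV N).
Proof.
apply: (@measurability _ _ (RM * BV N)%type (BV N.+1) setT (@cons_rV N) (@open 'rV[R]_N.+1)) => //.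
move=> _ [B oB <-]; rewrite setTI (rV_open_bigcup oB).
rewrite preimage_bigcup.
set Q := [set q | _]; rewrite bigcup_mkcond.
apply: countable_bigcupT_measurable => [|q]; first exact: countableP.
case: ifPn => // _.
(* The rational radius may fail to be positive; the ball is then empty. *)
have [q0|q0] := ltP 0 (ratr q.2 : R); last first.
  rewrite (_ : _ @^-1` _ = set0) //; apply/seteqP; split=> // z [/= q0'].
  by move: (lt_le_trans q0' q0); rewrite ltxx.
rewrite cons_rV_preimage_ball //; apply: measurableX.
  by apply: open_measurable; exact: ball_open.
by apply: borel_open_measurable; exact: ball_open.
Qed.

Lemma rV_entry_continuous N (j : 'I_N) : continuous (fun x : 'rV[R]_N => x 0 j).
Proof. by move=> x; exact: coord_continuous. Qed.

Lemma measurable_uncons_rV N : measurable_fun setT (@uncons_rV N).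
Proof.
apply: measurable_fun_pair => /=.
  apply: (@borel_continuous_real R _ (fun x : 'rV[R]_N.+1 => x 0 0)).
  exact: rV_entry_continuous.
apply: (@borel_continuous_measurable _ _ (fun x : 'rV[R]_N.+1 => \row_j x 0 (lift 0 j))).
move=> x A /nbhs_ballP[e /= e0 eA]; apply/nbhs_ballP; exists e => // y xy.
apply: eA; apply/rV_ballE => // j; rewrite !mxE.
by move: xy => /(rV_ballE _ _ e0); exact.
Qed.

Section Step.
Variables (N : nat) (lam : {sigma_finite_measure set (BV N) -> \bar R}).

Definition lebesgue_step : set (BV N.+1) -> \bar R :=
  pushforward (@lebesgue_measure R \x lam)%E (@cons_rV N).

HB.instance Definition _ := Measure.copy lebesgue_step
  (measure_function_pushforward__canonical__measure_function_Measure
     (@lebesgue_measure R \x lam)%E (@measurable_cons_rV N)).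


Lemma lebesgue_step_sigma_finite : sigma_finite setT lebesgue_step.
Proof.
have /sigma_finiteP[F [FT ndF Foo]] := sigma_finiteT (@lebesgue_measure R).
have /sigma_finiteP[G [GT ndG Goo]] := sigma_finiteT lam.
exists (fun n => @uncons_rV N @^-1` (F n `*` G n)).
  apply/seteqP; split=> // x _.
  have [n _ Fn] : (\bigcup_n F n) (uncons_rV x).1 by rewrite -FT.
  have [k _ Gk] : (\bigcup_n G n) (uncons_rV x).2 by rewrite -GT.
  (* Both exhausting sequences are nondecreasing, so a common index works for the two components. *)
  exists (maxn n k) => //; split.
    by move: Fn; apply/subsetPset/ndF/leq_maxl.
  by move: Gk; apply/subsetPset/ndG/leq_maxr.
move=> n; have [mF Fn] := Foo n; have [mG Gn] := Goo n; split.
  rewrite -[X in measurable X]setTI; apply: measurable_uncons_rV => //.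
  exact: measurableX.
rewrite /lebesgue_step /pushforward -comp_preimage.
rewrite (_ : _ \o _ = id); last by apply/funext => z; exact: cons_rVK.
by rewrite preimage_id product_measure1E // lte_mul_pinfty // ge0_fin_numE.
Qed.

HB.instance Definition _ := Measure_isSigmaFinite.Build _ _ _ lebesgue_step
  lebesgue_step_sigma_finite.

End Step.

(** In dimension 0 the space is one point, and its Lebesgue measure is the unit mass. *)
Definition dirac0 : set (BV 0) -> \bar R := dirac (0 : BV 0).
HB.instance Definition _ := Measure.on dirac0.
Let dirac0_sigma_finite : sigma_finite setT dirac0.
Proof.
exists (fun=> setT); first by rewrite bigcup_const //; exists 0%N.
by move=> n; split=> //; rewrite /dirac0 diracT ltry.
Qed.
HB.instance Definition _ := Measure_isSigmaFinite.Build _ _ _ dirac0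
  dirac0_sigma_finite.

(** The recursion returns the sigma-finite structure together with the measure, since the product
    with Lebesgue measure and Tonelli's theorem at the next dimension require it. *)
Fixpoint lebesgue_rV (N : nat) : {sigma_finite_measure set (BV N) -> \bar R} :=
  match N with
  | 0 => dirac0
  | N'.+1 => lebesgue_step (lebesgue_rV N')
  end.

Local Open Scope ereal_scope.

Lemma lebesgue_rV_integralS N (F : BV N.+1 -> \bar R) :
  measurable_fun setT F -> (forall x, 0 <= F x) ->
  \int[lebesgue_rV N.+1]_x F x =
  \int[@lebesgue_measure R]_t \int[lebesgue_rV N]_y F (cons_rV (t, y)).
Proof.
move=> mF F0.
have h := ge0_integral_pushforward (@measurable_cons_rV N)
  (@lebesgue_measure R \x lebesgue_rV N) measurableT mF (fun x _ => F0 x).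
apply: etrans h _; rewrite preimage_setT fubini_tonelli1 //.
  exact: measurableT_comp mF (@measurable_cons_rV N).
by move=> z; exact: F0.
Qed.

Lemma measurable_cons_section N (F : BV N.+1 -> \bar R) (t : R) :
  measurable_fun setT F -> measurable_fun setT (fun y => F (cons_rV (t, y))).
Proof.
move=> mF; apply: (measurableT_comp mF).
by apply: (measurableT_comp (@measurable_cons_rV N)); exact: measurable_pair1.
Qed.

(** Passing from iterated integrals to a measure opens the way to Fubini, densities and the
    comparison of integrals. *)
Lemma lebesgue_integral_rVE N (F : BV N -> \bar R) :
  measurable_fun setT F -> (forall x, 0 <= F x) ->
  lebesgue_integral_rV F = \int[lebesgue_rV N]_x F x.
Proof.
elim: N F => [|N IH] F mF F0 /=.
  by rewrite /dirac0 integral_dirac // diracT mul1e.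
rewrite -[RHS]/(\int[lebesgue_rV N.+1]_x F x) lebesgue_rV_integralS //.
apply: eq_integral => t _; rewrite -IH //.
exact: measurable_cons_section.
Qed.

Lemma lebesgue_rV_ball N (x : 'rV[R]_N) e : (0 < e)%R ->
  lebesgue_rV N (ball x e) < +oo.
Proof.
move=> e0; elim: N x => [|N IH] x.
  by rewrite /= /dirac0 diracE ltry.
rewrite /= /lebesgue_step /pushforward cons_rV_preimage_ball //.
rewrite product_measure1E; last 2 first.
- exact: measurable_ball.
- by apply: borel_open_measurable; exact: ball_open.
have h : lebesgue_measure (ball (x 0%R 0%R) e) = (e *+ 2)%:E.
  by apply: lebesgue_measure_ball; exact: ltW.
apply: lte_mul_pinfty; [exact: measure_ge0| |exact: IH].
by apply: etrans (congr1 (fun z => z \is a fin_num) h) _.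
Qed.

End LebesgueRV.

(** * Integrals of compactly supported partial derivatives *)

Lemma integrable_bounded_support d (T : measurableType d) (R : realType)
    (mu : {measure set T -> \bar R}) (f : T -> R) (A : set T) (C : R) :
  measurable A -> (mu A < +oo)%E -> measurable_fun setT f ->
  (forall x, `|f x| <= C) -> (forall x, ~ A x -> f x = 0) ->
  mu.-integrable setT (EFin \o f).
Proof.
move=> mA Afin mf fC f0.
have intA : mu.-integrable setT (EFin \o (fun x => C * \1_A x)).
  have h : mu.-integrable setT (EFin \o \1_A).
    apply/integrableP; split; first exact/measurable_EFinP.
    under eq_integral do rewrite /= ger0_norm ?indicE ?ler0n //.
    by rewrite integral_indic // setIT.
  exact: (integrableZl measurableT C h).
apply: (le_integrable measurableT _ _ intA); first exact/measurable_EFinP.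
move=> x _ /=; rewrite lee_fin indicE.
have C0 : 0 <= C := le_trans (normr_ge0 _) (fC x).
case: (boolP (x \in A)) => xA; first by rewrite mulr1 (ger0_norm C0).
by rewrite f0 ?normr0 // => /mem_set xA'; rewrite xA' in xA.
Qed.

(** The two difference quotients are the same function of [h], so derivability and the value of the
    derivative transfer together. *)
Lemma derive_reparam (R : realType) (V V' W : normedModType R) (phi : V' -> V)
    (F : V -> W) (x v : V') (w : V) :
  (forall h : R, phi (h *: v + x) = h *: w + phi x) ->
  'D_v (F \o phi) x = 'D_w F (phi x) /\
  (derivable F (phi x) w -> derivable (F \o phi) x v).
Proof.
move=> E.
have e : (fun h : R => h^-1 *: (((F \o phi) \o shift x) (h *: v) - (F \o phi) x)) =
    (fun h : R => h^-1 *: ((F \o shift (phi x)) (h *: w) - F (phi x))).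
  by apply/funext => h /=; rewrite E.
by rewrite /derivable /derive e.
Qed.

Lemma continuous_compact_support_bounded (R : realType) N (g : 'rV[R]_N -> R) (r : R) :
  continuous g -> (forall x, ~ ball 0 r x -> g x = 0) -> exists C, forall x, `|g x| <= C.
Proof.
move=> cg g0.
have cB : compact (closed_ball_ Num.norm (0 : 'rV[R]_N) r).
  apply: bounded_closed_compact; last exact: closed_closed_ball_.
  exists r; split=> [|s rs x /=]; first exact: num_real.
  by rewrite /closed_ball_ /= sub0r normrN => /le_trans; apply; exact: ltW.
have [C HC] : exists C, forall x, closed_ball_ Num.norm 0 r x -> `|g x| <= C.
  have cn : {within closed_ball_ Num.norm (0 : 'rV[R]_N) r, continuous g}.
    exact: continuous_subspaceT.
  have /compact_bounded[C [_ HC]] := continuous_compact cn cB; exists (C + 1) => x Bx.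
  by apply: HC; [rewrite ltrDl|exists x].
have [r0|r0] := leP 0 r; last first.
  exists 0 => x; rewrite g0 ?normr0 // -ball_normE /= => h.
  by have := lt_trans (le_lt_trans (normr_ge0 _) h) r0; rewrite ltxx.
exists (Num.max C 0) => x; rewrite le_max.
have [xr|xr] := pselect (ball (0 : 'rV[R]_N) r x); last by rewrite g0 // normr0 lexx orbT.
by rewrite HC //; move: xr; rewrite -ball_normE => /ltW.
Qed.

Section IntegralPartial.
Variable R : realType.
Local Notation BV N := (borel 'rV[R]_N).
Local Open Scope ereal_scope.

Lemma integral_compact_derivative (f g : R -> R) (r : R) :
  (forall t : R, is_derive t (1%R : R) f (g t)) -> continuous g ->
  (forall t, (r <= `|t|)%R -> f t = 0%R /\ g t = 0%R) ->
  \int[@lebesgue_measure R]_t (g t)%:E = 0.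
Proof.
move=> df cg sup.
(* The maximum with 1 makes the interval from [- s] to [s] nondegenerate, whatever the sign of
   [r]. *)
pose s := Num.max r 1%R.
have s0 : (0 < s)%R by rewrite lt_max ltr01 orbT.
have rs : (r <= s)%R by rewrite le_max lexx.
have E : (fun t : R => (g t)%:E) = (fun t => (g t)%:E) \_ `[(- s)%R, s]%classic.
  apply/funext => t; rewrite patchE; case: ifPn => // /negP ts.
  rewrite (sup t _).2 //; apply: (le_trans rs); rewrite leNgt; apply/negP => h.
  by apply: ts; apply/mem_set; rewrite /= in_itv /= -ler_norml ltW.
rewrite E -integral_mkcond (@continuous_FTC2 R g f).
- by rewrite (sup s _).1 ?(sup (- s)%R _).1 ?normrN ?gtr0_norm // subee.
- by rewrite gtrN.
- exact: continuous_subspaceT.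
- have cf t : {for t, continuous f}.
    apply: differentiable_continuous; apply/derivable1_diffP.
    by have [] := df t.
  split; first by move=> t _; have [] := df t.
    by apply: cvg_at_right_filter; exact: cf.
  by apply: cvg_at_left_filter; exact: cf.
- by move=> t _; rewrite derive1E; have [_ ->] := df t.
Qed.

Lemma cons_rV_ball N (t t' : R) (y y' : 'rV[R]_N) e : (0 < e)%R ->
  ball (cons_rV (t, y : BV N) : 'rV[R]_N.+1) e (cons_rV (t', y' : BV N)) <->
  ball t e t' /\ ball y e y'.
Proof.
move=> e0; have E := cons_rV_preimage_ball (cons_rV (t, y : BV N)) e0.
have e1 : (@cons_rV R N @^-1` ball (cons_rV (t, y : BV N) : 'rV[R]_N.+1) e) (t', y') =
  ball (cons_rV (t, y : BV N) : 'rV[R]_N.+1) e (cons_rV (t', y' : BV N)) by [].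
rewrite -e1 E cons_rV0 /=.
have -> : \row_j cons_rV (t, y : BV N) 0%R (lift 0%R j) = y :> 'rV[R]_N.
  by apply/rowP => j; rewrite mxE cons_rV_lift.
by [].
Qed.

Lemma cons_rV_ball0 N (t : R) (y : 'rV[R]_N) e :
  ball (0%R : 'rV[R]_N.+1) e (cons_rV (t, y : BV N)) -> ball 0%R e t /\ ball 0%R e y.
Proof.
move=> h; have e0 : (0 < e)%R by case: h.
apply/(cons_rV_ball _ _ _ _ e0); rewrite (_ : cons_rV _ = 0%R :> 'rV[R]_N.+1) //.
apply/rowP => j; rewrite [RHS]mxE; case: (unliftP 0%R j) => [k ->|->].
  by rewrite cons_rV_lift mxE.
by rewrite cons_rV0.
Qed.

Lemma cons_rV_continuous_l N (y : 'rV[R]_N) :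
  continuous (fun t : R => cons_rV (t, y : BV N) : 'rV[R]_N.+1).
Proof.
move=> t A /nbhs_ballP[e /= e0 eA]; apply/nbhs_ballP; exists e => // t' tt'.
by apply: eA; apply/(cons_rV_ball _ _ _ _ e0); split=> //; exact: ballxx.
Qed.

Lemma cons_rV_continuous_r N (t : R) :
  continuous (fun y : 'rV[R]_N => cons_rV (t, y : BV N) : 'rV[R]_N.+1).
Proof.
move=> y A /nbhs_ballP[e /= e0 eA]; apply/nbhs_ballP; exists e => // y' yy'.
by apply: eA; apply/(cons_rV_ball _ _ _ _ e0); split=> //; exact: ballxx.
Qed.

(** Fubini, with the order chosen by [i]: if [i] is the first coordinate, that variable is
    integrated first, by the fundamental theorem of calculus; otherwise the remaining variables are,
    by induction on the dimension. *)
Lemma integral_partial_derivative N (i : 'I_N) (F : 'rV[R]_N -> R) (r : R) :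
  (forall x, derivable F x (delta_mx 0%R i)) ->
  continuous (fun x => 'D_(delta_mx 0%R i) F x) ->
  (forall x, ~ ball 0%R r x -> F x = 0%R) ->
  \int[lebesgue_rV R N]_x ('D_(delta_mx 0%R i) F x)%:E = 0.
Proof.
elim: N i F r => [[]//|N IH] i F r dF cF supF.
pose g x := 'D_(delta_mx 0%R i) F x.
(* The derivative vanishes where [F] vanishes on a neighbourhood, that is for norm above [r];
   enlarging the radius by 1 avoids the sphere of radius [r]. *)
have supg x : ~ ball 0%R (r + 1)%R x -> g x = 0%R.
  move=> xr; apply: etrans _ (derive_cst (0%R : R) x (delta_mx 0%R i)).
  have oA : open [set y : 'rV[R]_N.+1 | (r < `|y|)%R].
    have -> : [set y : 'rV[R]_N.+1 | (r < `|y|)%R] =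
        ~` closed_ball_ Num.norm (0%R : 'rV[R]_N.+1) r.
      apply/seteqP; split=> y /=; rewrite /closed_ball_ /= sub0r normrN ltNge; first by move/negP.
      by move=> /negP.
    exact/closed_openC/closed_closed_ball_.
  have Ax : (r < `|x|)%R.
    apply: contra_notT xr; rewrite -leNgt -ball_normE /= sub0r normrN => xr.
    by rewrite (le_lt_trans xr) // ltrDl.
  apply: (derive_open_eq _ oA Ax) => y /= ry.
  by apply: supF; rewrite -ball_normE /= sub0r normrN; apply/negP; rewrite -leNgt ltW.
have [C gC] := continuous_compact_support_bounded cF supg.
have mg : measurable_fun (setT : set (BV N.+1)) g by exact: borel_continuous_real.
have [r0|r0] := ltP 0%R (r + 1)%R; last first.
  rewrite (eq_integral (fun=> 0)) ?integral0 // => x _.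
  rewrite -/(g x) supg // -ball_normE /= sub0r normrN.
  by move=> h; have := lt_le_trans (le_lt_trans (normr_ge0 _) h) r0; rewrite ltxx.
have mcons := @measurable_cons_rV R N.
pose G (z : measurableTypeR R * BV N) := g (cons_rV z).
have mG : measurable_fun setT G by exact: measurableT_comp mg mcons.
have iG : (@lebesgue_measure R \x lebesgue_rV R N).-integrable setT (EFin \o G).
  apply: (@integrable_bounded_support _ _ _ _ _
      (@cons_rV R N @^-1` ball (0%R : 'rV[R]_N.+1) (r + 1)%R) C) => //.
  - rewrite -[X in measurable X]setTI; apply: mcons => //.
    by apply: borel_open_measurable; exact: ball_open.
  - exact: (lebesgue_rV_ball (0%R : 'rV[R]_N.+1) r0).
  - by move=> z; exact: gC.
  - by move=> z; exact: supg.
have E1 : \int[lebesgue_rV R N.+1]_x (g x)%:E =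
    \int[@lebesgue_measure R \x lebesgue_rV R N]_z (G z)%:E.
  have mge : measurable_fun setT (EFin \o (g : BV N.+1 -> R)) by exact/measurable_EFinP.
  exact: (integral_pushforward mcons mge iG measurableT).
rewrite E1; case: (unliftP 0%R i) => [k ik|i0]; last first.
  rewrite -(integral21_prod_meas1 iG) (eq_integral (fun=> 0)) ?integral0 // => y _.
  have E h t : cons_rV (h *: (1%R : R) + t, y)%R =
      (h *: delta_mx 0 i + cons_rV (t, y) :> 'rV[R]_N.+1)%R.
    apply/rowP => j; rewrite i0 [RHS]mxE [X in _ = (X + _)%R]mxE [X in _ = (_ * X + _)%R]mxE.
    case: (unliftP 0%R j) => [l ->|->].
      by rewrite !cons_rV_lift mulr0 add0r.
    by rewrite !cons_rV0 eqxx /= mulr1 [h *: _]mulr1.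
  have nball s t : (0 < s)%R -> (s <= `|t|)%R -> ~ ball (0%R : 'rV[R]_N.+1) s (cons_rV (t, y)).
    move=> s0 st /cons_rV_ball0[+ _]; rewrite -ball_normE /= sub0r normrN.
    by apply/negP; rewrite -leNgt.
  apply: (@integral_compact_derivative (fun t => F (cons_rV (t, y))) _ (r + 1)%R).
  - move=> t; have [D1 D2] := @derive_reparam R 'rV[R]_N.+1 R R (fun t => cons_rV (t, y)) F
      t 1%R (delta_mx 0%R i) (E ^~ t).
    by apply: DeriveDef; [exact: D2|exact: D1].
  - move=> t; apply: (@continuous_comp _ _ _ (fun t : R => cons_rV (t, y) : 'rV[R]_N.+1) g).
      exact: cons_rV_continuous_l.
    exact: cF.
  - move=> t rt; split; last by apply: supg; exact: nball.
    apply: supF => h; have [h1 _] := cons_rV_ball0 h.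
    move: h1; rewrite -ball_normE /= sub0r normrN => tr.
    by have := lt_le_trans tr (le_trans _ rt); rewrite ltxx lerDl ler01 => /(_ isT).
rewrite -(integral12_prod_meas1 iG) (eq_integral (fun=> 0)) ?integral0 // => t _.
have E h y : cons_rV (t, (h *: (delta_mx 0 k : 'rV[R]_N) + y)%R) =
    (h *: delta_mx 0 i + cons_rV (t, y) :> 'rV[R]_N.+1)%R.
  apply/rowP => j; rewrite ik [RHS]mxE [X in _ = (X + _)%R]mxE [X in _ = (_ * X + _)%R]mxE.
  case: (unliftP 0%R j) => [l ->|->].
    by rewrite !cons_rV_lift /= [LHS]mxE [X in (X + _)%R = _]mxE
      [X in (_ * X + _)%R = _]mxE (inj_eq lift_inj).
  by rewrite !cons_rV0 mulr0 add0r.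
have D y := @derive_reparam R 'rV[R]_N.+1 'rV[R]_N R (fun y => cons_rV (t, y)) F y (delta_mx 0%R k)
  (delta_mx 0%R i) (E ^~ y).
have Dg : (fun y : 'rV[R]_N => 'D_(delta_mx 0%R k) ((F \o (fun y => cons_rV (t, y : BV N)))) y)
    = (fun y => G (t, y)).
  by apply/funext => y; exact: (D y).1.
rewrite -[LHS]/(\int[lebesgue_rV R N]_y (G (t, y))%:E).
apply: etrans (IH k (F \o (fun y => cons_rV (t, y : BV N))) r _ _ _).
- by apply: eq_integral => y _; congr (_%:E); exact: esym (D y).1.
- by move=> y; exact: (D y).2.
- rewrite Dg => y.
  apply: (@continuous_comp _ _ _ (fun y : 'rV[R]_N => cons_rV (t, y : BV N) : 'rV[R]_N.+1) g).
    exact: cons_rV_continuous_r.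
  exact: cF.
- by move=> y yr; apply: supF => /cons_rV_ball0[_].
Qed.

End IntegralPartial.

(** * Measures with a density *)

Section Density.
Context d (T : measurableType d) (R : realType).
Variables (nu lam : {measure set T -> \bar R}) (dens : T -> R).
Hypotheses (mdens : measurable_fun setT dens) (dens0 : forall x, 0 <= dens x).
Local Notation rho := (EFin \o dens).
Hypothesis nuE : forall A, measurable A -> nu A = (\int[lam]_(x in A) (dens x)%:E)%E.
Local Open Scope ereal_scope.
Import HBNNSimple.

Let mrho : measurable_fun setT rho. Proof. exact/measurable_EFinP. Qed.

Let rho0 x : 0 <= rho x. Proof. by rewrite lee_fin. Qed.

Lemma density_integral_nnsfun (h : {nnsfun T >-> R}) :
  \int[nu]_x (h x)%:E = \int[lam]_x ((h x)%:E * rho x).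
Proof.
have fE x : (h x)%:E = \sum_(y \in range h) (y * \1_(h @^-1` [set y]) x)%:E.
  by rewrite fsumEFin // -fimfunE.
under eq_integral do rewrite fE.
under [RHS]eq_integral do rewrite fE.
rewrite ge0_integral_fsum //; last 2 first.
- by move=> r; exact/measurable_EFinP/measurable_funM.
- by move=> r x _; exact: nnfun_muleindic_ge0.
under [RHS]eq_integral => x _.
  rewrite ge0_mule_fsuml; last by move=> r; exact: nnfun_muleindic_ge0.
  over.
rewrite ge0_integral_fsum //; last 2 first.
- move=> r; apply: emeasurable_funM => //.
  exact/measurable_EFinP/measurable_funM.
- by move=> r x _; rewrite mule_ge0 //; exact: nnfun_muleindic_ge0.
apply: eq_fsbigr => r rh.
have r0 : (0 <= r)%R by have [x _ <-] := set_mem rh.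
have mA : measurable (h @^-1` [set r]) by exact: measurable_sfunP.
transitivity (r%:E * nu (h @^-1` [set r])).
  under eq_integral do rewrite EFinM.
  rewrite (ge0_integralZl _ measurableT) //.
    by rewrite integral_indic // setIT.
  exact/measurable_EFinP.
rewrite nuE // [in LHS]integral_mkcond.
have mrA : measurable_fun setT (rho \_ (h @^-1` [set r])).
  by apply: (measurable_restrictT rho mA).1; exact: measurable_funTS.
have rA0 x : setT x -> 0 <= (rho \_ (h @^-1` [set r])) x.
  by move=> _; rewrite patchE; case: ifP.
rewrite -(ge0_integralZl _ measurableT mrA rA0); last by rewrite lee_fin.
apply: eq_integral => x _; rewrite patchE indicE; case: ifPn => _.
  by rewrite mulr1.
by rewrite mulr0 mule0 mul0e.
Qed.

Lemma density_integral (f : T -> \bar R) : measurable_fun setT f ->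
  (forall x, 0 <= f x) -> \int[nu]_x f x = \int[lam]_x (f x * rho x).
Proof.
move=> mf f0; pose h := nnsfun_approx measurableT mf.
have fE x : f x = limn (fun n => (h n x)%:E).
  by apply/esym/cvg_lim => //; exact: cvg_nnsfun_approx.
have E1 : \int[nu]_x f x = limn (fun n => \int[nu]_x (h n x)%:E).
  rewrite -monotone_convergence //.
  - by apply: eq_integral => x _; exact: fE.
  - by move=> n; exact/measurable_EFinP.
  - by move=> n x _; rewrite lee_fin.
  - by move=> x _ m n mn; rewrite lee_fin; exact/lefP/nd_nnsfun_approx.
have E2 : \int[lam]_x (f x * rho x) = limn (fun n => \int[lam]_x ((h n x)%:E * rho x)).
  rewrite -monotone_convergence //.
  - apply: eq_integral => x _; apply/esym/cvg_lim => //.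
    apply: cvgeZr => //; exact: cvg_nnsfun_approx.
  - by move=> n; apply: emeasurable_funM => //; exact/measurable_EFinP.
  - by move=> n x _; rewrite mule_ge0 // lee_fin.
  - move=> x _ m n mn; rewrite lee_wpmul2r // lee_fin; exact/lefP/nd_nnsfun_approx.
rewrite E1 E2; congr (limn _); apply/funext => n; exact: density_integral_nnsfun.
Qed.

End Density.

(** * The Riemannian volume *)

(** For an orthonormal basis [E] one has [\det E ^+ 2 * \det G = 1]. *)
Lemma posdef_det_gt0 (R : realType) N (G : 'M[R]_N) : G^T = G ->
  (forall v, v != 0 -> 0 < pairing G v v) -> 0 < \det G.
Proof.
move=> sG pG; have [|E EA oE] := @gram_schmidt _ _ _ sG pG _ (1%:M : 'M[R]_N).
  by rewrite row_free_unit unitmx1.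
have d : \det E ^+ 2 * \det G = 1.
  have := congr1 determinant oE; rewrite !det_mulmx det_tr det1 => h.
  by rewrite -[RHS]h expr2 mulrAC.
have d0 : \det E != 0 by apply: contra_eq_neq d => ->; rewrite expr0n mul0r eq_sym oner_eq0.
by rewrite -(pmulr_rgt0 _ (_ : 0 < \det E ^+ 2)) ?d // exprn_even_gt0.
Qed.

Section ChartIntegral.
Variables (R : realType) (N : nat) (M : smooth_manifold R N) (G : field M 'M[R]_N).
Variable mu : {measure set (borel M) -> \bar R}.
Hypothesis hG : is_riemannian_metric G.
Hypothesis hmu : is_riemannian_volume G mu.
Variable c : chart M.
Local Notation BV := (borel 'rV[R]_N).
Local Notation lam := (lebesgue_rV R N).

Definition volume_density : BV -> R := (fun x => Num.sqrt (\det (G c x))) \_ (img c).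

(** Made total so as to be measurable on all of [M]. The value 0 off the chart is harmless, as [mu]
    is restricted to [dom c] before being pushed forward. *)
Definition total_coord (p : borel M) : BV :=
  if p \in dom c then Defs.coord c p else 0.

Lemma measurable_img : measurable (img c : set BV).
Proof. by apply: borel_open_measurable; exact: img_open. Qed.

Lemma measurable_dom : measurable (dom c : set (borel M)).
Proof. by apply: borel_open_measurable; exact: dom_open. Qed.

Lemma open_chart_preimage (B : set 'rV[R]_N) : open B ->
  open (dom c `&` Defs.coord c @^-1` B).
Proof.
move=> oB; rewrite openE => p [cp Bp]; rewrite /interior.
have n1 : \forall q \near p, dom c q by apply: open_nbhs_nbhs; split=> //; exact: dom_open.
have nB : nbhs (Defs.coord c p) B by apply: open_nbhs_nbhs.
have n2 := Defs.coord_continuous cp nB.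
by apply: filterS2 n1 n2 => q; split.
Qed.

Lemma open_param_preimage (A : set M) : open A -> open (img c `&` param c @^-1` A).
Proof.
move=> oA; rewrite openE => x [cx Ax]; rewrite /interior.
have n1 : \forall y \near x, img c y by apply: open_nbhs_nbhs; split=> //; exact: img_open.
have nA : nbhs (param c x) A by apply: open_nbhs_nbhs.
have n2 := param_continuous cx nA.
by apply: filterS2 n1 n2 => q; split.
Qed.

Lemma measurable_total_coord : measurable_fun setT total_coord.
Proof.
apply: (@measurability _ _ (borel M) BV setT total_coord (@open 'rV[R]_N)) => //.
move=> _ [B oB <-]; rewrite setTI.
have -> : total_coord @^-1` B =
    (dom c `&` Defs.coord c @^-1` B) `|` (~` dom c `&` [set _ | B 0]).
  apply/seteqP; split=> p; rewrite /total_coord /=.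
    by case: ifPn => [/set_mem cp Bp|/negP cp B0]; [left|right; split=> // /mem_set].
  by case=> [[cp Bp]|[cp B0]]; [rewrite mem_set|rewrite memNset].
apply: measurableU; first by apply: borel_open_measurable; exact: open_chart_preimage.
have [B0|B0] := pselect (B 0); last first.
  rewrite (_ : _ `&` _ = set0) //; apply/seteqP; split=> // p [_ h].
  exact: (B0 h).
rewrite (_ : [set _ | _] = setT); last by apply/seteqP; split.
rewrite setIT; apply: measurableC; exact: measurable_dom.
Qed.

Lemma measurable_param : measurable_fun (img c : set BV) (param c : BV -> borel M).
Proof.
apply: (@measurability _ _ BV (borel M) _ _ (@open M)) => //.
by move=> _ [B oB <-]; apply: borel_open_measurable; exact: open_param_preimage.
Qed.

Lemma det_metric_gt0 x : img c x -> 0 < \det (G c x).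
Proof. by move=> cx; have [_ sG pG _] := hG; apply: posdef_det_gt0; [exact: sG|exact: pG]. Qed.

Lemma Ck_on_sqrt_det k : Ck_on k (img c) (fun x => Num.sqrt (\det (G c x))).
Proof.
have [CG _ _ _] := hG.
apply: Ck_on_sqrt; [exact: img_open|exact: det_metric_gt0|].
apply: Ck_on_det; first exact: img_open.
by move=> i j; apply: Ck_on_entry; [exact: img_open|exact: CG].
Qed.

Lemma measurable_volume_density : measurable_fun setT volume_density.
Proof.
apply: (measurable_restrictT _ measurable_img).1.
apply: borel_real_measurable; [exact: measurable_img| |exact: img_open].
by move=> x cx; exact: (Ck_on_continuous (Ck_on_sqrt_det 0) cx).
Qed.

Lemma volume_density_ge0 x : 0 <= volume_density x.
Proof. by rewrite /volume_density patchE; case: ifP => // _; exact: sqrtr_ge0. Qed.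

Local Open Scope ereal_scope.

Lemma volume_chart (A : set (borel M)) : measurable A -> A `<=` dom c ->
  mu A = \int[lam]_(x in Defs.coord c @` A) (volume_density x)%:E.
Proof.
move=> mA Ac; rewrite (hmu mA Ac).
have mcA : measurable (Defs.coord c @` A : set BV).
  have -> : Defs.coord c @` A = img c `&` param c @^-1` A.
    apply/seteqP; split=> [_ [p Ap <-]|x [[p cp <-]]].
      by split; [exists p => //; exact: Ac|rewrite /= coordK //; exact: Ac].
    by rewrite /= coordK // => Ap; exists p.
  exact: measurable_param measurable_img A mA.
rewrite [RHS]integral_mkcond.
have E : (fun x => (\1_(Defs.coord c @` A) x * Num.sqrt (\det (G c x)))%:E) =
    (EFin \o volume_density) \_ (Defs.coord c @` A).
  apply/funext => x; rewrite patchE indicE; case: ifPn => xA.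
    rewrite mul1r /volume_density /= patchE mem_set //.
    by move/set_mem : xA => [p Ap <-]; exists p => //; exact: Ac.
  by rewrite mul0r.
rewrite E lebesgue_integral_rVE //.
  apply: (measurable_restrictT _ mcA).1; apply: measurable_funTS.
  by apply/measurable_EFinP; exact: measurable_volume_density.
by move=> x; rewrite patchE; case: ifP => // _; rewrite lee_fin volume_density_ge0.
Qed.

(** [nu] is the image of the restriction of [mu] to the chart; the definition of the volume says
    that it has density [volume_density] with respect to Lebesgue measure. *)
Lemma chart_integral_ge0 (F : borel M -> \bar R) : measurable_fun setT F ->
  (forall p, 0 <= F p) -> (forall p, ~ dom c p -> F p = 0) ->
  \int[mu]_p F p = \int[lam]_x (((F \o param c) \_ (img c)) x * (volume_density x)%:E).
Proof.
move=> mF F0 Fc.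
pose nu := pushforward (mrestr mu measurable_dom) total_coord.
have nuE (B : set BV) : measurable B -> nu B = \int[lam]_(x in B) (volume_density x)%:E.
  move=> mB; rewrite /nu /pushforward /mrestr volume_chart; last 2 first.
  - apply: measurableI; last exact: measurable_dom.
    by rewrite -[X in measurable X]setTI; exact: measurable_total_coord.
  - by move=> p [].
  have -> : Defs.coord c @` (total_coord @^-1` B `&` dom c) = B `&` img c.
    apply/seteqP; split=> [_ [p [Bp cp] <-]|x [Bx [p cp px]]].
      by move: Bp; rewrite /= /total_coord mem_set // => Bp; split=> //; exists p.
    by exists p => //; split=> //; rewrite /= /total_coord mem_set // px.
  rewrite integral_mkcond [RHS]integral_mkcond; apply: eq_integral => x _.
  rewrite !patchE in_setI; case: (x \in B) => //=.
  by case: ifPn => // /negbTE xc; rewrite /volume_density patchE xc.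
have mf : measurable_fun setT ((F \o param c) \_ (img c) : BV -> \bar R).
  apply: (measurable_restrictT _ measurable_img).1.
  exact: measurableT_comp mF measurable_param.
have f0 x : 0 <= ((F \o param c) \_ (img c)) x.
  by rewrite patchE; case: ifPn => // _; exact: F0.
have h1 := density_integral measurable_volume_density volume_density_ge0 nuE mf f0.
have h2 := ge0_integral_pushforward measurable_total_coord
  (mrestr mu measurable_dom) measurableT mf (fun x _ => f0 x).
refine (etrans _ (h1 measurable_total_coord)); refine (etrans _ (esym h2)).
have mind : measurable_fun setT (\1_(dom c) : borel M -> R).
  by apply: measurable_indic; exact: measurable_dom.
(* The restriction of [mu] to the chart is itself a measure with a density, namely the indicator of
   [dom c] with respect to [mu]. *)
rewrite preimage_setT (density_integral (lam := mu) mind) //; last 3 first.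
- move=> A mA; rewrite (integral_indic _ mA measurable_dom).
  by rewrite /= /mrestr setIC.
- exact: measurableT_comp mf measurable_total_coord.
- by move=> p; exact: f0.
apply: eq_integral => p _ /=; rewrite indicE /total_coord.
case: ifPn => [/set_mem cp|/negP cp]; last by rewrite Fc ?mule0 // => /mem_set.
by rewrite mule1 patchE mem_set /= ?coordK //; exists p.
Qed.

End ChartIntegral.

(** The single finite-subcover argument behind finiteness of the volume, existence of cutoffs and
    uniformity of the estimates in [t]. *)
Lemma compact_induction (T : ptopologicalType) (P : set T -> Prop) (K : set T) :
  compact K -> P set0 -> (forall A B, P A -> P B -> P (A `|` B)) ->
  (forall A B, A `<=` B -> P B -> P A) ->
  (forall p, K p -> exists U, [/\ open U, U p & P U]) -> P K.
Proof.
move=> cK P0 PU Pm Ploc.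
have h p : exists U, K p -> [/\ open U, U p & P U].
  have [Kp|nKp] := pselect (K p); last by exists set0.
  by have [U HU] := Ploc p Kp; exists U.
pose f p := sval (cid (h p)).
have Hf p : K p -> [/\ open (f p), f p p & P (f p)] := svalP (cid (h p)).
move: cK; rewrite compact_cover => /(_ T K f).
case=> [p /Hf[]//|p Kp|D DK KD]; first by exists p => //; have [] := Hf p Kp.
apply: Pm KD _.
have gen (r : seq T) : (forall p, p \in r -> P (f p)) ->
    P (\big[setU/set0]_(p <- r) f p).
  elim: r => [|p r IH] PD; first by rewrite big_nil.
  rewrite big_cons; apply: PU; first by apply: PD; rewrite mem_head.
  by apply: IH => q qs; apply: PD; rewrite in_cons qs orbT.
have -> : cover [set` D] f = \big[setU/set0]_(p <- D) f p.
  by rewrite -bigcup_seq.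
by apply: gen => p pD; have /set_mem/Hf[] := DK p pD.
Qed.

Section MeasureComparison.
Context d (T : measurableType d) (R : realType).
Variables (mu1 mu2 : {measure set T -> \bar R}) (D : set T) (k : R).
Hypotheses (mD : measurable D) (k0 : 0 <= k).
Hypothesis mu21 : forall A, measurable A -> A `<=` D -> (mu2 A <= k%:E * mu1 A)%E.
Local Open Scope ereal_scope.
Import HBNNSimple.

Let integral_nnsfun_sum (mu : {measure set T -> \bar R}) (h : {nnsfun T >-> R}) :
  \int[mu]_(x in D) (h x)%:E = \sum_(y \in range h) y%:E * mu (h @^-1` [set y] `&` D).
Proof.
have fE x : (h x)%:E = \sum_(y \in range h) (y * \1_(h @^-1` [set y]) x)%:E.
  by rewrite fsumEFin // -fimfunE.
under eq_integral do rewrite fE.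
rewrite ge0_integral_fsum //; last 2 first.
- by move=> r; apply/measurable_EFinP; apply: measurable_funM => //; exact: measurable_funTS.
- by move=> r x _; exact: nnfun_muleindic_ge0.
apply: eq_fsbigr => r rh.
have r0 : (0 <= r)%R by have [x _ <-] := set_mem rh.
under eq_integral do rewrite EFinM.
rewrite (ge0_integralZl _ mD) //.
  by rewrite (integral_indic _ mD).
by apply/measurable_EFinP; exact: measurable_funTS.
Qed.

(** The inequality holds for simple functions, level set by level set, and passes to the supremum
    over an approximating sequence common to both measures. *)
Lemma le_measure_integral (f : T -> \bar R) : measurable_fun D f ->
  (forall x, D x -> 0 <= f x) ->
  \int[mu2]_(x in D) f x <= k%:E * \int[mu1]_(x in D) f x.
Proof.
move=> mf f0; pose h := nnsfun_approx mD mf.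
have nd (mu : {measure set T -> \bar R}) :
    nondecreasing_seq (fun n => \int[mu]_(x in D) (h n x)%:E).
  move=> m n mn; apply: ge0_le_integral => //.
  - by move=> x _; rewrite lee_fin.
  - by apply/measurable_EFinP; exact: measurable_funTS.
  - by apply/measurable_EFinP; exact: measurable_funTS.
  - by move=> x _; rewrite lee_fin; exact/lefP/nd_nnsfun_approx.
have E (mu : {measure set T -> \bar R}) : \int[mu]_(x in D) f x =
    ereal_sup (range (fun n => \int[mu]_(x in D) (h n x)%:E)).
  rewrite -(cvg_lim _ (ereal_nondecreasing_cvgn (nd mu))) // -monotone_convergence //.
  - apply: eq_integral => x /set_mem Dx; apply/esym/cvg_lim => //.
    by apply: cvg_nnsfun_approx => // y Dy; exact: f0.
  - by move=> n; apply/measurable_EFinP; exact: measurable_funTS.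
  - by move=> n x _; rewrite lee_fin.
  - by move=> x _ m n mn; rewrite lee_fin; exact/lefP/nd_nnsfun_approx.
rewrite !E; apply: ge_ereal_sup => _ [n _ <-].
apply: (@le_trans _ _ (k%:E * \int[mu1]_(x in D) (h n x)%:E)).
  rewrite !integral_nnsfun_sum ge0_mule_fsumr; last first.
    move=> r; have [r0|r0] := leP 0%R r; first by rewrite mule_ge0.
    by rewrite preimage_nnfun0 // set0I measure0 mule0.
  apply: lee_fsum => // r [x _ <-].
  rewrite muleCA lee_wpmul2l ?lee_fin //; apply: mu21; last by move=> y [].
  by apply: measurableI => //; exact: measurable_sfunP.
by rewrite lee_wpmul2l ?lee_fin //; apply: ereal_sup_ubound; exists n.
Qed.

End MeasureComparison.

(** * Integrals of derivatives along Killing fields *)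

Lemma Ck_on_local (R : realType) (V W : normedModType R) k (A : set V) (f : V -> W) :
  (forall x, A x -> exists B, [/\ open B, B x & Ck_on k B f]) -> Ck_on k A f.
Proof.
elim: k f => [|k IH] f h.
  by move=> x Ax; have [B [oB Bx Cf]] := h x Ax; exact: Cf.
split=> [x Ax|v].
  by have [B [oB Bx Cf]] := h x Ax; exact: Ck_on_differentiable Cf Bx.
apply: IH => x Ax; have [B [oB Bx Cf]] := h x Ax.
by exists B; split=> //; exact: Ck_on_derive Cf.
Qed.

Lemma Ck_on1_comp_real (R : realType) (V : normedModType R) (A : set V) (u : V -> R)
    (q dq : R -> R) : open A -> (forall t : R, is_derive t (1 : R) q (dq t)) ->
  continuous dq -> Ck_on 1 A u -> Ck_on 1 A (q \o u).
Proof.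
move=> oA hq cdq Cu; have [du Du] := Cu.
have dfq t : differentiable q t by apply/derivable1_diffP; have [] := hq t.
split=> [x Ax|v].
  by apply: differentiable_comp; [exact: du|exact: dfq].
apply: (@Ck_on_eq _ _ _ _ _ (fun x => dq (u x) * 'D_v u x)) => //.
  move=> x Ax; apply/esym; apply: etrans (derive_comp_diff v (du x Ax) (dfq _)) _.
  move: ('D_v u x) => s; rewrite deriveE // -[s in LHS]mulr1 -[_ * 1]/(s *: 1).
  by rewrite linearZ -deriveE // mulrC; have [_ ->] := hq (u x).
apply: Ck_onM => //; last exact: Du.
move=> x Ax; apply: continuous_comp; last exact: cdq.
by apply: differentiable_continuous; exact: du.
Qed.

Lemma Ck_on1_comp (R : realType) (N N' : nat) (A : set 'rV[R]_N) (B : set 'rV[R]_N')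
    (t : 'rV[R]_N -> 'rV[R]_N') (f : 'rV[R]_N' -> R) :
  open A -> Ck_on 1 A t -> (forall x, A x -> B (t x)) -> Ck_on 1 B f ->
  Ck_on 1 A (f \o t).
Proof.
move=> oA [dt Dt] AB [df Df]; split=> [x Ax|v].
  by apply: differentiable_comp; [exact: dt|apply: df; exact: AB].
apply: (@Ck_on_eq _ _ _ _ _
  (fun x => \sum_j 'D_v t x 0 j * 'D_(delta_mx 0 j) f (t x))) => //.
  move=> x Ax; have dft := df _ (AB x Ax).
  by rewrite (derive_comp_diff v (dt x Ax) dft) (derive_rV _ dft).
apply: Ck_on_sum => // j _; apply: Ck_onM => //.
  by apply: (@Ck_on_entry _ _ 0 A _ _ (fun x => 'D_v t x) 0 j) => //; exact: Dt.
move=> x Ax; apply: (@continuous_comp _ _ _ t ('D_(delta_mx 0 j) f)).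
  by apply: differentiable_continuous; exact: dt.
by apply: Df; exact: AB.
Qed.

(** * Bump functions of class C^1 *)

Section Bump.
Variable R : realType.

(** The square of the positive part: the simplest C^1 function that is positive exactly for [y > 0],
    and one derivative suffices for a single integration by parts. *)
Definition possq (y : R) : R := y * Num.max y 0.

Lemma is_derive_possq (y : R) : is_derive y (1 : R) possq (2 * Num.max y 0).
Proof.
have [y0|y0|->] := ltgtP y 0.
- apply: (@near_eq_is_derive _ _ _ (cst 0)); last first.
    by rewrite mulr0; exact: is_derive_cst.
  have : \forall z \near y, z < 0 by exact: lt_nbhsl.
  by apply: filterS => z z0; rewrite /possq max_r ?mulr0 // ltW.
- apply: (@near_eq_is_derive _ _ _ (fun z : R => z * z : R)); last first.
    have h := is_deriveM (is_derive_id y (1 : R)) (is_derive_id y (1 : R)).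
    by apply: is_derive_eq h _; rewrite [RHS]mulr_natl [RHS]mulr2n; congr (_ + _); rewrite [LHS]mulr1.
  have : \forall z \near y, 0 < z by exact: lt_nbhsr.
  by apply: filterS => z z0; rewrite /possq max_l // ltW.
rewrite mulr0.
(* At the gluing point 0 the difference quotient is at most [h] in absolute value. *)
have h : (fun h : R => h^-1 *: ((possq \o shift 0) (h *: 1) - possq 0)) @ 0^' --> (0 : R).
  apply/cvgrPdist_le => e e0; near=> h.
  have h0 : h != 0 by near: h; exact: nbhs_dnbhs_neq.
  rewrite /= /possq [h *: 1]mulr1 addr0 mul0r subr0 sub0r normrN.
  rewrite [_ *: _]mulKf // (@le_trans _ _ `|h|) //.
    by case: (leP h 0) => h1; rewrite ?normr0.
  by near: h; apply: dnbhs0_le.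
by apply: DeriveDef; [apply/cvg_ex; exists 0|exact/cvg_lim].
Unshelve. all: by end_near. Qed.

Lemma possq_ge0 y : 0 <= possq y.
Proof.
by rewrite /possq; case: (leP y 0) => y0; rewrite ?mulr0 // mulr_ge0 // ltW.
Qed.

Lemma possq_gt0 y : 0 < y -> 0 < possq y.
Proof. by move=> y0; rewrite /possq max_l ?mulr_gt0 // ltW. Qed.

Lemma possq_eq0 y : y <= 0 -> possq y = 0.
Proof. by move=> y0; rewrite /possq max_r // mulr0. Qed.

Variables (N : nat) (a : 'rV[R]_N) (r : R).

(** Balls of ['rV] are cubes, for the norm is the maximum of the coordinates; hence a product over
    coordinates is positive exactly on the ball. *)
Definition bump (x : 'rV[R]_N) : R := \prod_j possq (r ^+ 2 - (x 0 j - a 0 j) ^+ 2).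

Lemma Ck_on_coord k (A : set 'rV[R]_N) j :
  Ck_on k A (fun x : 'rV[R]_N => x 0 j).
Proof.
apply: (@Ck_on_sub _ _ _ _ _ setT) => //; apply: Ck_on_entry; first exact: openT.
elim: k => [|k IH]; first by move=> x _; exact: cvg_id.
split=> [x _|v]; first exact: ex_diff.
have -> : (fun x : 'rV[R]_N => 'D_v id x) = (fun=> v).
  by apply/funext => x; rewrite derive_id.
exact: Ck_on_cst.
Qed.

Lemma Ck_on_bump : Ck_on 1 setT bump.
Proof.
apply: Ck_on_prod => [|j _]; first exact: openT.
apply: (@Ck_on1_comp_real _ _ _ (fun x : 'rV[R]_N => r ^+ 2 - (x 0 j - a 0 j) ^+ 2)
  possq (fun y => 2 * Num.max y 0)); [exact: openT|exact: is_derive_possq| |].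
  move=> y; apply: (@continuousM R R^o (cst 2) (fun y : R => Num.max y 0)).
    exact: cvg_cst.
  by apply: (@continuous_max R R^o id (cst 0)); [exact: cvg_id|exact: cvg_cst].
have oT : open (setT : set 'rV[R]_N) by exact: openT.
have C1 : Ck_on 1 setT (fun x : 'rV[R]_N => x 0 j - a 0 j).
  by apply: Ck_onB => //; [exact: Ck_on_coord|exact: Ck_on_cst].
apply: (Ck_onB oT); first exact: Ck_on_cst.
by apply: (Ck_on_eq oT _ (Ck_onM oT C1 C1)) => x _; rewrite expr2.
Qed.

Lemma bump_ge0 x : 0 <= bump x.
Proof. by apply: prodr_ge0 => j _; exact: possq_ge0. Qed.

Lemma bump_gt0 x : ball a r x -> 0 < bump x.
Proof.
move=> ax; have r0 : 0 < r by case: ax.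
have /(rV_ballE _ _ r0) h := ax.
apply: prodr_gt0 => j _; apply: possq_gt0.
have : `|a 0 j - x 0 j| < r by exact: (h j).
move: (a 0 j) (x 0 j) => u w h1; rewrite subr_gt0 -real_normK ?num_real // distrC.
by rewrite ltr_pXn2r // nnegrE ?normr_ge0 // ltW.
Qed.

Lemma bump_eq0 x : ~ ball a r x -> 0 < r -> bump x = 0.
Proof.
move=> nax r0; have [j nj] : exists j, ~ ball (a 0 j) r (x 0 j).
  by apply/existsNP => h; apply: nax; apply/rV_ballE.
rewrite /bump (bigD1 j) //= possq_eq0 ?mul0r // subr_le0.
have : r <= `|a 0 j - x 0 j| by rewrite leNgt; apply/negP.
move: (a 0 j) (x 0 j) => u w h1; rewrite -[leRHS]real_normK ?num_real // distrC.
by rewrite lerXn2r // nnegrE ?normr_ge0 // ltW.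
Qed.

End Bump.

(** Contraction with cofactors is the trace against the adjugate, and a matrix times its adjugate is
    scalar. With [is_derive_det] this differentiates the determinant of the metric. *)
Lemma lie_det_trace (R : comUnitRingType) N (G J : 'M[R]_N) :
  \sum_i \sum_j (J *m G + G *m J^T) i j * cofactor G i j = 2 * (\tr J * \det G).
Proof.
have E (A : 'M[R]_N) : \sum_i \sum_j A i j * cofactor G i j = \tr (A *m \adj G).
  by apply: eq_bigr => i _; rewrite mxE; apply: eq_bigr => j _; rewrite [\adj G j i]mxE.
rewrite E mulmxDl mxtraceD -mulmxA mul_mx_adj mul_mx_scalar mxtraceZ.
rewrite [X in _ + X]mxtrace_mulC mulmxA mul_adj_mx mul_scalar_mx mxtraceZ mxtrace_tr.
by rewrite mulrC -mulr2n mulr_natl.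
Qed.

(** * Divergence of a Killing field *)

Section KillingDivergence.
Variables (R : realType) (N : nat) (U : set 'rV[R]_N) (G : 'rV[R]_N -> 'M[R]_N).
Variable X : 'rV[R]_N -> 'rV[R]_N.
Hypotheses (oU : open U) (CG : smooth_on U G) (CX : smooth_on U X).
Hypothesis sG : forall x, U x -> (G x)^T = G x.
Hypothesis pG : forall x, U x -> forall v, v != 0 -> 0 < pairing (G x) v v.
Hypothesis kX : forall x, U x -> forall u v, lie_metric X G x u v = 0.

Let dG x : U x -> differentiable G x.
Proof. by move=> Ux; exact: Ck_on_differentiable (CG 1) Ux. Qed.

Let dX x : U x -> differentiable X x.
Proof. by move=> Ux; exact: Ck_on_differentiable (CX 1) Ux. Qed.

Let J x : 'M[R]_N := \matrix_i 'D_(delta_mx 0 i) X x.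

Lemma killing_derive_metric x : U x ->
  'D_(X x) G x = - (J x *m G x + G x *m (J x)^T).
Proof.
move=> Ux; apply/matrixP => i j.
have h := kX Ux (delta_mx 0 i) (delta_mx 0 j).
have E0 (k l : 'I_N) :
    pairing (G x) ('D_(delta_mx 0 k) X x) (delta_mx 0 l) = (J x *m G x) k l.
  have -> : (J x *m G x) k l = (row k (J x) *m G x) 0 l by rewrite -row_mul [RHS]mxE.
  by rewrite rowK /pairing trmx_delta -colE [LHS]mxE.
have E2 : pairing (G x) (delta_mx 0 i) ('D_(delta_mx 0 j) X x) = (G x *m (J x)^T) i j.
  rewrite (pairing_sym _ _ (sG Ux)) E0.
  by rewrite -[in RHS](sG Ux) -trmx_mul [RHS]mxE.
move: h; rewrite /lie_metric E0 E2 pairing_delta => h.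
rewrite [RHS]mxE [X in - X]mxE; apply/eqP; rewrite -addr_eq0 addrA; exact/eqP.
Qed.

Lemma det_differentiable x : U x -> differentiable (fun y => \det (G y)) x.
Proof.
move=> Ux; apply: (@Ck_on_differentiable _ _ _ 0 U) Ux.
by apply: Ck_on_det => // i j; exact: (Ck_on_entry i j oU (CG 1)).
Qed.

Lemma killing_derive_det x : U x ->
  'D_(X x) (fun y => \det (G y)) x = - (2 * (\tr (J x) * \det (G x))).
Proof.
move=> Ux; rewrite -lie_det_trace.
have dGX : derivable G x (X x) by apply: diff_derivable; exact: dG.
have h := is_derive_det (fun i j => is_derive_entry i j dGX).
have [_ ->] := h; rewrite (killing_derive_metric Ux) -sumrN; apply: eq_bigr => i _.
rewrite -sumrN; apply: eq_bigr => j _.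
by rewrite [X in X * _]mxE mulNr.
Qed.

(** In the product rule the trace of the Jacobian [J] of [X] appears with opposite signs: once from
    the partial derivatives of [X], once from the derivative of the volume density along [X], which
    the Killing equation determines. *)
Lemma killing_divergence (h : 'rV[R]_N -> R) x : U x -> differentiable h x ->
  \sum_i 'D_(delta_mx 0 i) (fun y => h y * X y 0 i * Num.sqrt (\det (G y))) x =
  lie_fun X h x * Num.sqrt (\det (G x)).
Proof.
move=> Ux dh; have d0 : 0 < \det (G x) by apply: posdef_det_gt0; [exact: sG|exact: pG].
have s0 : Num.sqrt (\det (G x)) != 0 by rewrite sqrtr_eq0 -ltNge.
have dsq v : is_derive x v (fun y => Num.sqrt (\det (G y)))
    ((2 * Num.sqrt (\det (G x)))^-1 * 'D_v (fun y => \det (G y)) x).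
  have dd := det_differentiable Ux.
  have [dq Dq] := is_derive1_sqrt d0.
  have dfq : differentiable (Num.sqrt : R -> R) (\det (G x)) by apply/derivable1_diffP.
  have E := derive_comp_diff v dd dfq.
  apply: DeriveDef; first by apply: diff_derivable; exact: differentiable_comp dd dfq.
  apply: etrans E _; move: ('D_v _ x) => t.
  rewrite deriveE // -[t in LHS]mulr1 -[t * 1]/(t *: 1) linearZ -deriveE // Dq.
  by rewrite [LHS]mulrC.
have E i : 'D_(delta_mx 0 i) (fun y => h y * X y 0 i * Num.sqrt (\det (G y))) x =
    'D_(delta_mx 0 i) h x * X x 0 i * Num.sqrt (\det (G x))
    + h x * J x i i * Num.sqrt (\det (G x))
    + h x * X x 0 i * ((2 * Num.sqrt (\det (G x)))^-1
       * 'D_(delta_mx 0 i) (fun y => \det (G y)) x).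
  have dhi : derivable h x (delta_mx 0 i) by exact: diff_derivable.
  have dXi : derivable X x (delta_mx 0 i) by apply: diff_derivable; exact: dX.
  have h1 := derivableP dhi; have h2 := is_derive_entry 0 i dXi.
  have [_ h3] := is_deriveM (is_deriveM h1 h2) (dsq (delta_mx 0 i)).
  apply: etrans h3 _; rewrite [J x i i]mxE.
  have aux (a b c d e k : R) : (a * b) * k + c * (a * d + b * e) =
    e * b * c + a * d * c + a * b * k by ring.
  exact: aux.
rewrite (eq_bigr _ (fun i _ => E i)) !big_split /= /lie_fun (derive_rV _ dh).
have e1 : \sum_i h x * X x 0 i * ((2 * Num.sqrt (\det (G x)))^-1
       * 'D_(delta_mx 0 i) (fun y => \det (G y)) x) =
    h x * ((2 * Num.sqrt (\det (G x)))^-1 * 'D_(X x) (fun y => \det (G y)) x).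
  rewrite (derive_rV _ (det_differentiable Ux)) !mulr_sumr; apply: eq_bigr => i _.
  have aux (a b c d : R) : a * b * (c * d) = a * (c * (b * d)) by ring.
  exact: aux.
rewrite e1 killing_derive_det // -!mulr_suml -mulr_sumr.
have e2 : \sum_i 'D_(delta_mx 0 i) h x * X x 0 i = \sum_j X x 0 j *: 'D_(delta_mx 0 j) h x.
  by apply: eq_bigr => i _; rewrite [LHS]mulrC.
rewrite e2 -/(\tr (J x)).
have := sqr_sqrtr (ltW d0); move: s0.
have aux (a b c t d : R) : t != 0 -> t ^+ 2 = d ->
   a * t + b * c * t + b * ((2 * t)^-1 * - (2 * (c * d))) = a * t.
  by move=> t0 <-; field.
exact: aux.
Qed.

End KillingDivergence.

(** * Functions on the manifold and their derivatives along fields *)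

Section ManifoldFunctions.
Variables (R : realType) (N : nat) (M : smooth_manifold R N).
Implicit Types (c d : chart M) (phi psi : M -> R).

Definition Ck_fun k phi := forall c, Ck_on k (img c) (phi \o param c).

(** It reads a field in the chart [chart_at p], the chart used by [mutual_curvature]; for an
    invariant field every other chart gives the same value. *)
Definition fun_of (psi : field M R) (p : M) : R :=
  psi (chart_at p) (Defs.coord (chart_at p) p).

Lemma dom_chart_at (p : M) : dom (chart_at p) p.
Proof. exact: projT2 (cid (dom_cover p)). Qed.

Lemma img_coord c (p : M) : dom c p -> img c (Defs.coord c p).
Proof. by move=> cp; exists p. Qed.

Lemma fun_of_param (psi : field M R) c x : scalar_invariant psi -> img c x ->
  fun_of psi (param c x) = psi c x.
Proof.
move=> ipsi cx; have dp := dom_chart_at (param c x).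
have h : overlap c (chart_at (param c x)) x by apply/overlapP.
by rewrite (ipsi c _ x h).
Qed.

Lemma fun_of_coord (psi : field M R) c p : scalar_invariant psi -> dom c p ->
  fun_of psi p = psi c (Defs.coord c p).
Proof.
by move=> ipsi cp; rewrite -[in LHS](coordK cp) fun_of_param //; exact: img_coord.
Qed.

Lemma Ck_fun_of k (psi : field M R) : scalar_invariant psi ->
  (forall c, Ck_on k (img c) (psi c)) -> Ck_fun k (fun_of psi).
Proof.
move=> ipsi Cpsi c; apply: (Ck_on_eq (@img_open _ _ M c) _ (Cpsi c)) => x cx.
by rewrite /= fun_of_param.
Qed.

Lemma scalar_invariant_param phi : scalar_invariant (fun c => phi \o param c).
Proof. by move=> c d x h; rewrite /= param_transition. Qed.

Lemma near_param c x (A : set M) : img c x -> open A -> A (param c x) ->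
  exists B, [/\ open B, B x, B `<=` img c & forall y, B y -> A (param c y)].
Proof.
move=> cx oA Ax; exists (img c `&` param c @^-1` A); split=> [| |y []|y []] //.
exact: open_param_preimage.
Qed.

Lemma near_coord c p (B : set 'rV[R]_N) : dom c p -> open B -> B (Defs.coord c p) ->
  exists A, [/\ open A, A p, A `<=` dom c & forall q, A q -> B (Defs.coord c q)].
Proof.
move=> cp oB Bp; exists (dom c `&` Defs.coord c @^-1` B); split=> [| |q []|q []] //.
exact: open_chart_preimage.
Qed.

Lemma Ck_fun_continuous k phi : Ck_fun k phi -> continuous phi.
Proof.
move=> Cphi p; have cp := dom_chart_at p; set c := chart_at p in cp.
apply: (@near_eq_continuous M R ((phi \o param c) \o Defs.coord c) phi p).
  apply: (filterS _ (open_nbhs_nbhs (conj (dom_open c) cp))) => q cq /=.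
  by rewrite coordK.
apply: continuous_comp; first exact: Defs.coord_continuous.
exact: Ck_on_continuous (Cphi c) (img_coord cp).
Qed.

Lemma compact_manifold_closed (K : set M) : compact K -> closed K.
Proof. by apply: compact_closed; exact: carrier_hausdorff. Qed.

Lemma Ck_funM k phi psi : Ck_fun k phi -> Ck_fun k psi -> Ck_fun k (fun p => phi p * psi p).
Proof.
by move=> h1 h2 c; exact: (Ck_onM (@img_open _ _ M c) (h1 c) (h2 c)).
Qed.

Lemma Ck_funD k phi psi : Ck_fun k phi -> Ck_fun k psi -> Ck_fun k (fun p => phi p + psi p).
Proof.
by move=> h1 h2 c; exact: (Ck_onD (@img_open _ _ M c) (h1 c) (h2 c)).
Qed.

Section LieM.
Variable X : field M 'rV[R]_N.
Hypothesis hX : is_vector_field X.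

Definition lieM phi : M -> R := fun_of (fun c => lie_fun (X c) (phi \o param c)).

Lemma lie_scalar_invariant phi : Ck_fun 1 phi ->
  scalar_invariant (fun c => lie_fun (X c) (phi \o param c)).
Proof.
move=> Cphi; apply: (scalar_invariant_lie hX) => //; exact: scalar_invariant_param.
Qed.

Lemma lieM_param phi c x : Ck_fun 1 phi -> img c x ->
  lieM phi (param c x) = lie_fun (X c) (phi \o param c) x.
Proof. by move=> /lie_scalar_invariant h cx; rewrite /lieM fun_of_param. Qed.

Lemma Ck_lieM k phi : Ck_fun k.+1 phi -> Ck_fun k (lieM phi).
Proof.
move=> Cphi; apply: Ck_fun_of.
  by apply: lie_scalar_invariant => c; exact: Ck_on_le _ (Cphi c).
move=> c; apply: Ck_on_derive_field; [exact: img_open|exact: Cphi|].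
by move=> j; have := vector_field_entries c hX; apply.
Qed.

Lemma lieM_eq0 phi p (A : set M) : open A -> A p -> (forall q, A q -> phi q = 0) ->
  lieM phi p = 0.
Proof.
move=> oA Ap phi0; have cp := dom_chart_at p; set c := chart_at p in cp.
have Acp : A (param c (Defs.coord c p)) by rewrite coordK.
have [B [oB Bx Bc BA]] := near_param (img_coord cp) oA Acp.
rewrite /lieM /fun_of -/c /lie_fun.
rewrite (derive_open_eq (g := cst 0) _ oB Bx) ?derive_cst // => y /BA.
exact: phi0.
Qed.

Lemma lieMD phi psi p : Ck_fun 1 phi -> Ck_fun 1 psi ->
  lieM (fun q => phi q + psi q) p = lieM phi p + lieM psi p.
Proof.
move=> h1 h2; have cp := img_coord (dom_chart_at p).
have d1 := Ck_on_differentiable (h1 _) cp; have d2 := Ck_on_differentiable (h2 _) cp.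
apply: (deriveD (f := phi \o param (chart_at p)) (g := psi \o param (chart_at p)));
  exact: diff_derivable.
Qed.

End LieM.

End ManifoldFunctions.

Lemma compact_fun_bounded (R : realType) (T : topologicalType) (K : set T) (f : T -> R) :
  compact K -> (forall x, K x -> {for x, continuous f}) ->
  exists2 C, 0 <= C & forall x, K x -> `|f x| <= C.
Proof.
move=> cK cf; have wf : {within K, continuous f}.
  by apply: continuous_in_subspaceT => x /set_mem; exact: cf.
have /compact_bounded[C [_ HC]] := continuous_compact wf cK.
exists (`|C| + 1) => [|x Kx]; first by rewrite addr_ge0.
by apply: HC; [rewrite (le_lt_trans (ler_norm C)) // ltrDl|exists x].
Qed.

Section Balls.
Variables (R : realType) (N : nat).
Local Notation cball := (closed_ball_ (@Num.norm R 'rV[R]_N)).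

Lemma compact_cball (x : 'rV[R]_N) r : compact (cball x r).
Proof.
apply: bounded_closed_compact; last exact: closed_closed_ball_.
exists (r + `|x|); split=> [|s rs y /= xy]; first exact: num_real.
apply: le_trans (ltW rs); rewrite -[y](subrK x) (le_trans (ler_normD _ _)) //.
by rewrite lerD2r distrC.
Qed.

Lemma sub_cball_ball (x : 'rV[R]_N) r : 0 < r -> cball x r `<=` ball 0 (r + `|x| + 1).
Proof.
move=> r0 y xy; rewrite -ball_normE /= sub0r normrN -[y](subrK x).
rewrite (le_lt_trans (ler_normD _ _)) // (@le_lt_trans _ _ (r + `|x|)) ?ltrDl //.
by rewrite lerD2r distrC.
Qed.

Lemma sub_ball_cball (x : 'rV[R]_N) r : ball x r `<=` cball x r.
Proof. by move=> y; rewrite -ball_normE => /ltW. Qed.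

Lemma open_cball_compl (x : 'rV[R]_N) r : open (~` cball x r).
Proof. exact/closed_openC/closed_closed_ball_. Qed.

End Balls.
Arguments compact_cball {R N}.
Arguments open_cball_compl {R N}.

Section Volume.
Variables (R : realType) (N : nat) (M : smooth_manifold R N).

Lemma chart_closed_ball (c : chart M) x : img c x -> exists r, [/\ 0 < r,
  closed_ball_ Num.norm x r `<=` img c,
  compact (param c @` closed_ball_ Num.norm x r) &
  open (dom c `&` Defs.coord c @^-1` ball x r)].
Proof.
move=> cx; have : nbhs x (img c) by apply: open_nbhs_nbhs; split=> //; exact: img_open.
move=> /nbhs_ballP[e /= e0 ec]; exists (e / 2).
have sc : closed_ball_ Num.norm x (e / 2) `<=` img c.
  move=> y xy; apply: ec; rewrite -ball_normE /=; apply: le_lt_trans xy _.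
  by rewrite ltr_pdivrMr // ltr_pMr // ltr1n.
split; [by rewrite divr_gt0|exact: sc| |].
  apply: continuous_compact (compact_cball _ _).
  apply: continuous_in_subspaceT => y /set_mem /sc; exact: param_continuous.
by apply: open_chart_preimage; exact: ball_open.
Qed.

Variables (G : field M 'M[R]_N) (mu : {measure set (borel M) -> \bar R}).
Hypotheses (hG : is_riemannian_metric G) (hmu : is_riemannian_volume G mu).
Local Notation lam := (lebesgue_rV R N).
Local Open Scope ereal_scope.

Lemma compact_measurable (K : set M) : compact K -> measurable (K : set (borel M)).
Proof. by move=> cK; apply: borel_closed_measurable; exact: compact_manifold_closed. Qed.

Lemma volume_compact (K : set M) : compact K -> mu K < +oo.
Proof.
move=> cK.
(* A measurable superset is asked for because [compact_induction] ranges over arbitrary sets. *)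
pose P (B : set M) := exists A : set (borel M), [/\ measurable A, B `<=` A & mu A < +oo].
have : P K.
  apply: (compact_induction (P := P) cK).
  - by exists set0; split=> //; rewrite measure0 ltry.
  - move=> A B [A' [mA AA' fA]] [B' [mB BB' fB]]; exists (A' `|` B').
    split; [exact: measurableU|by move=> x [/AA'|/BB']; [left|right]|].
    by apply: le_lt_trans (measureU2 _ mA mB) _; exact: lte_add_pinfty.
  - move=> A B AB [A' [mA BA' fA]]; exists A'; split=> //.
    exact: subset_trans BA'.
  move=> p Kp; have cp := dom_chart_at p; set c := chart_at p in cp.
  have [r [r0 sr cr oU]] := chart_closed_ball (img_coord cp).
  pose U := dom c `&` Defs.coord c @^-1` ball (Defs.coord c p) r.
  exists U; split=> //; first by split=> //=; exact: ballxx.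
  have mU : measurable (U : set (borel M)) by exact: borel_open_measurable.
  exists U; split=> //.
  have [C C0 HC] : exists2 C, (0 <= C)%R &
      forall x, closed_ball_ Num.norm (Defs.coord c p) r x -> (`|volume_density G c x| <= C)%R.
    have [C C0 HC] := compact_fun_bounded (f := fun x => Num.sqrt (\det (G c x)))
      (compact_cball (Defs.coord c p) r)
      (fun x xr => Ck_on_continuous (Ck_on_sqrt_det hG c 0) (sr x xr)).
    by exists C => // x xr; rewrite /volume_density patchE mem_set ?HC //; exact: sr.
  rewrite (volume_chart hG hmu (c := c) mU); last by move=> q [].
  have E : Defs.coord c @` U = ball (Defs.coord c p) r.
    apply/seteqP; split=> [_ [q [cq Bq] <-] //|x Bx].
    have cx : img c x by apply: sr; exact: sub_ball_cball.
    by exists (param c x); [split; [exact: img_param|rewrite /= paramK]|rewrite paramK].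
  rewrite E.
  have mB : measurable (ball (Defs.coord c p) r : set (borel 'rV[R]_N)).
    by apply: borel_open_measurable; exact: ball_open.
  have lB : lam (ball (Defs.coord c p) r) < +oo by exact: lebesgue_rV_ball.
  apply: (@le_lt_trans _ _ (\int[lam]_(x in ball (Defs.coord c p) r) C%:E)).
    apply: ge0_le_integral => //.
    - by move=> x _; rewrite lee_fin; exact: volume_density_ge0.
    - by apply: measurable_funTS; apply/measurable_EFinP; exact: measurable_volume_density.
    - move=> x Bx; rewrite lee_fin (le_trans (ler_norm _)) //.
      by apply: HC; exact: sub_ball_cball.
  by rewrite integral_cst //; apply: lte_mul_pinfty.
move=> [A [mA KA fA]]; apply: le_lt_trans fA; apply: le_measure => //; apply: mem_set => //.
exact: compact_measurable.
Qed.

Lemma integrable_compact_support (f : borel M -> R) (K : set M) : compact K ->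
  continuous (f : M -> R) -> (forall p, ~ K p -> f p = 0%R) ->
  mu.-integrable setT (EFin \o f).
Proof.
move=> cK cf f0; have [C C0 HC] := compact_fun_bounded cK (fun p _ => cf p).
apply: (integrable_bounded_support (compact_measurable cK) (volume_compact cK)
  (borel_continuous_real cf) (C := C)) => // p.
by have [/HC //|/f0 ->] := pselect (K p); rewrite normr0.
Qed.

Lemma chart_integral (f : borel M -> R) (c : chart M) : measurable_fun setT f ->
  (forall p, ~ dom c p -> f p = 0%R) ->
  \int[mu]_p (f p)%:E =
  \int[lam]_x (((f \o param c) \_ (img c)) x * volume_density G c x)%:E.
Proof.
move=> mf f0; rewrite integralE [RHS]integralE.
have mF : measurable_fun setT (EFin \o f) by exact/measurable_EFinP.
rewrite (chart_integral_ge0 hG hmu (c := c) (measurable_funepos mF)) //; last first.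
  by move=> p cp; rewrite funeposE /= f0 // maxxx.
rewrite (chart_integral_ge0 hG hmu (c := c) (measurable_funeneg mF)) //; last first.
  by move=> p cp; rewrite funenegE /= f0 // oppr0 maxxx.
have d0 := volume_density_ge0 G c.
congr (_ - _); apply: eq_integral => x _; rewrite patchE.
  rewrite [RHS]funeposE /= patchE; case: ifPn => _; last by rewrite mul0e mul0r maxxx.
  by rewrite /= funeposE /= -!EFin_max -EFinM maxr_pMl // mul0r.
rewrite [RHS]funenegE /= patchE; case: ifPn => _; last by rewrite mul0e mul0r oppr0 maxxx.
by rewrite /= funenegE /= -!EFin_max -EFinM maxr_pMl // mul0r mulNr.
Qed.

End Volume.

(** * The divergence theorem for Killing fields *)

Section ChartBump.
Variables (R : realType) (N : nat) (M : smooth_manifold R N).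
Variables (c : chart M) (a : 'rV[R]_N) (r : R).
Hypotheses (r0 : 0 < r) (sr : closed_ball_ Num.norm a r `<=` img c).
Hypothesis cK : compact (param c @` closed_ball_ Num.norm a r).
Local Notation K := (param c @` closed_ball_ Num.norm a r).

Definition chart_bump (p : M) : R :=
  if p \in dom c then bump a r (Defs.coord c p) else 0.

Lemma chart_bump_ge0 p : 0 <= chart_bump p.
Proof. by rewrite /chart_bump; case: ifP => // _; exact: bump_ge0. Qed.

Lemma chart_bump_param x : img c x -> chart_bump (param c x) = bump a r x.
Proof. by move=> cx; rewrite /chart_bump mem_set ?paramK //; exact: img_param. Qed.

Lemma chart_bump_eq0 p : ~ K p -> chart_bump p = 0.
Proof.
move=> Kp; rewrite /chart_bump; case: ifPn => // /set_mem cp.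
apply: bump_eq0 => // /sub_ball_cball h; apply: Kp.
by exists (Defs.coord c p) => //; rewrite coordK.
Qed.

Lemma chart_bump_gt0 p : (dom c `&` Defs.coord c @^-1` ball a r) p -> 0 < chart_bump p.
Proof. by move=> [cp Bp]; rewrite /chart_bump mem_set //; exact: bump_gt0. Qed.

(** Around a point of [dom c] this is regularity of [bump]. Any other point lies outside the compact
    set [K], which is closed because [M] is Hausdorff, so the function vanishes near it. *)
Lemma Ck_chart_bump : Ck_fun 1 chart_bump.
Proof.
move=> d; apply: Ck_on_local => x dx.
have [cx|cx] := pselect (dom c (param d x)).
  have ox : overlap d c x by apply/overlapP.
  exists (overlap d c); split; [exact: overlap_open|exact: ox|].
  apply: (@Ck_on_eq _ _ _ _ _ (bump a r \o transition d c)); first exact: overlap_open.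
    move=> y /[dup] oy /overlapP[dy cy]; rewrite /= -chart_bump_param ?param_transition //.
    exact: img_transition.
  apply: (@Ck_on1_comp _ _ _ _ setT); [exact: overlap_open|exact: transition_Ck|by []|].
  exact: Ck_on_bump.
have Kx : (~` K) (param d x) by move=> [y yr yx]; apply: cx; rewrite -yx; apply: img_param; exact: sr.
have oK : open (~` K) by apply: closed_openC; exact: compact_manifold_closed.
have [B [oB Bx _ BK]] := near_param dx oK Kx; exists B; split; [exact: oB|exact: Bx|].
apply: (Ck_on_eq oB _ (Ck_on_cst 1 B (0 : R))) => y By.
by rewrite /= chart_bump_eq0 //; exact: BK.
Qed.

Section LocalDivergence.
Variables (G : field M 'M[R]_N) (mu : {measure set (borel M) -> \bar R}).
Hypotheses (hG : is_riemannian_metric G) (hmu : is_riemannian_volume G mu).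
Variable X : field M 'rV[R]_N.
Hypotheses (hX : is_vector_field X) (kX : is_killing G X).
Variable phi : M -> R.
Hypothesis Cphi : Ck_fun 1 phi.
Local Notation lam := (lebesgue_rV R N).

Let h (x : 'rV[R]_N) : R := phi (param c x) * chart_bump (param c x).
(** The components of the field [X], multiplied by [h] and the volume density. They vanish off a
    closed ball inside the chart image, so extension by 0 keeps them C^1 on the whole of
    ['rV[R]_N]. *)
Let w (i : 'I_N) (x : 'rV[R]_N) : R :=
  if x \in img c then h x * X c x 0 i * Num.sqrt (\det (G c x)) else 0.

Let Ch : Ck_on 1 (img c) h.
Proof. by have := Ck_funM Cphi Ck_chart_bump; apply. Qed.

Let h0 x : img c x -> ~ closed_ball_ Num.norm a r x -> h x = 0.
Proof.
move=> cx xr; rewrite /h chart_bump_eq0 ?mulr0 // => -[y yr yx]; apply: xr.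
by rewrite -(paramK cx) -yx paramK //; exact: sr.
Qed.

Let w0 i x : ~ closed_ball_ Num.norm a r x -> w i x = 0.
Proof.
by move=> xr; rewrite /w; case: ifPn => // /set_mem cx; rewrite h0 // !mul0r.
Qed.

Let Cw i : Ck_on 1 setT (w i).
Proof.
apply: Ck_on_local => x _; have [cx|cx] := pselect (img c x).
  have oc := @img_open _ _ M c; exists (img c); split; [exact: oc|exact: cx|].
  have CX := vector_field_entries c hX.
  have C := Ck_onM oc (Ck_onM oc Ch (CX 1%N i)) (Ck_on_sqrt_det hG c 1).
  by apply: (Ck_on_eq oc _ C) => y cy; rewrite /w mem_set.
exists (~` closed_ball_ Num.norm a r); split; [exact: open_cball_compl|by move=> /sr|].
apply: (Ck_on_eq (open_cball_compl a r) _ (Ck_on_cst 1 _ (0 : R))) => y yr.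
by rewrite w0.
Qed.

Let dw0 i x : ~ closed_ball_ Num.norm a r x -> 'D_(delta_mx 0 i) (w i) x = 0.
Proof.
move=> xr; rewrite (derive_open_eq (g := cst 0) _ (open_cball_compl a r) xr) ?derive_cst //.
by move=> y yr; rewrite w0.
Qed.

Local Open Scope ereal_scope.

Let int_dw i : lam.-integrable setT (fun x => ('D_(delta_mx 0%R i) (w i) x)%:E) /\
  \int[lam]_x ('D_(delta_mx 0%R i) (w i) x)%:E = 0.
Proof.
have [dw cw] := Cw i.
have cdw : continuous (fun x => 'D_(delta_mx 0%R i) (w i) x) by move=> x; exact: cw.
have out x : ~ ball (0%R : 'rV[R]_N) (r + `|a| + 1)%R x -> ~ closed_ball_ Num.norm a r x.
  by move=> xb xr; apply: xb; exact: sub_cball_ball xr.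
split; last first.
  apply: (@integral_partial_derivative _ _ i (w i) (r + `|a| + 1)%R) => //.
    by move=> x; apply: diff_derivable; exact: dw.
  by move=> x /out; exact: w0.
have [C HC] := continuous_compact_support_bounded cdw (fun x xb => dw0 i (out x xb)).
have := (@integrable_bounded_support _ (borel 'rV[R]_N) _ lam (fun x => 'D_(delta_mx 0%R i) (w i) x)
  (ball (0%R : 'rV[R]_N) (r + `|a| + 1)%R) C); apply.
- by apply: borel_open_measurable; exact: ball_open.
- by apply: lebesgue_rV_ball; rewrite ltr_wpDl // addr_ge0 // ltW.
- exact: borel_continuous_real.
- exact: HC.
- by move=> x /out; exact: dw0.
Qed.

(** By [killing_divergence] the integrand read in the chart is the sum of the partial derivatives of
    the [w i], each of integral 0. *)
Lemma integral_lie_chart_bump :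
  \int[mu]_p (lieM X (fun q => phi q * chart_bump q)%R p)%:E = 0.
Proof.
have Cpb := Ck_funM Cphi Ck_chart_bump.
have out p : ~ K p -> lieM X (fun q => phi q * chart_bump q)%R p = 0%R.
  move=> Kp; apply: (lieM_eq0 X (A := ~` K)) => //.
    by apply: closed_openC; exact: compact_manifold_closed.
  by move=> q Kq; rewrite chart_bump_eq0 // mulr0.
rewrite (chart_integral hG hmu (c := c)); last 2 first.
- by apply: borel_continuous_real; apply: (Ck_fun_continuous (k := 0)); exact: Ck_lieM.
- move=> p cp; apply: out => -[y yr yp]; apply: cp; rewrite -yp.
  by apply: img_param; exact: sr.
have E x : (((lieM X (fun q => phi q * chart_bump q) \o param c) \_ (img c)) x
    * volume_density G c x)%R = (\sum_i 'D_(delta_mx 0 i) (w i) x)%R.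
  rewrite patchE; case: ifPn => [/set_mem cx|/negP cx]; last first.
    rewrite mul0r big1 // => i _; apply: dw0 => xr.
    by apply: cx; apply: mem_set; exact: sr.
  rewrite /volume_density patchE mem_set //= lieM_param //.
  have [oc CG sG pG] := metric_open_data hG c.
  have dh : differentiable h x by exact: Ck_on_differentiable Ch cx.
  have kill := killing_divergence oc CG (proj1 hX c) sG pG (kX (c := c)) cx dh.
  apply: etrans (esym kill) _; apply: eq_bigr => i _.
  by apply: (derive_open_eq _ oc cx) => y cy; rewrite /w mem_set.
under eq_integral do rewrite E -sumEFin.
rewrite integral_sum //; last by move=> i; have [] := int_dw i.
by rewrite big1 // => i _; have [] := int_dw i.
Qed.

End LocalDivergence.
End ChartBump.

Section KillingIntegral.
Variables (R : realType) (N : nat) (M : smooth_manifold R N).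
Variables (G : field M 'M[R]_N) (mu : {measure set (borel M) -> \bar R}).
Hypotheses (hG : is_riemannian_metric G) (hmu : is_riemannian_volume G mu).
Variable X : field M 'rV[R]_N.
Hypotheses (hX : is_vector_field X) (kX : is_killing G X).
Local Open Scope ereal_scope.

Lemma integrable_lie (K : set M) (phi : M -> R) : compact K -> Ck_fun 1 phi ->
  (forall p, ~ K p -> phi p = 0%R) -> mu.-integrable setT (EFin \o lieM X phi).
Proof.
move=> cK Cphi phi0; apply: (integrable_compact_support hG hmu cK).
  by apply: (Ck_fun_continuous (k := 0)); exact: Ck_lieM.
move=> p Kp; apply: (lieM_eq0 X (A := ~` K)) => //.
by apply: closed_openC; exact: compact_manifold_closed.
Qed.

(** The last clause, the divergence theorem for multiples of [beta], is additive in [beta]; it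
    therefore survives finite unions of chart balls, and quantifying over every [phi] allows a later
    division by [beta]. *)
Let cutoff (B : set M) (beta : M -> R) : Prop :=
  [/\ Ck_fun 1 beta, (forall p, (0 <= beta p)%R), (forall p, B p -> (0 < beta p)%R),
      (exists2 K, compact K & forall p, ~ K p -> beta p = 0%R) &
      forall phi, Ck_fun 1 phi -> \int[mu]_p (lieM X (fun q => phi q * beta q)%R p)%:E = 0].

Let cutoff_exists (K : set M) : compact K -> exists beta, cutoff K beta.
Proof.
move=> cK; apply: (compact_induction (P := fun B => exists beta, cutoff B beta) cK).
- exists (fun=> 0%R); split; [|by []|by []| |].
  + by move=> c; exact: Ck_on_cst.
  + by exists set0 => //; exact: compact0.
  + move=> phi Cphi; rewrite (eq_integral (cst 0)) ?integral0 // => p _.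
    rewrite (lieM_eq0 X (A := setT)) //; first exact: openT.
    by move=> q _; rewrite mulr0.
- move=> A B [b [Cb b0 bA [Kb cKb Kb0] Ib]] [b' [Cb' b0' bB [Kb' cKb' Kb0'] Ib']].
  exists (fun p => b p + b' p)%R; split.
  + exact: Ck_funD.
  + by move=> p; rewrite addr_ge0.
  + by move=> p [/bA h|/bB h]; [rewrite ltr_pwDl|rewrite ltr_wpDl].
  + exists (Kb `|` Kb'); first exact: compactU.
    by move=> p /not_orP[/Kb0 -> /Kb0' ->]; rewrite addr0.
  + move=> phi Cphi; have C1 := Ck_funM Cphi Cb; have C2 := Ck_funM Cphi Cb'.
    have i1 : mu.-integrable setT (EFin \o lieM X (fun q => phi q * b q)%R).
      by apply: (integrable_lie cKb) => // p /Kb0 ->; rewrite mulr0.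
    have i2 : mu.-integrable setT (EFin \o lieM X (fun q => phi q * b' q)%R).
      by apply: (integrable_lie cKb') => // p /Kb0' ->; rewrite mulr0.
    have E p : lieM X (fun q => phi q * (b q + b' q))%R p =
        (lieM X (fun q => phi q * b q) p + lieM X (fun q => phi q * b' q) p)%R.
      rewrite -lieMD //; congr (lieM X _ p); apply/funext => q; exact: mulrDr.
    under eq_integral do rewrite E EFinD.
    by rewrite (integralD measurableT i1 i2) Ib // Ib' // adde0.
- move=> A B AB [b [Cb b0 bB sb Ib]]; exists b; split; [by []|by []|by move=> p /AB; exact: bB|by []|exact: Ib].
- move=> p Kp; have cp := dom_chart_at p; set c := chart_at p in cp.
  have [r [r0 sr cr oU]] := chart_closed_ball (img_coord cp).
  exists (dom c `&` Defs.coord c @^-1` ball (Defs.coord c p) r).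
  split; [exact: oU|by split; [exact: cp|exact: ballxx]|].
  exists (chart_bump c (Defs.coord c p) r); split.
  + exact: Ck_chart_bump.
  + exact: chart_bump_ge0.
  + by move=> q; exact: chart_bump_gt0.
  + exists (param c @` closed_ball_ Num.norm (Defs.coord c p) r); first exact: cr.
    by move=> q; exact: chart_bump_eq0.
  + by move=> phi Cphi; exact: (integral_lie_chart_bump r0 sr cr hG hmu hX kX Cphi).
Qed.

(** With a cutoff [b] positive on [K], the function [phi] is the multiple [phi / b * b], to which
    the last clause of [cutoff] applies. *)
Lemma integral_lie_killing (K : set M) (phi : M -> R) : compact K -> Ck_fun 1 phi ->
  (forall p, ~ K p -> phi p = 0%R) -> \int[mu]_p (lieM X phi p)%:E = 0.
Proof.
move=> cK Cphi phi0; have [b [Cb b0 bK _ Ib]] := cutoff_exists cK.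
have E : (fun q => phi q / b q * b q)%R = phi.
  apply/funext => q; have [Kq|Kq] := pselect (K q); last by rewrite phi0 // !mul0r.
  by rewrite divfK // gt_eqF // bK.
have := Ib (fun q => phi q / b q)%R; rewrite E; apply.
(* The quotient is C^1: where [b] vanishes the point is off [K], and [phi] is 0 nearby; elsewhere
   [b] is nonzero on a neighbourhood. *)
move=> c; apply: Ck_on_local => x cx; have [bx|bx] := eqVneq (b (param c x)) 0%R.
  have Kx : (~` K) (param c x) by move=> /bK; rewrite bx ltxx.
  have oK : open (~` K) by apply: closed_openC; exact: compact_manifold_closed.
  have [B [oB Bx _ BK]] := near_param cx oK Kx; exists B; split; [exact: oB|exact: Bx|].
  apply: (Ck_on_eq oB _ (Ck_on_cst 1 B (0%R : R))) => y By.
  by rewrite /= phi0 ?mul0r //; exact: BK.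
have oA : open [set p | b p != 0%R].
  rewrite (_ : [set p | _] = b @^-1` [set y | y != 0%R]) //.
  apply: open_comp; last exact: open_neq.
  by move=> p _; exact: (Ck_fun_continuous (k := 1) Cb).
have [B [oB Bx Bc BK]] := near_param cx oA bx; exists B; split; [exact: oB|exact: Bx|].
apply: (Ck_onM oB (Ck_on_sub Bc (Cphi c))).
by apply: (Ck_onV oB) => //; exact: Ck_on_sub (Cb c).
Qed.

End KillingIntegral.

(** * Derivatives on a zero set *)

Lemma derive_comp_real (R : realType) (V : normedModType R) (u : V -> R) (q : R -> R)
    (dq : R) (x v : V) : differentiable u x -> is_derive (u x) (1 : R) q dq ->
  'D_v (q \o u) x = dq * 'D_v u x.
Proof.
move=> du [hq Dq]; have dfq : differentiable q (u x) by apply/derivable1_diffP.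
apply: etrans (derive_comp_diff v du dfq) _.
move: ('D_v u x) => s; rewrite deriveE // -[s in LHS]mulr1 -[_ * 1]/(s *: 1).
by rewrite linearZ -deriveE // mulrC Dq.
Qed.

(* As k tends to infinity, [damp k] tends to 0 pointwise and boundedly, whereas its
   derivative [ddamp k] tends boundedly to the indicator function of 0. *)
Section Damping.
Variable R : realType.
Implicit Types k y : R.

Definition rescale k y : R := (1 + k * y ^+ 2)^-1.
Definition damp k y : R := y * rescale k y.
Definition ddamp k y : R := 2 * rescale k y ^+ 2 - rescale k y.

Lemma rescale_den_ge1 k y : 0 <= k -> 1 <= 1 + k * y ^+ 2.
Proof. by move=> k0; rewrite lerDl mulr_ge0 // sqr_ge0. Qed.

Lemma rescale_ge0 k y : 0 <= k -> 0 <= rescale k y.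
Proof. by move=> k0; rewrite invr_ge0 (le_trans ler01) // rescale_den_ge1. Qed.

Lemma rescale_le1 k y : 0 <= k -> rescale k y <= 1.
Proof.
move=> k0; have h := rescale_den_ge1 y k0.
by rewrite /rescale invf_le1 // (lt_le_trans ltr01).
Qed.

Lemma is_derive_damp k y : 0 <= k -> is_derive y (1 : R) (damp k) (ddamp k y).
Proof.
move=> k0; have d0 : 1 + k * y ^+ 2 != 0.
  by rewrite gt_eqF // (lt_le_trans ltr01) // rescale_den_ge1.
have hd : is_derive y (1 : R) (fun y : R => 1 + k * y ^+ 2) (2 * k * y).
  have h1 : is_derive y (1 : R) (fun y : R => y * y) (y * 1 + y * 1).
    exact: is_deriveM (is_derive_id y (1 : R)) (is_derive_id y (1 : R)).
  have h2 : is_derive y (1 : R) (fun y : R => k * (y * y)) (k * (y * 1 + y * 1)).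
    exact: is_deriveZ.
  have h3 := is_deriveD (is_derive_cst (1 : R) y (1 : R)) h2.
  have -> : 2 * k * y = 0 + k * (y * 1 + y * 1) by ring.
  exact: h3.
have hV := is_deriveV (f := fun y : R => 1 + k * y ^+ 2) d0 hd.
have h := is_deriveM (is_derive_id y (1 : R)) hV.
apply: is_derive_eq h _; rewrite /ddamp /rescale.
have aux (e : R) : e = 1 + k * y ^+ 2 -> e != 0 ->
    y * (- (e ^- 2) * (2 * k * y)) + e^-1 * 1 = 2 * e^-1 ^+ 2 - e^-1.
  move=> ee e0; have -> : y * (- (e ^- 2) * (2 * k * y)) = - (2 * (e - 1) * e ^- 2).
    by rewrite ee; ring.
  by field.
exact: aux.
Qed.

Lemma ddamp_continuous k : 0 <= k -> continuous (ddamp k).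
Proof.
move=> k0; have cs : continuous (rescale k).
  move=> y; apply: (@continuousV R R^o (fun y => 1 + k * y ^+ 2) y).
    by rewrite gt_eqF // (lt_le_trans ltr01) // rescale_den_ge1.
  apply: (@continuousD R R^o R^o (cst 1) (fun y => k * y ^+ 2) y); first exact: cvg_cst.
  apply: (@continuousM R R^o (cst k) (fun y => y ^+ 2)); first exact: cvg_cst.
  exact: exprn_continuous.
move=> y; apply: (@continuousB R R^o R^o (fun y => 2 * rescale k y ^+ 2) (rescale k)).
  apply: (@continuousM R R^o (cst 2) (fun y => rescale k y ^+ 2)); first exact: cvg_cst.
  apply: (@continuousM R R^o (rescale k) (rescale k)); exact: cs.
exact: cs.
Qed.

Lemma damp_bound k y : 0 <= k -> `|damp k y| <= `|y|.
Proof.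
move=> k0; rewrite normrM (ger0_norm (rescale_ge0 _ k0)) ler_piMr //.
exact: rescale_le1.
Qed.

Lemma ddamp_bound k y : 0 <= k -> `|ddamp k y| <= 1.
Proof.
move=> k0; rewrite /ddamp; move: (rescale_ge0 y k0) (rescale_le1 y k0).
by move: (rescale k y) => s s0 s1; rewrite ler_norml; apply/andP; split; nra.
Qed.

Lemma rescale_cvg0 y : y != 0 -> rescale n.+1%:R y @[n --> \oo] --> 0.
Proof.
move=> y0; have h : (y ^- 2) * harmonic n @[n --> \oo] --> (y ^- 2) * (0 : R).
  by apply: cvgM; [exact: cvg_cst|exact: cvg_harmonic].
rewrite mulr0 in h.
have y20 : 0 < y ^+ 2 by rewrite lt_neqAle sqr_ge0 eq_sym expf_eq0 /= y0.
apply: (squeeze_cvgr _ (cvg_cst 0) h); near=> n; rewrite rescale_ge0 //=.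
rewrite /harmonic /rescale -invfM lef_pV2 ?posrE ?(mulr_gt0 y20) ?ltr0Sn //.
  by rewrite [leLHS]mulrC lerDr ler01.
exact: lt_le_trans ltr01 (rescale_den_ge1 _ _).
Unshelve. all: by end_near. Qed.

Lemma damp_cvg0 y : damp n.+1%:R y @[n --> \oo] --> 0.
Proof.
have [->|y0] := eqVneq y 0.
  by rewrite /damp; under eq_fun do rewrite mul0r; exact: cvg_cst.
by rewrite -(mulr0 y); apply: cvgM; [exact: cvg_cst|exact: rescale_cvg0].
Qed.

Lemma ddamp_cvg y : ddamp n.+1%:R y @[n --> \oo] --> ((y == 0)%:R : R).
Proof.
have [->|y0] := eqVneq y 0.
  rewrite /ddamp /rescale; under eq_fun do rewrite expr0n /= mulr0 addr0 invr1 expr1n mulr1.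
  rewrite (_ : 2 - 1 = 1 :> R) ?mulr1n; [exact: cvg_cst|ring].
have h := rescale_cvg0 y0.
have -> : (false%:R : R) = 2 * (0 * 0) - 0 by rewrite mulr0 mulr0 subr0.
apply: (cvgB _ h); apply: cvgM; first exact: cvg_cst.
exact: (cvgM h h).
Qed.

End Damping.

Section NullDerivative.
Variables (R : realType) (N : nat) (M : smooth_manifold R N).
Variables (G : field M 'M[R]_N) (mu : {measure set (borel M) -> \bar R}).
Hypotheses (hG : is_riemannian_metric G) (hmu : is_riemannian_volume G mu).
Variable X : field M 'rV[R]_N.
Hypotheses (hX : is_vector_field X) (kX : is_killing G X).
Local Open Scope ereal_scope.

Lemma Ck_damp (u : M -> R) (k : R) : (0 <= k)%R -> Ck_fun 1 u -> Ck_fun 1 (damp k \o u).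
Proof.
move=> k0 Cu c; apply: (@Ck_on1_comp_real _ _ _ (u \o param c) (damp k) (ddamp k)).
- exact: img_open.
- by move=> t; exact: is_derive_damp.
- exact: ddamp_continuous.
- exact: Cu.
Qed.

Lemma lieM_damp (u v : M -> R) (k : R) p : (0 <= k)%R -> Ck_fun 1 u -> Ck_fun 1 v ->
  lieM X (fun q => damp k (u q) * v q)%R p =
  (ddamp k (u p) * lieM X u p * v p + damp k (u p) * lieM X v p)%R.
Proof.
move=> k0 Cu Cv; have cp := img_coord (dom_chart_at p); set c := chart_at p in cp.
set x := Defs.coord c p in cp.
have d1 := Ck_on_differentiable (Cu c) cp; have d2 := Ck_on_differentiable (Cv c) cp.
have d3 := Ck_on_differentiable (Ck_damp k0 Cu c) cp.
have px : param c x = p by apply: coordK; exact: dom_chart_at.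
have h1 : derivable ((damp k \o u) \o param c) x (X c x) by exact: diff_derivable.
have h2 : derivable (v \o param c) x (X c x) by exact: diff_derivable.
have h := deriveM h1 h2.
apply: etrans h _; rewrite /= px.
have -> : 'D_(X c x) ((damp k \o u) \o param c) x = (ddamp k (u p) * lieM X u p)%R.
  have E := derive_comp_real (X c x) d1 (is_derive_damp _ k0).
  by apply: etrans E _; rewrite /= px.
have aux (a b s t : R) : (a * s + t * b = b * t + a * s)%R by rewrite addrC mulrC.
exact: aux.
Qed.

(** The derivative along [X] of [damp k] of [u] times [lieM X u] has integral 0. As [k] grows,
    dominated convergence leaves the integral of the square of [lieM X u] over the zero set of [u],
    which must then vanish. *)
Lemma null_lie_ae (K : set M) (u : M -> R) : compact K -> (forall p, ~ K p -> u p = 0%R) ->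
  Ck_fun 2 u -> \forall p \ae mu, u p = 0%R -> lieM X u p = 0%R.
Proof.
move=> cK u0 Cu2; have Cu : Ck_fun 1 u by move=> c; exact: Ck_on_le (Cu2 c).
have Cl : Ck_fun 1 (lieM X u) by exact: Ck_lieM.
have cu := Ck_fun_continuous Cu; have cl := Ck_fun_continuous Cl.
have cll : continuous (lieM X (lieM X u)).
  by apply: (Ck_fun_continuous (k := 0)); exact: Ck_lieM.
have oK : open (~` K) by apply: closed_openC; exact: compact_manifold_closed.
have l0 p : ~ K p -> lieM X u p = 0%R.
  by move=> Kp; apply: (lieM_eq0 X (A := ~` K)).
pose f_ n (p : borel M) : R := lieM X (fun q => damp n.+1%:R (u q) * lieM X u q)%R p.
pose f (p : borel M) : R := ((u p == 0)%:R * lieM X u p * lieM X u p)%R.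
(* The majorant uses that [ddamp] is bounded by 1 and [damp k y] by [y] in absolute value, uniformly
   in [k]. *)
pose g (p : borel M) : R :=
  (lieM X u p * lieM X u p + `|u p| * `|lieM X (lieM X u) p|)%R.
have fE n p : f_ n p = (ddamp n.+1%:R (u p) * lieM X u p * lieM X u p
    + damp n.+1%:R (u p) * lieM X (lieM X u) p)%R by exact: lieM_damp.
have If n : \int[mu]_p (f_ n p)%:E = 0.
  apply: (integral_lie_killing hG hmu hX kX cK).
    by apply: Ck_funM; [exact: Ck_damp|exact: Cl].
  by move=> p Kp; rewrite l0 // mulr0.
have mf_ n : measurable_fun setT (EFin \o f_ n).
  apply/measurable_EFinP; apply: borel_continuous_real.
  apply: (Ck_fun_continuous (k := 0)); apply: (Ck_lieM hX).
  by apply: Ck_funM; [exact: Ck_damp|exact: Cl].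
have mz : measurable ([set p | u p = 0%R] : set (borel M)).
  apply: borel_closed_measurable.
  rewrite (_ : [set p | _] = u @^-1` [set 0%R]) //.
  by apply: closed_comp; [move=> p _; exact: cu|exact: closed_eq].
have ml : measurable_fun setT (lieM X u : borel M -> R) by exact: borel_continuous_real.
have mf : measurable_fun setT (EFin \o f).
  apply/measurable_EFinP; apply: measurable_funM => //; apply: measurable_funM => //.
  have -> : (fun p : borel M => (u p == 0%R)%:R : R) = \1_([set p | u p = 0%R] : set (borel M)).
    apply/funext => p; rewrite indicE; case: eqP => up; first by rewrite mem_set.
    by rewrite memNset.
  exact: measurable_indic.
have gi : mu.-integrable setT (EFin \o g).
  apply: (integrable_compact_support hG hmu cK).
    move=> p; apply: (@continuousD R R^o _ (fun p => lieM X u p * lieM X u p)%R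
      (fun p => `|u p| * `|lieM X (lieM X u) p|)%R).
      by apply: (@continuousM R _ (lieM X u) (lieM X u)); exact: cl.
    apply: (@continuousM R _ (fun p => `|u p|)%R (fun p => `|lieM X (lieM X u) p|)%R).
      by apply: (continuous_comp (cu p)); exact: norm_continuous.
    by apply: (continuous_comp (cll p)); exact: norm_continuous.
  by move=> p Kp; rewrite /g l0 // u0 // normr0 !mul0r addr0.
have [_ _ lim] : [/\ mu.-integrable setT (EFin \o f),
    (\int[mu]_p `|(EFin \o f_ n) p - (EFin \o f) p|) @[n --> \oo] --> 0 &
    (\int[mu]_p (EFin \o f_ n) p) @[n --> \oo] --> \int[mu]_p (EFin \o f) p].
  apply: (dominated_convergence measurableT mf_ mf _ gi).
    apply: nearW => p _; apply: cvg_EFin; first by apply: nearW.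
    rewrite /f -[X in _ --> X]addr0; under eq_fun do rewrite /= fE.
    apply: cvgD.
      apply: cvgM; last exact: cvg_cst.
      by apply: cvgM; [exact: ddamp_cvg|exact: cvg_cst].
    rewrite -(mul0r (lieM X (lieM X u) p)).
    by apply: cvgM; [exact: damp_cvg0|exact: cvg_cst].
  apply: nearW => p n _; rewrite /= lee_fin fE /g.
  apply: le_trans (ler_normD _ _) _; apply: lerD.
    rewrite -mulrA normrM [leRHS](_ : _ = 1 * `|lieM X u p * lieM X u p|)%R.
      by apply: ler_wpM2r => //; exact: ddamp_bound.
    by rewrite mul1r ger0_norm // -expr2 sqr_ge0.
  by rewrite normrM; apply: ler_wpM2r => //; exact: damp_bound.
have {}lim : \int[mu]_p (EFin \o f) p = 0.
  apply/esym; apply: cvg_unique lim => //.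
  rewrite (_ : (fun n => \int[mu]_p (EFin \o f_ n) p) = fun=> 0); first exact: cvg_cst.
  by apply/funext => n; exact: If.
have f0 p : (0 <= f p)%R.
  by rewrite /f -mulrA mulr_ge0 ?ler0n // -expr2 sqr_ge0.
have : ae_eq mu setT (EFin \o f) (cst 0).
  apply/(ae_eq_integral_abs mu measurableT mf); rewrite -[RHS]lim.
  by apply: eq_integral => p _; rewrite gee0_abs // lee_fin.
apply: filterS => p h up; have := EFin_inj (h I).
rewrite /f up eqxx mul1r; by move/eqP; rewrite mulf_eq0 orbb => /eqP.
Qed.

(** The integral over all of [M] is 0. Off [Om] the function [u] is 0, so its first derivative is 0
    almost everywhere there, and a second use of [null_lie_ae] does the same for the second
    derivative. *)
Lemma integral_lie_lie (K Om : set M) (u : M -> R) : compact K ->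
  (forall p, ~ K p -> u p = 0%R) -> Ck_fun 3 u -> open Om ->
  (forall p, ~ Om p -> u p = 0%R) ->
  \int[mu]_(p in Om) (lieM X (lieM X u) p)%:E = 0.
Proof.
move=> cK u0 Cu oOm uOm.
have oK : open (~` K) by apply: closed_openC; exact: compact_manifold_closed.
have C1 : Ck_fun 1 u by move=> c; exact: Ck_on_le _ (Cu c).
have C2 : Ck_fun 2 u by move=> c; exact: Ck_on_le _ (Cu c).
have Cl : Ck_fun 2 (lieM X u) by exact: Ck_lieM.
have Cl1 : Ck_fun 1 (lieM X u) by move=> c; exact: Ck_on_le _ (Cl c).
have l0 p : ~ K p -> lieM X u p = 0%R.
  by move=> Kp; apply: (lieM_eq0 X (A := ~` K)).
have I0 := integral_lie_killing hG hmu hX kX cK Cl1 l0.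
have mOm : measurable (Om : set (borel M)) by exact: borel_open_measurable.
have mll : measurable_fun setT (EFin \o (lieM X (lieM X u) : borel M -> R)).
  apply/measurable_EFinP; apply: borel_continuous_real.
  by apply: (Ck_fun_continuous (k := 0)); exact: Ck_lieM.
rewrite integral_mkcond -[RHS]I0; apply: ae_eq_integral => //.
  by apply: (measurable_restrictT _ mOm).1; exact: measurable_funTS.
have h1 := null_lie_ae cK u0 C2; have h2 := null_lie_ae cK l0 Cl.
apply: (@filterS2 _ _ (ae_filter_ringOfSetsType mu) _ _ _ _ h1 h2) => p {}h1 {}h2 _; rewrite patchE; case: ifPn => // /negP Omp.
by rewrite h2 // h1 // uOm // => /mem_set.
Qed.

End NullDerivative.

(** * Estimates in the parameter of the variation *)

Section JointEstimates.
Variables (R : realType) (N : nat) (U : set 'rV[R]_N) (eps : R).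
Hypotheses (oU : open U) (eps0 : 0 < eps).
Local Notation V := (R^o * 'rV[R]_N)%type.
Implicit Types (H : V -> R) (k : nat).

Definition cylinder : set V := [set z | `|z.1| < eps /\ U z.2].

Lemma cylinder_open : open cylinder.
Proof.
have oB : open [set t : R^o | `|t| < eps].
  rewrite (_ : [set t | _] = ball (0 : R^o) eps); first exact: ball_open.
  by apply/seteqP; split=> t; rewrite /ball /= sub0r normrN.
have -> : cylinder = (fst : V -> R^o) @^-1` [set t | `|t| < eps] `&`
    (snd : V -> 'rV[R]_N) @^-1` U by [].
apply: openI; apply: open_comp; [|exact: oB| |exact: oU] => z _.
  exact: cvg_fst.
exact: cvg_snd.
Qed.

Lemma Ck_on_snd k (f : 'rV[R]_N -> R) :
  Ck_on k U f -> Ck_on k cylinder (fun z => f z.2).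
Proof.
move=> Cf; apply: (@Ck_on_sub _ _ _ _ _ ((snd : V -> 'rV[R]_N) @^-1` U)); first by move=> z [].
apply: (@Ck_on_comp_affine _ _ _ _ (snd : V -> 'rV[R]_N) snd _ U f) => //.
- by apply: open_comp => // z _; exact: cvg_snd.
- by move=> z; apply: linear_differentiable => y; exact: cvg_snd.
- move=> z v; have cs : continuous (snd : V -> 'rV[R]_N) by move=> y; exact: cvg_snd.
  rewrite deriveE; last exact: linear_differentiable.
  by rewrite (diff_lin z cs).
Qed.

Lemma derive_slice H (t : R) x (v : 'rV[R]_N) :
  'D_v (fun y => H (t, y)) x = 'D_((0 : R^o, v) : V) H (t, x).
Proof.
have [] // := @derive_reparam R V 'rV[R]_N R (fun y => (t, y) : V) H x v ((0 : R^o, v) : V).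
by move=> h; congr (_, _); rewrite /= scaler0 add0r.
Qed.

(** A derivative in the space variable alone is a joint derivative along directions [(0, v)], so
    joint regularity in time and space is inherited. *)
Lemma Ck_on_lie_slice k H (X : 'rV[R]_N -> 'rV[R]_N) :
  Ck_on k.+1 cylinder H -> (forall j, Ck_on k U (fun x => X x 0 j)) ->
  Ck_on k cylinder (fun z => lie_fun X (fun y => H (z.1, y)) z.2).
Proof.
move=> CH CX; have oD := cylinder_open.
have C : Ck_on k cylinder (fun z => \sum_j X z.2 0 j * 'D_((0 : R^o, delta_mx 0 j) : V) H z).
  apply: (@Ck_on_sum R V k cylinder _ _ _
    (fun j z => X z.2 0 j * 'D_((0 : R^o, delta_mx 0 j) : V) H z) oD) => j _.
  apply: (@Ck_onM R V k cylinder (fun z => X z.2 0 j)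
    (fun z => 'D_((0 : R^o, delta_mx 0 j) : V) H z) oD).
    exact: (@Ck_on_snd k (fun x => X x 0 j) (CX j)).
  exact: (Ck_on_derive _ CH).
apply: (Ck_on_eq oD _ C) => -[t x] Dz; have dH := Ck_on_differentiable CH Dz.
rewrite /lie_fun /= derive_slice -(derive_sum_dir _ _ _ _ dH).
congr ('D__ H _); rewrite [in RHS](row_sum_delta (X x)).
elim/big_rec2: _ => [//|j v w _ ->].
by congr (_, _); rewrite /= scaler0 addr0.
Qed.

(** The neighbourhood is taken in time and space together, so the constant is uniform for space
    points near [x]; this is what compactness can globalise. *)
Definition bigO k (x : 'rV[R]_N) H := exists2 C, 0 <= C &
  \forall z \near ((0 : R^o, x) : V), `|H z| <= C * `|z.1| ^+ k.

Lemma bigOD k x H H' : bigO k x H -> bigO k x H' -> bigO k x (fun z => H z + H' z).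
Proof.
move=> [C C0 h] [C' C0' h']; exists (C + C'); first exact: addr_ge0.
apply: filterS2 h h' => z h h'; rewrite mulrDl.
by apply: le_trans (ler_normD _ _) _; exact: lerD.
Qed.

Lemma bigOM k l x H H' : bigO k x H -> bigO l x H' -> bigO (k + l) x (fun z => H z * H' z).
Proof.
move=> [C C0 h] [C' C0' h']; exists (C * C'); first exact: mulr_ge0.
by apply: filterS2 h h' => z h h'; rewrite normrM exprD mulrACA ler_pM.
Qed.

Lemma bigO_cst x (a : R) : bigO 0 x (fun=> a).
Proof. by exists `|a| => //; near=> z; rewrite expr0 mulr1. Unshelve. all: by end_near. Qed.

Lemma bigOZ k x (a : R) H : bigO k x H -> bigO k x (fun z => a * H z).
Proof. by move=> h; have := bigOM (bigO_cst x a) h. Qed.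

Lemma bigO0 k x : bigO k x (fun=> 0).
Proof.
by exists 0 => //; near=> z; rewrite normr0 mul0r. Unshelve. all: by end_near. Qed.

Lemma bigO_sum k x (I : Type) (r : seq I) (P : pred I) (F : I -> V -> R) :
  (forall i, P i -> bigO k x (F i)) -> bigO k x (fun z => \sum_(i <- r | P i) F i z).
Proof.
move=> h; elim: r => [|i r IH].
  by rewrite (_ : (fun z => _) = fun=> 0); [exact: bigO0|apply/funext => z; rewrite big_nil].
case Pi : (P i); last first.
  by rewrite (_ : (fun z => _) = fun z => \sum_(i <- r | P i) F i z) //;
    apply/funext => z; rewrite big_cons Pi.
rewrite (_ : (fun z => _) = fun z => F i z + \sum_(i <- r | P i) F i z).
  by apply: bigOD => //; exact: h.
by apply/funext => z; rewrite big_cons Pi.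
Qed.

Lemma near_cylinder x : U x -> \forall z \near ((0 : R^o, x) : V), cylinder z.
Proof.
move=> Ux; apply: open_nbhs_nbhs; split; first exact: cylinder_open.
by split; rewrite /= ?normr0.
Qed.

Lemma bigO_eq k x H H' : U x -> (forall z, cylinder z -> H z = H' z) ->
  bigO k x H -> bigO k x H'.
Proof.
move=> Ux E [C C0 h]; exists C => //.
by apply: filterS2 h (near_cylinder Ux) => z h Dz; rewrite -E.
Qed.

Lemma bigO_continuous x H : U x -> Ck_on 0 cylinder H -> bigO 0 x H.
Proof.
move=> Ux CH; have cH := Ck_on_continuous CH (nbhs_singleton (near_cylinder Ux)).
exists (`|H (0, x)| + 1); first by rewrite addr_ge0.
have h : \forall z \near ((0 : R^o, x) : V), `|H (0, x) - H z| <= 1.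
  by move/cvgrPdist_le : cH; apply.
apply: filterS h => z h; rewrite expr0 mulr1 -[H z](subrK (H (0, x))) addrC.
apply: le_trans (ler_normD _ _) _; rewrite lerD2l distrC //.
Qed.

(** The mean value theorem in the time direction, with a local bound on the time derivative. *)
Lemma bigO_vanishing x H : U x -> Ck_on 1 cylinder H ->
  (forall y, U y -> H (0, y) = 0) -> bigO 1 x H.
Proof.
move=> Ux CH H0.
have [C1 C10 h1] := bigO_continuous Ux (Ck_on_derive ((1 : R^o, 0) : V) CH).
(* [mean_value_line] moves forward only, so negative times are reached along the direction
   [(-1, 0)]; in [step] below, [s] is the sign of [t]. *)
have [C2 C20 h2] := bigO_continuous Ux (Ck_on_derive ((-1 : R^o, 0) : V) CH).
exists (C1 + C2); first exact: addr_ge0.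
have h3 : nbhs ((0 : R^o, x) : V) [set z | cylinder z /\
    (`|'D_((1 : R^o, 0) : V) H z| <= C1 /\ `|'D_((-1 : R^o, 0) : V) H z| <= C2)].
  apply: filterS2 (near_cylinder Ux) (filterI h1 h2) => z Dz [].
  by rewrite expr0 !mulr1.
move: h3; rewrite -nbhs_ballE => -[e /= e0 eP].
suff : nbhs ((0 : R^o, x) : V) [set z | `|H z| <= (C1 + C2) * `|z.1| ^+ 1] by [].
rewrite -nbhs_ballE; exists e => // -[t y] [te ye]; rewrite /= expr1.
have step (s : R^o) : (s == 1) || (s == -1) -> t = `|t| * s ->
    exists2 c : R, 0 <= c <= `|t| & H (t, y) = 'D_((s, 0) : V) H (c * s : R^o, y) * `|t|
      /\ ball (0 : R) e (c * s).
  move=> s1 ts.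
  have bs (c : R) : 0 <= c <= `|t| -> ball (0 : R) e (c * s).
    move=> /andP[c0 ct]; rewrite -ball_normE /= sub0r normrN normrM (ger0_norm c0).
    have -> : `|s| = 1 by case/orP: s1 => /eqP ->; rewrite ?normrN normr1.
    rewrite mulr1; apply: le_lt_trans ct _.
    by move: te; rewrite -ball_normE /= sub0r normrN.
  have Eq (c : R) : ((0 : R^o, y) : V) + c *: ((s, 0) : V) = (c * s : R^o, y).
    by congr (_, _); rewrite /= ?add0r ?scaler0 ?addr0.
  have [|c ct] := @mean_value_line R V H ((0 : R^o, y) : V) ((s, 0) : V) `|t| (normr_ge0 _).
    move=> c ct; rewrite Eq; apply: (Ck_on_differentiable CH).
    by have [] := eP (c * s, y) (conj (bs c ct) ye).
  rewrite !Eq -ts H0 ?subr0; last by have [[]] := eP (t, y) (conj te ye).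
  by move=> E; exists c => //; split=> //; exact: bs.
have [t0|t0] := leP 0 t.
  have t1 : t = `|t| * 1 by rewrite mulr1 ger0_norm.
  have s1 : ((1 : R) == 1) || ((1 : R) == -1) by rewrite eqxx.
  have [c ct [-> Bc]] := step 1 s1 t1.
  have [_ [b1 _]] := eP (c * 1 : R^o, y) (conj Bc ye).
  rewrite normrM normr_id; apply: ler_wpM2r => //.
  by apply: le_trans b1 _; rewrite lerDl.
have t1 : t = `|t| * -1 by rewrite mulrN1 ltr0_norm // opprK.
have s1 : ((-1 : R) == 1) || ((-1 : R) == -1) by rewrite eqxx orbT.
have [c ct [-> Bc]] := step (-1) s1 t1.
have [_ [_ b2]] := eP (c * -1 : R^o, y) (conj Bc ye).
rewrite normrM normr_id; apply: ler_wpM2r => //.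
by apply: le_trans b2 _; rewrite lerDr.
Qed.

End JointEstimates.

(** * Curvature and volume of a family of metrics in a chart *)

Section MetricFamily.
Variables (R : realType) (N s m : nat) (U : set 'rV[R]_N) (eps : R).
Variable Gt : R -> 'rV[R]_N -> 'M[R]_N.
Variable X : 'I_s -> 'rV[R]_N -> 'rV[R]_N.
Hypotheses (oU : open U) (eps0 : 0 < eps).
Local Notation V := (R^o * 'rV[R]_N)%type.
Local Notation D := (@cylinder R N U eps).
Hypothesis CJ : smooth_on D (fun z : V => Gt z.1 z.2).
Hypothesis CG : forall t, `|t| < eps -> smooth_on U (Gt t).
Hypothesis sG : forall t, `|t| < eps -> forall x, U x -> (Gt t x)^T = Gt t x.
Hypothesis pG : forall t, `|t| < eps -> forall x, U x ->
  forall v, v != 0 -> 0 < pairing (Gt t x) v v.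
Hypothesis CX : forall p, smooth_entries U (X p).
Hypothesis XX : forall p q y, U y -> 'D_(X p y) (X q) y = 'D_(X q y) (X p) y.
Hypothesis freeX : forall y, U y -> row_free (\matrix_p X p y).
Hypothesis gram0 : forall p q y, U y -> gram (Gt 0) X p q y = (p == q)%:R.
Hypothesis killing0 : forall p y, U y -> forall u v, lie_metric (X p) (Gt 0) y u v = 0.

Local Notation e_ := (@delta_mx R 1 N 0).
Let oD : open D. Proof. exact: cylinder_open. Qed.
Let eps00 : `|0 : R| < eps. Proof. by rewrite normr0. Qed.

Let CJe k i j : Ck_on k D (fun z : V => Gt z.1 z.2 i j).
Proof. exact: (@Ck_on_entry _ _ k D _ _ (fun z : V => Gt z.1 z.2) i j oD (CJ k)). Qed.

Let CXe k p j : Ck_on k D (fun z : V => X p z.2 0 j).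
Proof. exact: (@Ck_on_snd _ _ U eps oU k (fun x => X p x 0 j) (CX p k j)). Qed.

Lemma Ck_on_gram_family k p q : Ck_on k D (fun z : V => gram (Gt z.1) X p q z.2).
Proof.
exact: (@Ck_on_pairing _ _ _ k D (fun z : V => Gt z.1 z.2) (fun z => X p z.2)
  (fun z => X q z.2) oD (CJe k) (CXe k p) (CXe k q)).
Qed.

Lemma Ck_on_second_lie_family k p q i j :
  Ck_on k D (fun z : V => second_lie (Gt z.1) X p q i j z.2).
Proof.
have C1 := Ck_on_lie_slice oU (Ck_on_gram_family k.+2 i j) (CX q k.+1).
exact: (Ck_on_lie_slice oU C1 (CX p k)).
Qed.

Lemma derive_gram0 p q y v : U y -> 'D_v (gram (Gt 0) X p q) y = 0.
Proof.
move=> Uy; rewrite (derive_open_eq (g := cst ((p == q)%:R : R)) _ oU Uy) ?derive_cst //.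
by move=> z Uz; rewrite gram0.
Qed.

Lemma second_lie0 p q i j y : U y -> second_lie (Gt 0) X p q i j y = 0.
Proof.
move=> Uy; rewrite /second_lie {1}/lie_fun.
rewrite (derive_open_eq (g := cst 0) _ oU Uy) ?derive_cst // => z Uz.
exact: derive_gram0.
Qed.

Lemma bigO_second_lie x p q i j : U x ->
  bigO 1 x (fun z : V => second_lie (Gt z.1) X p q i j z.2).
Proof.
move=> Ux; apply: (bigO_vanishing oU eps0 Ux (Ck_on_second_lie_family 1 p q i j)) => y Uy.
exact: second_lie0.
Qed.

Let CDX k p q j : Ck_on k U (fun y => ('D_(X q y) (X p) y) 0 j).
Proof.
apply: (Ck_on_eq oU _ (Ck_on_derive_field oU (CX p k.+1 j) (CX q k))) => y Uy.
have d : derivable (X p) y (X q y) by exact: smooth_entries_derivable (CX p) Uy.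
by have [_ ->] := is_derive_entry 0 j d.
Qed.

Let CDeX k p l j : Ck_on k U (fun y => ('D_(e_ l) (X p) y) 0 j).
Proof.
apply: (Ck_on_eq oU _ (Ck_on_derive (e_ l) (CX p k.+1 j))) => y Uy.
have d : derivable (X p) y (e_ l) by exact: smooth_entries_derivable (CX p) Uy.
by have [_ ->] := is_derive_entry 0 j d.
Qed.

Let Cdelta k l j : Ck_on k D (fun _ : V => e_ l 0 j).
Proof. exact: Ck_on_cst. Qed.

Lemma Ck_on_lie_metric_family k p q l :
  Ck_on k D (fun z : V => lie_metric (X p) (Gt z.1) z.2 (X q z.2) (e_ l)).
Proof.
have CDG i j : Ck_on k D (fun z : V => ('D_(X p z.2) (Gt z.1) z.2) i j).
  have C := Ck_on_lie_slice oU (CJe k.+1 i j) (CX p k).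
  apply: (Ck_on_eq oD _ C) => -[t y] [te Uy]; rewrite /lie_fun /=; apply/esym.
  by apply: derive_entry; exact: Ck_on_differentiable (CG te 1%N) Uy.
have C2 j := @Ck_on_snd _ _ U eps oU k (fun y => ('D_(X q y) (X p) y) 0 j) (CDX k p q j).
have C3 j := @Ck_on_snd _ _ U eps oU k (fun y => ('D_(e_ l) (X p) y) 0 j) (CDeX k p l j).
have h1 := @Ck_on_pairing _ _ _ k D (fun z : V => 'D_(X p z.2) (Gt z.1) z.2)
  (fun z => X q z.2) (fun=> e_ l) oD CDG (CXe k q) (Cdelta k l).
have h2 := @Ck_on_pairing _ _ _ k D (fun z : V => Gt z.1 z.2)
  (fun z => 'D_(X q z.2) (X p) z.2) (fun=> e_ l) oD (CJe k) C2 (Cdelta k l).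
have h3 := @Ck_on_pairing _ _ _ k D (fun z : V => Gt z.1 z.2)
  (fun z => X q z.2) (fun z => 'D_(e_ l) (X p) z.2) oD (CJe k) (CXe k q) C3.
exact: (Ck_onD oD (Ck_onD oD h1 h2) h3).
Qed.

(** Lowering the index makes Koszul's formula directly applicable; the inverse metric comes back
    only as a bounded factor. *)
Definition covector p q l (z : V) : R :=
  pairing (Gt z.1 z.2) (covariant (Gt z.1) (X p) (X q) z.2) (e_ l).

Let covectorE p q l (z : V) : D z -> covector p q l z =
  2^-1 * (lie_metric (X p) (Gt z.1) z.2 (X q z.2) (e_ l)
          + lie_metric (X q) (Gt z.1) z.2 (X p z.2) (e_ l)
          - 'D_(e_ l) (gram (Gt z.1) X p q) z.2).
Proof.
move=> [te Uz]; exact: (pairing_covariant (e_ l) oU (CG te) (sG te) (pG te)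
  (CX p) (CX q) Uz (XX p q Uz)).
Qed.

(** At time 0 the three terms of Koszul's formula vanish: two by the Killing equation, one because
    the Gram matrix is constant. *)
Lemma bigO_covector x p q l : U x -> bigO 1 x (covector p q l).
Proof.
move=> Ux; have C0 := Ck_on_lie_slice oU (Ck_on_gram_family 2 p q)
  (fun j => Ck_on_cst 1 U (e_ l 0 j)).
have C := Ck_onM oD (Ck_on_cst 1 D (2^-1 : R)) (Ck_onB oD
  (Ck_onD oD (Ck_on_lie_metric_family 1 p q l) (Ck_on_lie_metric_family 1 q p l)) C0).
have h : bigO 1 x (fun z : V => 2^-1 * (lie_metric (X p) (Gt z.1) z.2 (X q z.2) (e_ l)
          + lie_metric (X q) (Gt z.1) z.2 (X p z.2) (e_ l)
          - lie_fun (fun=> e_ l) (fun y => gram (Gt z.1) X p q y) z.2)).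
  apply: (bigO_vanishing oU eps0 Ux C) => y Uy /=.
  by rewrite !killing0 // /lie_fun (derive_gram0 p q (e_ l) Uy) addr0 subr0 mulr0.
apply: (bigO_eq oU eps0 Ux _ h) => z Dz; exact: (esym (covectorE p q l Dz)).
Qed.

Let uG (z : V) : D z -> Gt z.1 z.2 \in unitmx.
Proof. by move=> [te Uz]; apply: posdef_unitmx; exact: pG. Qed.

Let pairing_covectors (G : 'M[R]_N) (u v : 'rV[R]_N) : G \in unitmx ->
  pairing G u v = \sum_k \sum_l pairing G u (e_ k) * pairing G v (e_ l) * invmx G l k.
Proof.
move=> GU; have E w k : pairing G w (e_ k) = (w *m G) 0 k.
  by rewrite /pairing trmx_delta -colE mxE.
rewrite [LHS]pairing_def mxE; apply: eq_bigr => k _; rewrite [v^T k 0]mxE.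
rewrite -[v in LHS](mulmxK GU) [X in _ * X]mxE big_distrr /=; apply: eq_bigr => l _.
by rewrite !E mulrA.
Qed.

Lemma bigO_pairing_covariant x p q i j : U x ->
  bigO 2 x (fun z : V => pairing (Gt z.1 z.2) (covariant (Gt z.1) (X p) (X q) z.2)
                                (covariant (Gt z.1) (X i) (X j) z.2)).
Proof.
move=> Ux; have h : bigO 2 x (fun z : V => \sum_k \sum_l
    covector p q k z * covector i j l z * invmx (Gt z.1 z.2) l k).
  apply: bigO_sum => k _; apply: bigO_sum => l _.
  have h1 := bigOM (bigO_covector p q k Ux) (bigO_covector i j l Ux).
  apply: (bigOM (k := 2) (l := 0) h1).
  exact: (bigO_continuous oU eps0 Ux (Ck_on_invmx oD uG (CJe 0) l k)).
apply: (bigO_eq oU eps0 Ux _ h) => z Dz.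
exact/esym/(pairing_covectors _ _ (uG Dz)).
Qed.

Definition linear_coef p q i j (z : V) : R :=
  - (2^-1 * second_lie (Gt z.1) X p q i j z.2) - 2^-1 * second_lie (Gt z.1) X i j p q z.2.

Lemma bigO_linear_coef x p q i j : U x -> bigO 1 x (linear_coef p q i j).
Proof.
move=> Ux; have h1 := bigOZ (- 2^-1) (bigO_second_lie p q i j Ux).
have h2 := bigOZ (- 2^-1) (bigO_second_lie i j p q Ux).
apply: (bigO_eq oU eps0 Ux _ (bigOD h1 h2)) => z _.
have aux (a b : R) : - 2^-1 * a + - 2^-1 * b = - (2^-1 * a) - 2^-1 * b by rewrite !mulNr.
exact: aux.
Qed.

Lemma bigO_curvature_coef x p q i j : U x ->
  bigO 2 x (fun z : V => curvature_coef (Gt z.1) X p q i j z.2 - linear_coef p q i j z).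
Proof.
move=> Ux; have h1 := bigO_pairing_covariant p i q j Ux.
have h2 := bigOZ (-1) (bigO_pairing_covariant p q i j Ux).
apply: (bigO_eq oU eps0 Ux _ (bigOD h1 h2)) => z _.
rewrite /curvature_coef /linear_coef.
have aux (a b c d : R) : c + -1 * d = a - b + c - d - (a - b) by ring.
exact: aux.
Qed.

Lemma gram_mx_unit t y : `|t| < eps -> U y -> gram_mx (Gt t) X y \in unitmx.
Proof.
move=> te Uy; apply: posdef_unitmx => v v0.
rewrite gram_mxE /pairing.
have -> : v *m (\matrix_p X p y *m Gt t y *m (\matrix_p X p y)^T) *m v^T =
    (v *m \matrix_p X p y) *m Gt t y *m (v *m \matrix_p X p y)^T.
  by rewrite trmx_mul !mulmxA.
by apply: pG => //; rewrite mulmx_free_eq0 //; exact: freeX.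
Qed.

Let inv_gram p q (z : V) : R := invmx (gram_mx (Gt z.1) X z.2) p q.

Let Cinv k p q : Ck_on k D (inv_gram p q).
Proof.
apply: (Ck_on_invmx oD) => [z [te Uz]|i j]; first exact: gram_mx_unit.
by apply: (Ck_on_eq oD _ (Ck_on_gram_family k i j)) => z _; rewrite mxE.
Qed.

Lemma bigO_inv_gram x p q : U x -> bigO 1 x (fun z => inv_gram p q z - (p == q)%:R).
Proof.
move=> Ux; have C := Ck_onB oD (Cinv 1 p q) (Ck_on_cst 1 D ((p == q)%:R : R)).
apply: (bigO_vanishing oU eps0 Ux C) => y Uy.
rewrite /inv_gram /= (_ : gram_mx _ _ _ = 1%:M) ?invmx1 ?mxE ?subrr //.
by apply/matrixP => i j; rewrite !mxE gram0.
Qed.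

Definition family_curvature (z : V) : R :=
  \sum_(p < s | (p < m)%N) \sum_(q < s | (q < m)%N)
    \sum_(i < s | (m <= i)%N) \sum_(j < s | (m <= j)%N)
      invmx (gram_mx (Gt z.1) X z.2) p q * invmx (gram_mx (Gt z.1) X z.2) i j
      * curvature_coef (Gt z.1) X p q i j z.2.

(** The [L_t] of the overview: the inverse Gram matrix is replaced by the identity and the products
    of covariant derivatives are dropped. *)
Definition linear_curvature (z : V) : R :=
  \sum_(p < s | (p < m)%N) \sum_(q < s | (q < m)%N)
    \sum_(i < s | (m <= i)%N) \sum_(j < s | (m <= j)%N)
      (p == q)%:R * (i == j)%:R * linear_coef p q i j z.

Lemma bigO_linear_curvature x : U x -> bigO 1 x linear_curvature.
Proof.
move=> Ux; do 4! (apply: bigO_sum => ? _); apply: bigOZ; exact: bigO_linear_coef.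
Qed.

Lemma bigO_family_curvature x : U x ->
  bigO 2 x (fun z => family_curvature z - linear_curvature z).
Proof.
move=> Ux; pose term p q i j (z : V) : R :=
  invmx (gram_mx (Gt z.1) X z.2) p q * invmx (gram_mx (Gt z.1) X z.2) i j
      * curvature_coef (Gt z.1) X p q i j z.2
  - (p == q)%:R * (i == j)%:R * linear_coef p q i j z.
have h p q i j : bigO 2 x (term p q i j).
  have o1 := bigO_inv_gram p q Ux; have o2 := bigO_inv_gram i j Ux.
  have c1 := bigO_continuous oU eps0 Ux (Cinv 0 p q).
  have c2 := bigO_continuous oU eps0 Ux (Cinv 0 i j).
  have ol := bigO_linear_coef p q i j Ux.
  have oc := bigO_curvature_coef p q i j Ux.
  (* Telescoping: [a * b * c - d * d' * l] is [a * b * (c - l) + (a - d) * b * l + d * (b - d') *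
     l], of order 2 in the first term and of orders 1 and 1 in the factors of the others. *)
  have h1 : bigO 2 x (fun z => inv_gram p q z * inv_gram i j z *
     (curvature_coef (Gt z.1) X p q i j z.2 - linear_coef p q i j z)).
    exact: (bigOM (k := 0) (l := 2) (bigOM (k := 0) (l := 0) c1 c2) oc).
  have h2 : bigO 2 x (fun z => ((inv_gram p q z - (p == q)%:R) * inv_gram i j z)
     * linear_coef p q i j z).
    exact: (bigOM (k := 1) (l := 1) (bigOM (k := 1) (l := 0) o1 c2) ol).
  have h3 : bigO 2 x (fun z => ((p == q)%:R * (inv_gram i j z - (i == j)%:R))
     * linear_coef p q i j z).
    exact: (bigOM (k := 1) (l := 1) (bigOZ _ o2) ol).
  apply: (bigO_eq oU eps0 Ux _ (bigOD (bigOD h1 h2) h3)) => z _.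
  rewrite /term -/(inv_gram p q z) -/(inv_gram i j z).
  move: (inv_gram p q z) (inv_gram i j z) (linear_coef p q i j z) (curvature_coef _ _ _ _ _ _ _).
  by move=> a b c d; ring.
have H : bigO 2 x (fun z => \sum_(p < s | (p < m)%N) \sum_(q < s | (q < m)%N)
    \sum_(i < s | (m <= i)%N) \sum_(j < s | (m <= j)%N) term p q i j z).
  by do 4! (apply: bigO_sum => ? _); exact: h.
apply: (bigO_eq oU eps0 Ux _ H) => z _; rewrite /family_curvature /linear_curvature /term.
do 4! (rewrite -sumrB; apply: eq_bigr => ? _).
by [].
Qed.

Let CdetS k : Ck_on k D (fun z : V => Num.sqrt (\det (Gt z.1 z.2))).
Proof.
apply: (Ck_on_sqrt oD) => [z [te Uz]|].
  by apply: posdef_det_gt0; [exact: sG|exact: pG].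
by apply: (Ck_on_det oD) => i j; exact: CJe.
Qed.

Lemma bigO_volume_ratio x : U x -> bigO 1 x (fun z : V =>
  Num.sqrt (\det (Gt z.1 z.2)) / Num.sqrt (\det (Gt 0 z.2)) - 1).
Proof.
move=> Ux; have d0 y : U y -> Num.sqrt (\det (Gt 0 y)) != 0.
  move=> Uy; rewrite sqrtr_eq0 -ltNge; apply: posdef_det_gt0.
    exact: (sG eps00).
  exact: (pG eps00).
have C0 : Ck_on 1 U (fun y => (Num.sqrt (\det (Gt 0 y)))^-1).
  apply: (Ck_onV oU d0); apply: (Ck_on_sqrt oU) => [y Uy|].
    by apply: posdef_det_gt0; [exact: (sG eps00)|exact: (pG eps00)].
  by apply: (Ck_on_det oU) => i j; exact: (Ck_on_entry i j oU (CG eps00 1%N)).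
have C1 := Ck_onM oD (CdetS 1) (@Ck_on_snd _ _ U eps oU 1 _ C0).
have C := Ck_onB oD C1 (Ck_on_cst 1 D (1 : R)).
by apply: (bigO_vanishing oU eps0 Ux C) => y Uy; rewrite divff ?subrr //; exact: d0.
Qed.

End MetricFamily.

(** * Integrals against two comparable measures *)

Section IntegralComparison.
Context d (T : measurableType d) (R : realType).
Variables (mu0 mu1 : {measure set T -> \bar R}) (D : set T) (k : R).
Hypotheses (mD : measurable D) (D0 : (mu0 D < +oo)%E) (k1 : 1 <= k).
Hypothesis mu10 : forall A, measurable A -> A `<=` D -> (mu1 A <= k%:E * mu0 A)%E.
Hypothesis mu01 : forall A, measurable A -> A `<=` D -> (mu0 A <= k%:E * mu1 A)%E.

Lemma bounded_integrable (mu : {measure set T -> \bar R}) (f : T -> R) (C : R) :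
  (mu D < +oo)%E -> measurable_fun D f -> (forall x, D x -> `|f x| <= C) ->
  mu.-integrable D (EFin \o f).
Proof.
move=> muD mf fC; apply: measurable_bounded_integrable => //.
by exists C; split=> [|M CM x /= Dx]; [exact: num_real|exact: le_trans (fC x Dx) (ltW CM)].
Qed.

Lemma Rintegral_bound (mu : {measure set T -> \bar R}) (f : T -> R) (C : R) :
  (mu D < +oo)%E -> measurable_fun D f -> (forall x, D x -> `|f x| <= C) ->
  `|Rintegral mu D f| <= C * fine (mu D).
Proof.
move=> muD mf fC; have fi := bounded_integrable muD mf fC.
apply: le_trans (le_normr_Rintegral mD fi) _; rewrite -Rintegral_cst //.
have mn : measurable_fun D (fun x => `|f x|) by exact: measurableT_comp mf.
apply: le_Rintegral => //.
- by apply: (bounded_integrable muD mn (C := C)) => x Dx; rewrite normr_id fC.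
- apply: (bounded_integrable muD (measurable_cst C) (C := `|C|)) => x _ //.
Qed.

Let D1 : (mu1 D < +oo)%E.
Proof.
apply: le_lt_trans (mu10 mD (@subset_refl _ D)) _; apply: lte_mul_pinfty => //.
by rewrite lee_fin (le_trans ler01).
Qed.

Let Rintegral_le (nu0 nu1 : {measure set T -> \bar R}) (f : T -> R) (C : R) :
  (forall A, measurable A -> A `<=` D -> (nu1 A <= k%:E * nu0 A)%E) ->
  (nu0 D < +oo)%E -> (nu1 D < +oo)%E -> measurable_fun D f ->
  (forall x, D x -> 0 <= f x <= C) -> Rintegral nu1 D f <= k * Rintegral nu0 D f.
Proof.
move=> nu nu0D nu1D mf fC; have k0 : 0 <= k by apply: le_trans k1.
have fC' x : D x -> `|f x| <= C.
  by move=> Dx; have /andP[f0 ?] := fC x Dx; rewrite ger0_norm.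
have fi0 := bounded_integrable nu0D mf fC'; have fi1 := bounded_integrable nu1D mf fC'.
have h := @le_measure_integral _ _ _ nu0 nu1 D k mD k0 nu (EFin \o f).
have {}h : (\int[nu1]_(x in D) (f x)%:E <= k%:E * \int[nu0]_(x in D) (f x)%:E)%E.
  apply: h; first exact/measurable_EFinP.
  by move=> x Dx; rewrite lee_fin; have /andP[] := fC x Dx.
have f0 : (\int[nu0]_(x in D) (f x)%:E)%E \is a fin_num by exact: integrable_fin_num fi0.
have f1 : (\int[nu1]_(x in D) (f x)%:E)%E \is a fin_num by exact: integrable_fin_num fi1.
have fk : (k%:E * \int[nu0]_(x in D) (f x)%:E)%E \is a fin_num by rewrite fin_numM.
by have := fine_le f1 fk h; rewrite fineM.
Qed.

(** Two errors are separated: [f - l], small enough to be bounded by its size, and [l], whose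
    [mu0]-integral is 0, so that its [mu1]-integral is controlled by the discrepancy [k - 1] of the
    measures times its size. *)
Lemma Rintegral_compare (f l : T -> R) (C1 C2 : R) :
  measurable_fun D f -> measurable_fun D l -> 0 <= C1 -> 0 <= C2 ->
  (forall x, D x -> `|l x| <= C1) -> (forall x, D x -> `|f x - l x| <= C2) ->
  Rintegral mu0 D l = 0 ->
  `|Rintegral mu1 D f| <= k * C2 * fine (mu0 D) + 2 * (k - 1) * C1 * fine (mu0 D).
Proof.
move=> mf ml C10 C20 lC fl l0.
have mfl : measurable_fun D (fun x => f x - l x) by exact: measurable_funB.
have li1 := bounded_integrable D1 ml lC; have li0 := bounded_integrable D0 ml lC.
have fli := bounded_integrable D1 mfl fl.
have -> : Rintegral mu1 D f = Rintegral mu1 D (fun x => f x - l x) + Rintegral mu1 D l.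
  by rewrite -RintegralD //; apply: eq_Rintegral => x _; rewrite subrK.
apply: le_trans (ler_normD _ _) _; apply: lerD.
  apply: le_trans (Rintegral_bound D1 mfl fl) _; rewrite mulrAC mulrC.
  apply: ler_wpM2r => //.
  have h := mu10 mD (@subset_refl _ D).
  have f0 : mu0 D \is a fin_num by rewrite ge0_fin_numE.
  have f1 : mu1 D \is a fin_num by rewrite ge0_fin_numE.
  by rewrite -[k]/(fine k%:E) -fineM //; apply: fine_le; rewrite // fin_numM.
(* The comparison of measures concerns nonnegative integrands, hence the positive and negative
   parts, whose [mu0]-integrals agree. *)
pose lp x := Num.max (l x) 0; pose ln x := Num.max (- l x) 0.
have mp : measurable_fun D lp by apply: measurable_maxr => //; exact: measurable_cst.
have mn : measurable_fun D ln.
  by apply: measurable_maxr; [exact: measurableT_comp ml|exact: measurable_cst].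
have pC x : D x -> 0 <= lp x <= C1.
  move=> /lC; rewrite ler_norml => /andP[_ h].
  by rewrite /lp le_max lexx orbT ge_max h C10.
have nC x : D x -> 0 <= ln x <= C1.
  move=> /lC; rewrite ler_norml => /andP[h _].
  by rewrite /ln le_max lexx orbT ge_max C10 andbT lerNl.
have abs (h : T -> R) : (forall x, D x -> 0 <= h x <= C1) -> forall x, D x -> `|h x| <= C1.
  by move=> hC x Dx; have /andP[h0 ?] := hC x Dx; rewrite ger0_norm.
have lE x : l x = lp x - ln x.
  rewrite /lp /ln; have [h|h] := leP (l x) 0.
    by rewrite max_l ?oppr_ge0 // sub0r opprK.
  by rewrite max_r ?subr0 // oppr_le0 ltW.
have IE (nu : {measure set T -> \bar R}) : (nu D < +oo)%E ->
    Rintegral nu D l = Rintegral nu D lp - Rintegral nu D ln.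
  move=> nuD; rewrite -RintegralB //; first by apply: eq_Rintegral => x _; exact: lE.
    exact: bounded_integrable nuD mp (abs _ pC).
  exact: bounded_integrable nuD mn (abs _ nC).
have a1 := Rintegral_le mu10 D0 D1 mp pC; have b1 := Rintegral_le mu10 D0 D1 mn nC.
have a2 := Rintegral_le mu01 D1 D0 mp pC; have b2 := Rintegral_le mu01 D1 D0 mn nC.
have A0 : 0 <= Rintegral mu0 D lp by apply: Rintegral_ge0 => x /pC/andP[].
have A1 := Rintegral_bound D0 mp (abs _ pC).
move: l0 A1; rewrite !IE // (ger0_norm A0).
move: (Rintegral mu1 D lp) (Rintegral mu1 D ln) (Rintegral mu0 D lp)
  (Rintegral mu0 D ln) (fine _) A0 a1 b1 a2 b2 k1 C10 => a b A B v A0 a1 b1 a2 b2 k1' C10' AB AC.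
have EB : B = A by apply/esym/eqP; rewrite -subr_eq0; apply/eqP.
rewrite EB in b1 b2.
(* Both [a] and [b] lie between [A / k] and [k * A], and [k - 1 / k] is at most [2 * (k - 1)] as [k]
   is at least 1. *)
apply: (@le_trans _ _ (2 * (k - 1) * A)); last first.
  by rewrite -[leRHS]mulrA; apply: ler_wpM2l => //; rewrite mulr_ge0 // subr_ge0.
rewrite ler_norml; apply/andP; split; nra.
Qed.

End IntegralComparison.

Lemma Ck_on_sum4 (R : realType) (V : normedModType R) k (A : set V) (I : finType)
    (P1 P2 P3 P4 : pred I) (F : I -> I -> I -> I -> V -> R) :
  open A -> (forall p q i j, Ck_on k A (F p q i j)) ->
  Ck_on k A (fun x => \sum_(p | P1 p) \sum_(q | P2 q) \sum_(i | P3 i) \sum_(j | P4 j)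
    F p q i j x).
Proof.
move=> oA CF.
apply: (@Ck_on_sum R V k A _ _ _ (fun p x => \sum_(q | P2 q) \sum_(i | P3 i)
  \sum_(j | P4 j) F p q i j x) oA) => p _.
apply: (@Ck_on_sum R V k A _ _ _ (fun q x => \sum_(i | P3 i) \sum_(j | P4 j)
  F p q i j x) oA) => q _.
apply: (@Ck_on_sum R V k A _ _ _ (fun i x => \sum_(j | P4 j) F p q i j x) oA) => i _.
by apply: (@Ck_on_sum R V k A _ _ _ (F p q i) oA) => j _.
Qed.

(** * Uniform estimates on compact subsets of the manifold *)

Section ManifoldEstimates.
Variables (R : realType) (N s m : nat) (M : smooth_manifold R N) (eps : R).
Variables (gt : R -> field M 'M[R]_N) (X : 'I_s -> field M 'rV[R]_N).
Hypothesis eps0 : 0 < eps.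
Hypothesis hgt : forall t, `|t| < eps -> is_riemannian_metric (gt t).
Hypothesis Cgt : forall c, smooth_on
  [set z : R^o * 'rV[R]_N | `|z.1| < eps /\ img c z.2] (fun z => gt z.1 c z.2).
Hypothesis hX : forall p, is_vector_field (X p).
Hypothesis XX : forall p q c x, img c x ->
  'D_(X p c x) (X q c) x = 'D_(X q c x) (X p c) x.
Hypothesis freeX : forall c x, img c x -> row_free (\matrix_p X p c x).
Hypothesis gram0 : forall p q c x, img c x ->
  pairing (gt 0 c x) (X p c x) (X q c x) = (p == q)%:R.
Hypothesis killing0 : forall p, is_killing (gt 0) (X p).

Local Notation Xc c := (fun p => X p c).
Local Notation Gc c := (fun t => gt t c).

Let CXe p c : smooth_entries (img c) (X p c).
Proof. exact: vector_field_entries. Qed.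

Let eps00 : `|0 : R| < eps. Proof. by rewrite normr0. Qed.

Let CGc c t : `|t| < eps -> smooth_on (img c) (gt t c).
Proof. by move=> te; have [] := metric_open_data (hgt te) c. Qed.

Let sGc c t : `|t| < eps -> forall x, img c x -> (gt t c x)^T = gt t c x.
Proof. by move=> te; have [] := metric_open_data (hgt te) c. Qed.

Let pGc c t : `|t| < eps -> forall x, img c x ->
  forall v, v != 0 -> 0 < pairing (gt t c x) v v.
Proof. by move=> te; have [] := metric_open_data (hgt te) c. Qed.

Lemma Ck_on_curvature_coef t c p q i j k : `|t| < eps ->
  Ck_on k (img c) (curvature_coef (gt t c) (Xc c) p q i j).
Proof.
move=> te; have [oc CG sG pG] := metric_open_data (hgt te) c.
have C1 p' q' i' j' := Ck_on_second_lie oc CG (fun p => CXe p c) k p' q' i' j'.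
have CGe i' j' := Ck_on_entry i' j' oc (CG k).
have Cc p' q' := smooth_entries_covariant oc CG sG pG (CXe p' c) (CXe q' c).
have C2 p' q' i' j' := Ck_on_pairing oc CGe (Cc p' q' k) (Cc i' j' k).
have Ch (f : 'rV[R]_N -> R) : Ck_on k (img c) f -> Ck_on k (img c) (fun x => 2^-1 * f x).
  by move=> Cf; exact: (Ck_onM oc (Ck_on_cst k (img c) (2^-1 : R)) Cf).
exact: (Ck_onB oc (Ck_onD oc (Ck_onB oc (Ck_onN oc (Ch _ (C1 p q i j)))
  (Ch _ (C1 i j p q))) (C2 p i q j)) (C2 p q i j)).
Qed.

Definition chart_curvature t : field M R :=
  fun c x => family_curvature m (Gc c) (Xc c) (t, x).

Definition chart_linear t : field M R :=
  fun c x => linear_curvature m (Gc c) (Xc c) (t, x).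

Lemma chart_curvature_invariant t : `|t| < eps -> scalar_invariant (chart_curvature t).
Proof.
move=> te c d x h; rewrite /chart_curvature /family_curvature /=.
rewrite (gram_mx_invariant (hgt te) hX h).
apply: eq_bigr => p _; apply: eq_bigr => q _; apply: eq_bigr => i _; apply: eq_bigr => j _.
congr (_ * _); exact: (curvature_coef_invariant (hgt te) hX XX p q i j h).
Qed.

Lemma chart_linear_invariant t : `|t| < eps -> scalar_invariant (chart_linear t).
Proof.
move=> te c d x h; rewrite /chart_linear /linear_curvature /linear_coef /=.
apply: eq_bigr => p _; apply: eq_bigr => q _; apply: eq_bigr => i _; apply: eq_bigr => j _.
have E p' q' i' j' := second_lie_invariant (hgt te) hX p' q' i' j' h.
have aux (w a a' b b' : R) : a = a' -> b = b' ->
    w * (- (2^-1 * a) - 2^-1 * b) = w * (- (2^-1 * a') - 2^-1 * b') by move=> -> ->.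
exact (aux _ _ _ _ _ (E p q i j) (E i j p q)).
Qed.

Lemma continuous_curvature t : `|t| < eps -> continuous (fun_of (chart_curvature t)).
Proof.
move=> te; apply: (Ck_fun_continuous (k := 0)); apply: Ck_fun_of.
  exact: chart_curvature_invariant.
move=> c; have [oc CG sG pG] := metric_open_data (hgt te) c.
have Cinv p q : Ck_on 0 (img c) (fun x => invmx (gram_mx (gt t c) (Xc c) x) p q).
  apply: (Ck_on_invmx oc) => [x cx|i j].
    exact: (gram_mx_unit (pGc (c := c)) (freeX (c := c)) te cx).
  apply: (Ck_on_eq oc _ (Ck_on_gramX oc CG (fun p => CXe p c) 0 i j)) => x _.
  by rewrite mxE.
apply: (@Ck_on_sum4 R _ 0 (img c) _ _ _ _ _ (fun p q i j x => invmx (gram_mx (gt t c) (Xc c) x) p q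
  * invmx (gram_mx (gt t c) (Xc c) x) i j * curvature_coef (gt t c) (Xc c) p q i j x) oc).
move=> p q i j.
exact: (Ck_onM oc (Ck_onM oc (Cinv p q) (Cinv i j)) (Ck_on_curvature_coef c p q i j 0 te)).
Qed.

Lemma continuous_linear t : `|t| < eps -> continuous (fun_of (chart_linear t)).
Proof.
move=> te; apply: (Ck_fun_continuous (k := 0)); apply: Ck_fun_of.
  exact: chart_linear_invariant.
move=> c; have [oc CG sG pG] := metric_open_data (hgt te) c.
have C1 p' q' i' j' := Ck_on_second_lie oc CG (fun p => CXe p c) 0 p' q' i' j'.
have Ch (f : 'rV[R]_N -> R) : Ck_on 0 (img c) f -> Ck_on 0 (img c) (fun x => 2^-1 * f x).
  by move=> Cf; exact: (Ck_onM oc (Ck_on_cst 0 (img c) (2^-1 : R)) Cf).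
apply: (@Ck_on_sum4 R _ 0 (img c) _ _ _ _ _ (fun p q i j x => (p == q)%:R * (i == j)%:R *
  (- (2^-1 * second_lie (gt t c) (Xc c) p q i j x)
   - 2^-1 * second_lie (gt t c) (Xc c) i j p q x)) oc) => p q i j.
apply: (Ck_onM oc (Ck_on_cst 0 (img c) ((p == q)%:R * (i == j)%:R : R))).
exact: (Ck_onB oc (Ck_onN oc (Ch _ (C1 p q i j))) (Ch _ (C1 i j p q))).
Qed.

Lemma bigO_near k (c : chart M) p H : dom c p -> bigO k (Defs.coord c p) H ->
  exists C e, [/\ 0 <= C, 0 < e, e <= eps &
    exists A : set M, [/\ open A, A p, A `<=` dom c &
      forall t q, `|t| < e -> A q -> `|H (t, Defs.coord c q)| <= C * `|t| ^+ k]].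
Proof.
move=> cp [C C0 h].
have : nbhs ((0 : R^o, Defs.coord c p) : R^o * 'rV[R]_N)
  [set z | `|H z| <= C * `|z.1| ^+ k] by [].
(* The minimum with [eps] keeps [t] in the range where [gt t] is a metric. *)
rewrite -nbhs_ballE => -[e /= e0 eP]; exists C, (Num.min e eps); split=> //.
- by rewrite lt_min e0.
- by rewrite ge_min lexx orbT.
have [A [oA Ap Ac AB]] := near_coord cp (ball_open (Defs.coord c p) e) (ballxx _ e0).
exists A; split=> // t q; rewrite lt_min => /andP[te _] Aq.
by apply: (eP (t, Defs.coord c q)); split; [rewrite /ball /= sub0r normrN|exact: AB].
Qed.

Lemma curvature_bound_near p : exists C e, [/\ 0 <= C, 0 < e, e <= eps &
  exists A : set M, [/\ open A, A p & forall t q, `|t| < e -> A q ->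
    `|fun_of (chart_linear t) q| <= C * `|t| /\
    `|fun_of (chart_curvature t) q - fun_of (chart_linear t) q| <= C * `|t| ^+ 2]].
Proof.
have cp := dom_chart_at p; set c := chart_at p in cp.
have oc := @img_open _ _ M c; have cx := img_coord cp.
have b1 := @bigO_linear_curvature R N s m (img c) eps (Gc c) (Xc c) oc eps0 (Cgt c) (fun p => CXe p c)
  (fun p q y => @gram0 p q c y) _ cx.
have b2 := @bigO_family_curvature R N s m (img c) eps (Gc c) (Xc c) oc eps0 (Cgt c) (@CGc c) (@sGc c)
  (@pGc c) (fun p => CXe p c) (fun p q y => @XX p q c y) (fun y => @freeX c y)
  (fun p q y => @gram0 p q c y) (fun p => @killing0 p c) _ cx.
have [C1 [e1 [C10 e10 e1e [A1 [oA1 A1p A1c H1]]]]] := bigO_near cp b1.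
have [C2 [e2 [C20 e20 e2e [A2 [oA2 A2p A2c H2]]]]] := bigO_near cp b2.
exists (C1 + C2), (Num.min e1 e2); split; first exact: addr_ge0.
- by rewrite lt_min e10.
- by rewrite ge_min e1e.
exists (A1 `&` A2); split; [exact: openI|by []|].
move=> t q; rewrite lt_min => /andP[te1 te2] [A1q A2q].
have te : `|t| < eps by exact: lt_le_trans te1 e1e.
have cq := A1c q A1q.
rewrite (fun_of_coord (chart_linear_invariant te) cq).
rewrite (fun_of_coord (chart_curvature_invariant te) cq); split.
  have := H1 t q te1 A1q; rewrite expr1 => h; apply: le_trans h _.
  by apply: ler_wpM2r => //; rewrite lerDl.
apply: le_trans (H2 t q te2 A2q) _.
by apply: ler_wpM2r; [exact: exprn_ge0|rewrite lerDr].
Qed.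

Lemma curvature_bound (K : set M) : compact K -> exists C e, [/\ 0 <= C, 0 < e, e <= eps &
  forall t q, `|t| < e -> K q -> `|fun_of (chart_linear t) q| <= C * `|t| /\
    `|fun_of (chart_curvature t) q - fun_of (chart_linear t) q| <= C * `|t| ^+ 2].
Proof.
pose P (B : set M) := exists C e, [/\ 0 <= C, 0 < e, e <= eps &
  forall t q, `|t| < e -> B q -> `|fun_of (chart_linear t) q| <= C * `|t| /\
    `|fun_of (chart_curvature t) q - fun_of (chart_linear t) q| <= C * `|t| ^+ 2].
move=> cK; apply: (compact_induction (P := P) cK).
- by exists 0, eps; split.
- move=> A B [C1 [e1 [C10 e10 e1e H1]]] [C2 [e2 [C20 e20 e2e H2]]].
  exists (C1 + C2), (Num.min e1 e2); split; first exact: addr_ge0.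
  + by rewrite lt_min e10.
  + by rewrite ge_min e1e.
  move=> t q; rewrite lt_min => /andP[te1 te2] [Aq|Bq].
    have [h1 h2] := H1 t q te1 Aq; split; [apply: le_trans h1 _|apply: le_trans h2 _].
      by apply: ler_wpM2r => //; rewrite lerDl.
    by apply: ler_wpM2r; [exact: exprn_ge0|rewrite lerDl].
  have [h1 h2] := H2 t q te2 Bq; split; [apply: le_trans h1 _|apply: le_trans h2 _].
    by apply: ler_wpM2r => //; rewrite lerDr.
  by apply: ler_wpM2r; [exact: exprn_ge0|rewrite lerDr].
- move=> A B AB [C [e [C0 e0 ee H]]]; exists C, e; split=> // t q te /AB; exact: H.
- move=> p Kp; have [C [e [C0 e0 ee [A [oA Ap H]]]]] := curvature_bound_near p.
  by exists A; split=> //; exists C, e; split.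
Qed.

(** Volumes are given by a predicate, hence the quantification over both measures. Inequalities
    between measures of sets, unlike an estimate of densities, add up over disjoint pieces lying in
    different charts. *)
Definition volumes_close (B : set (borel M)) (k t : R) : Prop :=
  forall mu0 mu1 : {measure set (borel M) -> \bar R},
  is_riemannian_volume (gt 0) mu0 -> is_riemannian_volume (gt t) mu1 ->
  forall A : set (borel M), measurable A -> A `<=` B ->
    (mu1 A <= k%:E * mu0 A)%E /\ (mu0 A <= k%:E * mu1 A)%E.

(** The factor 2 pays for inverting the ratio: [(1 + 2 * e) * (1 - e)] is at least 1 for [e] between
    0 and 1/2. *)
Let ratio_bounds (a b C t : R) : 0 < b -> 0 <= a -> 0 <= C -> 0 <= t -> C * t <= 2^-1 ->
  `|a / b - 1| <= C * t -> a <= (1 + 2 * C * t) * b /\ b <= (1 + 2 * C * t) * a.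
Proof.
move=> b0 a0 C0 t0 Ct; have E : a = a / b * b by rewrite divfK ?gt_eqF.
rewrite ler_norml => /andP[h1 h2]; move: (a / b) E h1 h2 => r -> h1 h2.
have d0 : 0 <= C * t by exact: mulr_ge0.
rewrite -mulrA; move: (C * t) d0 Ct h1 h2 => e e0 e1 h1 h2; split.
  by apply: ler_wpM2r; [exact: ltW|lra].
rewrite mulrA -[leLHS]mul1r; apply: ler_wpM2r; first exact: ltW.
apply: (@le_trans _ _ ((1 + 2 * e) * (1 - e))); last first.
  by apply: ler_wpM2l; lra.
nra.
Qed.

Lemma volume_bound_near p : exists C e, [/\ 0 <= C, 0 < e, e <= eps &
  exists A : set M, [/\ open A, A p & forall t, `|t| < e ->
    volumes_close A (1 + C * `|t|) t]].
Proof.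
have cp := dom_chart_at p; set c := chart_at p in cp.
have oc := @img_open _ _ M c; have cx := img_coord cp.
have b := @bigO_volume_ratio R N (img c) eps (Gc c) oc eps0 (Cgt c) (@CGc c) (@sGc c)
  (@pGc c) _ cx.
have [C [e [C0 e0 ee [A [oA Ap Ac H]]]]] := bigO_near cp b.
have C10 : 0 < 2 * C + 1 by rewrite ltr_wpDl // mulr_ge0.
(* The bound [(2 * C + 1)^-1] on the time guarantees that [C] times it is at most 1/2, as
   [ratio_bounds] requires. *)
exists (2 * C), (Num.min e (2 * C + 1)^-1); split; first exact: mulr_ge0.
- by rewrite lt_min e0 invr_gt0.
- by rewrite ge_min ee.
exists A; split=> // t; rewrite lt_min => /andP[te tC] mu0 mu1 h0 h1 B mB BA.
have te' : `|t| < eps by exact: lt_le_trans te ee.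
have Bc : B `<=` dom c by exact: subset_trans BA Ac.
have Ct : C * `|t| <= 2^-1.
  have h : (2 * C + 1) * `|t| <= 1.
    by rewrite mulrC -ler_pdivlMr // mul1r ltW.
  by move: (normr_ge0 t) h; nra.
have d x : (Defs.coord c @` B) x ->
    volume_density (gt t) c x <= (1 + 2 * C * `|t|) * volume_density (gt 0) c x /\
    volume_density (gt 0) c x <= (1 + 2 * C * `|t|) * volume_density (gt t) c x.
  move=> [q Bq <-]; have cq : img c (Defs.coord c q) by apply: img_coord; exact: Bc.
  rewrite /volume_density !patchE mem_set //=.
  apply: ratio_bounds => //.
  - rewrite sqrtr_gt0; apply: (det_metric_gt0 (hgt eps00)) => //.
  - by have := H t q te (BA q Bq); rewrite expr1.
have mcB : measurable (Defs.coord c @` B : set (borel 'rV[R]_N)).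
  have -> : Defs.coord c @` B = img c `&` param c @^-1` B.
    apply/seteqP; split=> [_ [q Bq <-]|x [[q cq <-]]].
      by split; [exists q => //; exact: Bc|rewrite /= coordK //; exact: Bc].
    by rewrite /= coordK // => Aq; exists q.
  exact: measurable_param (@measurable_img _ _ M c) B mB.
have comparison (u v : borel 'rV[R]_N -> R) : measurable_fun setT u -> measurable_fun setT v ->
    (forall x, 0 <= u x) -> (forall x, 0 <= v x) ->
    (forall x, (Defs.coord c @` B) x -> u x <= (1 + 2 * C * `|t|) * v x) ->
    (\int[lebesgue_rV R N]_(x in Defs.coord c @` B) (u x)%:E <= (1 + 2 * C * `|t|)%:E *
     \int[lebesgue_rV R N]_(x in Defs.coord c @` B) (v x)%:E)%E.
  move=> mu mv u0 v0 uv; have k0 : 0 <= 1 + 2 * C * `|t| by rewrite addr_ge0 // !mulr_ge0.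
  rewrite -ge0_integralZl //; last 2 first.
  - by apply: measurable_funTS; exact/measurable_EFinP.
  - by move=> x _; rewrite lee_fin.
  apply: ge0_le_integral => //.
  - by move=> x _; rewrite lee_fin.
  - by apply: measurable_funTS; exact/measurable_EFinP.
  - apply: measurable_funTS; apply: measurable_funeM; exact/measurable_EFinP.
rewrite (volume_chart (hgt te') h1 mB Bc) (volume_chart (hgt eps00) h0 mB Bc).
have m0 := measurable_volume_density (hgt eps00) c.
have m1 := measurable_volume_density (hgt te') c.
split; apply: comparison => //; try exact: volume_density_ge0.
  by move=> x /d[].
by move=> x /d[].
Qed.

Lemma volume_bound (K : set M) : compact K -> exists C e, [/\ 0 <= C, 0 < e, e <= eps &
  forall t, `|t| < e -> volumes_close K (1 + C * `|t|) t].
Proof.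
(* The measurable superset allows a set in a union to be cut into its parts inside and outside [A'],
   which are then estimated separately. *)
pose P (B : set M) := exists2 B' : set (borel M), measurable B' /\ B `<=` B' &
  exists C e, [/\ 0 <= C, 0 < e, e <= eps &
  forall t, `|t| < e -> volumes_close B' (1 + C * `|t|) t].
move=> cK; suff : P K.
  move=> [K' [_ KK'] [C [e [C0 e0 ee H]]]]; exists C, e; split=> // t te mu0 mu1 h0 h1 A mA AK.
  by apply: (H t te) => //; exact: subset_trans KK'.
apply: (compact_induction (P := P) cK).
- exists set0; first by split=> //; exact: measurable0.
  exists 0, eps; split=> // t te mu0 mu1 _ _ A mA; rewrite subset0 => ->.
  by rewrite !measure0 mule0.
- move=> A B [A' [mA' AA'] [C1 [e1 [C10 e10 e1e H1]]]] [B' [mB' BB'] [C2 [e2 [C20 e20 e2e H2]]]].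
  exists (A' `|` B').
    by split; [exact: measurableU|move=> x [/AA'|/BB']; [left|right]].
  exists (C1 + C2), (Num.min e1 e2); split; first exact: addr_ge0.
  + by rewrite lt_min e10.
  + by rewrite ge_min e1e.
  move=> t; rewrite lt_min => /andP[te1 te2] mu0 mu1 h0 h1 E mE EAB.
  have [|a1 a2] := H1 t te1 mu0 mu1 h0 h1 (E `&` A') (measurableI _ _ mE mA').
    by move=> x [].
  have [|b1 b2] := H2 t te2 mu0 mu1 h0 h1 (E `\` A') (measurableD mE mA').
    by move=> x [/EAB[]].
  have D (mu : {measure set (borel M) -> \bar R}) :
    mu E = (mu (E `&` A') + mu (E `\` A'))%E by rewrite addeC -measureDI.
  have k1 : ((1 + C1 * `|t|)%:E <= (1 + (C1 + C2) * `|t|)%:E)%E.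
    by rewrite lee_fin lerD2l ler_wpM2r // lerDl.
  have k2 : ((1 + C2 * `|t|)%:E <= (1 + (C1 + C2) * `|t|)%:E)%E.
    by rewrite lee_fin lerD2l ler_wpM2r // lerDr.
  rewrite !D !muleDr ?ge0_adde_def ?inE //; split; apply: leeD.
  + by apply: le_trans a1 _; exact: lee_wpmul2r.
  + by apply: le_trans b1 _; exact: lee_wpmul2r.
  + by apply: le_trans a2 _; exact: lee_wpmul2r.
  + by apply: le_trans b2 _; exact: lee_wpmul2r.
- move=> A B AB [B' [mB' BB'] H]; exists B' => //; split=> //; exact: subset_trans BB'.
- move=> p Kp; have [C [e [C0 e0 ee [A [oA Ap H]]]]] := volume_bound_near p.
  exists A; split=> //; exists A; first by split=> //; exact: borel_open_measurable.
  by exists C, e; split.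
Qed.

End ManifoldEstimates.

(** * The action is stationary *)

Section LinearPart.
Variables (R : realType) (N s m : nat) (M : smooth_manifold R N) (eps : R).
Variables (gt : R -> field M 'M[R]_N) (X : 'I_s -> field M 'rV[R]_N).
Variables (Om : set M) (mu : {measure set (borel M) -> \bar R}).
Hypothesis eps0 : 0 < eps.
Hypothesis hgt : forall t, `|t| < eps -> is_riemannian_metric (gt t).
Hypothesis hX : forall p, is_vector_field (X p).
Hypothesis gram0 : forall p q c x, img c x ->
  pairing (gt 0 c x) (X p c x) (X q c x) = (p == q)%:R.
Hypothesis killing0 : forall p, is_killing (gt 0) (X p).
Hypotheses (oOm : open Om) (cOm : compact (closure Om)).
Hypothesis hout : forall t, `|t| < eps -> forall c x, img c x -> ~ Om (param c x) ->
  gt t c x = gt 0 c x.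
Hypothesis hmu : is_riemannian_volume (gt 0) mu.

Local Notation Xc c := (fun p => X p c).
Let eps00 : `|0 : R| < eps. Proof. by rewrite normr0. Qed.
Let CXe p c : smooth_entries (img c) (X p c).
Proof. exact: vector_field_entries. Qed.

(** Subtracting the value at [t = 0] leaves the derivatives unchanged and produces a function
    vanishing off [Om], as the divergence argument requires. *)
Definition gram_defect t i j : M -> R :=
  fun_of (fun c x => gram (gt t c) (Xc c) i j x - (i == j)%:R).

Let defect_invariant t i j : `|t| < eps ->
  scalar_invariant (fun c x => gram (gt t c) (Xc c) i j x - (i == j)%:R).
Proof.
move=> te c d x h; congr (_ - _).
exact: (gram_scalar_invariant (hgt te) (hX i) (hX j) h).
Qed.

Lemma Ck_gram_defect k t i j : `|t| < eps -> Ck_fun k (gram_defect t i j).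
Proof.
move=> te; apply: Ck_fun_of; first exact: defect_invariant.
move=> c; have [oc CG sG pG] := metric_open_data (hgt te) c.
exact: (Ck_onB oc (Ck_on_gramX oc CG (fun p => CXe p c) k i j) (Ck_on_cst k _ _)).
Qed.

Lemma gram_defect_out t i j p : `|t| < eps -> ~ Om p -> gram_defect t i j p = 0.
Proof.
move=> te Omp; have cp := dom_chart_at p; rewrite /gram_defect /fun_of /gram.
rewrite (hout te) ?gram0 ?subrr //; first exact: img_coord.
  exact: img_coord.
by rewrite coordK.
Qed.

Lemma lie_lie_gram_defect t p i j q : `|t| < eps ->
  lieM (X p) (lieM (X p) (gram_defect t i j)) q =
  fun_of (fun c => second_lie (gt t c) (Xc c) p p i j) q.
Proof.
move=> te; have cq := img_coord (dom_chart_at q); set c := chart_at q in cq.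
have [oc CG sG pG] := metric_open_data (hgt te) c.
have E y : img c y -> lieM (X p) (gram_defect t i j) (param c y) =
    lie_fun (X p c) (gram (gt t c) (Xc c) i j) y.
  move=> cy; rewrite (lieM_param (hX p) (Ck_gram_defect 1 i j te) cy) /lie_fun.
  have e1 z : img c z -> (gram_defect t i j \o param c) z =
      gram (gt t c) (Xc c) i j z - (i == j)%:R.
    by move=> cz; exact: (fun_of_param (defect_invariant i j te) cz).
  rewrite (derive_open_eq (X p c y) oc cy e1).
  have dg : derivable (gram (gt t c) (Xc c) i j) y (X p c y).
    apply: diff_derivable.
    exact: Ck_on_differentiable (Ck_on_gramX oc CG (fun p => CXe p c) 1 i j) cy.
  have [_ h] := is_deriveB (derivableP dg) (is_derive_cst ((i == j)%:R : R) y (X p c y)).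
  by apply: etrans h _; rewrite subr0.
exact: (derive_open_eq (X p c _) oc cq E).
Qed.

Let zero_mean (h : borel M -> R) : Prop :=
  mu.-integrable Om (EFin \o h) /\ Rintegral mu Om h = 0.

Let mOm : measurable (Om : set (borel M)). Proof. exact: borel_open_measurable. Qed.

Let zero_meanD h h' : zero_mean h -> zero_mean h' -> zero_mean (fun q => h q + h' q).
Proof.
move=> [hi h0] [hi' h0']; split; last by rewrite RintegralD // h0 h0' addr0.
exact: (integrableD mOm hi hi').
Qed.

Let zero_meanZ (a : R) h : zero_mean h -> zero_mean (fun q => a * h q).
Proof.
move=> [hi h0]; split; last by rewrite RintegralZl // h0 mulr0.
exact: (integrableZl mOm a hi).
Qed.

Let zero_mean0 : zero_mean (fun=> 0).
Proof. by split; [exact: integrable0|rewrite Rintegral_cst // mul0r]. Qed.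

Let zero_mean_sum (I : finType) (P : pred I) (F : I -> borel M -> R) :
  (forall i, zero_mean (F i)) -> zero_mean (fun q => \sum_(i | P i) F i q).
Proof.
move=> hF; elim: (index_enum I) => [|i r IH].
  by rewrite (_ : (fun q => _) = fun=> 0) //; apply/funext => q; rewrite big_nil.
case Pi : (P i).
  rewrite (_ : (fun q => _) = fun q => F i q + \sum_(i <- r | P i) F i q).
    exact: zero_meanD.
  by apply/funext => q; rewrite big_cons Pi.
rewrite (_ : (fun q => _) = fun q => \sum_(i <- r | P i) F i q) //.
by apply/funext => q; rewrite big_cons Pi.
Qed.

Let zero_mean_second_lie t p i j : `|t| < eps ->
  zero_mean (fun_of (fun c => second_lie (gt t c) (Xc c) p p i j)).
Proof.
move=> te; rewrite (_ : fun_of _ = lieM (X p) (lieM (X p) (gram_defect t i j))); last first.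
  by apply/funext => q; rewrite lie_lie_gram_defect.
have u0 q : ~ closure Om q -> gram_defect t i j q = 0.
  by move=> Kq; apply: gram_defect_out => // Omq; apply: Kq; exact: subset_closure.
have C3 := Ck_gram_defect 3 i j te.
have Cl : Ck_fun 1 (lieM (X p) (gram_defect t i j)).
  by apply: (Ck_lieM (hX p)); exact: Ck_gram_defect.
split.
  have oK : open (~` closure Om) by apply: closed_openC; exact: closed_closure.
  have l0 q : ~ closure Om q -> lieM (X p) (gram_defect t i j) q = 0.
    by move=> Kq; apply: (lieM_eq0 (X p) (A := ~` closure Om)).
  have h := integrable_lie (hgt eps00) hmu (hX p) cOm Cl l0.
  exact: (integrableS measurableT mOm (@subsetT _ _) h).
have h := integral_lie_lie (hgt eps00) hmu (hX p) (@killing0 p) cOm u0 C3 oOm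
  (fun q => @gram_defect_out t i j q te).
by rewrite /Rintegral h.
Qed.

(** The Kronecker deltas leave only [p = q] and [i = j], where the terms are second derivatives of a
    Gram defect along one and the same Killing field. *)
Lemma Rintegral_linear t : `|t| < eps ->
  Rintegral mu Om (fun_of (chart_linear m gt X t)) = 0.
Proof.
move=> te; pose F p q i j (r : borel M) : R := (p == q)%:R * (i == j)%:R *
  (- 2^-1 * fun_of (fun c => second_lie (gt t c) (Xc c) p q i j) r
   + - 2^-1 * fun_of (fun c => second_lie (gt t c) (Xc c) i j p q) r).
have hF p q i j : zero_mean (F p q i j).
  rewrite /F; have [->|pq] := eqVneq p q; last first.
    by rewrite (_ : (fun r => _) = fun=> 0) //; apply/funext => r; rewrite !mul0r.
  have [->|ij] := eqVneq i j; last first.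
    by rewrite (_ : (fun r => _) = fun=> 0) //; apply/funext => r; rewrite mulr0 mul0r.
  apply: zero_meanZ; apply: zero_meanD; apply: zero_meanZ; exact: zero_mean_second_lie.
have : zero_mean (fun r => \sum_(p < s | (p < m)%N) \sum_(q < s | (q < m)%N)
    \sum_(i < s | (m <= i)%N) \sum_(j < s | (m <= j)%N) F p q i j r).
  by do 4! (apply: zero_mean_sum => ?); exact: hF.
move=> [_ <-]; apply: eq_Rintegral => r _.
rewrite /fun_of /chart_linear /linear_curvature /F.
apply: eq_bigr => p _; apply: eq_bigr => q _; apply: eq_bigr => i _; apply: eq_bigr => j _.
have aux (w a b : R) : w * (- (2^-1 * a) - 2^-1 * b) = w * (- 2^-1 * a + - 2^-1 * b).
  by rewrite !mulNr.
exact: aux.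
Qed.

End LinearPart.

Lemma lie_metric_congr (R : realType) N (x u v : 'rV[R]_N) (X : 'rV[R]_N -> 'rV[R]_N)
    (G G' : 'rV[R]_N -> 'M[R]_N) : 'D_(X x) G x = 'D_(X x) G' x -> G x = G' x ->
  lie_metric X G x u v = lie_metric X G' x u v.
Proof. by rewrite /lie_metric => -> ->. Qed.

(** The bound at [t = 0] forces [J 0 = 0], so the difference quotient is itself at most a multiple
    of [t]. *)
Lemma is_derive0_quadratic (R : realType) (J : R -> R) (C e : R) : 0 < e ->
  (forall t, `|t| < e -> `|J t| <= C * `|t| ^+ 2) -> is_derive (0 : R) (1 : R) J 0.
Proof.
move=> e0 JC; have J0 : J 0 = 0.
  by apply/eqP; rewrite -normr_le0 (le_trans (JC 0 _)) ?normr0 // expr0n mulr0.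
have h : (fun h : R => h^-1 *: ((J \o shift 0) (h *: 1) - J 0)) @ 0^' --> (0 : R).
  apply/cvgrPdist_le => d d0; near=> h.
  have h0 : h != 0 by near: h; exact: nbhs_dnbhs_neq.
  have he : `|h| < e by near: h; exact: dnbhs0_lt.
  have hd : `|h| <= d / (`|C| + 1).
    by near: h; apply: dnbhs0_le; rewrite divr_gt0 // ltr_wpDl.
  rewrite sub0r normrN /= addr0 J0 subr0 [h *: 1]mulr1 normrM normfV.
  rewrite ler_pdivrMl ?normr_gt0 // (le_trans (JC h he)) // expr2 mulrCA.
  apply: ler_wpM2l => //; apply: (@le_trans _ _ ((`|C| + 1) * `|h|)).
    by apply: ler_wpM2r => //; rewrite (le_trans (ler_norm C)) // lerDl.
  by rewrite mulrC -ler_pdivlMr // ltr_wpDl.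
by apply: DeriveDef; [apply/cvg_ex; exists 0|exact/cvg_lim].
Unshelve. all: by end_near. Qed.

Theorem proposition13 (R : realType) (n s m : nat)
    (M : smooth_manifold R (n.*2 + s))
    (f : field M 'M[R]_(n.*2 + s))
    (xi : 'I_s -> field M 'rV[R]_(n.*2 + s))
    (eta : 'I_s -> field M 'cV[R]_(n.*2 + s))
    (g : field M 'M[R]_(n.*2 + s))
    (hdim : (2 < n.*2 + s)%N)
    (hM : metric_f_K_contact_manifold f xi eta g)
    (hm : (m < s)%N) :
  let D1 := span_distribution (fun i : 'I_s => (i < m)%N) xi in
  let D2 := span_distribution (fun i : 'I_s => (m <= i)%N) xi in
  critical D1 D2 (orthogonal_distributions D1 D2) g.
Proof.
move=> D1 D2 Om eps gt J oOm cOm eps0 [hgt Cgt g0 gout] orth act.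
have [[[[hE hX hEta hF] hg hfg hxi] dEta] kill] := hM.
have eps00 : `|0 : R| < eps by rewrite normr0.
have XX p q c x : img c x -> 'D_(xi p c x) (xi q c) x = 'D_(xi q c x) (xi p c) x.
  exact: (char_commute hM).
have freeX c x : img c x -> row_free (\matrix_p xi p c x).
  by move=> cx; have [] := hF c x cx.
have gram0 p q c x : img c x -> pairing (gt 0 c x) (xi p c x) (xi q c x) = (p == q)%:R.
  by move=> cx; rewrite g0 // hxi.
have kill0 p : is_killing (gt 0) (xi p).
  (* [gt 0] agrees with [g] only on the chart images; these are open, so the derivatives agree as
     well. *)
  move=> c x cx u v; have e := derive_open_eq (xi p c x) (@img_open _ _ M c) cx (g0 c).
  have h : lie_metric (xi p c) (gt 0 c) x u v = lie_metric (xi p c) (g c) x u v.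
    by apply: lie_metric_congr; [exact: e|exact: g0].
  exact: etrans h (kill p c x cx u v).
have hout t : `|t| < eps -> forall c x, img c x -> ~ Om (param c x) -> gt t c x = gt 0 c x.
  by move=> te c x cx Omx; rewrite g0 // gout.
(* Orthogonality for [gt t] enters here; both sides are evaluated in the chart [chart_at p]. *)
have SE t p : `|t| < eps -> mutual_curvature D1 D2 (gt t) p =
    fun_of (chart_curvature m gt xi t) p.
  move=> te; have cp := img_coord (dom_chart_at p).
  have [oc CG sG pG] := metric_open_data (hgt t te) (chart_at p).
  have orthX (a i : 'I_s) y : (a < m)%N -> (m <= i)%N -> img (chart_at p) y ->
      pairing (gt t (chart_at p) y) (xi a (chart_at p) y) (xi i (chart_at p) y) = 0.
    move=> am mi cy; apply: (orth t te (chart_at p) y cy).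
      by rewrite /D1 /span_distribution (sumsmx_sup a) // genmxE.
    by rewrite /D2 /span_distribution (sumsmx_sup i) // genmxE.
  exact: (mutual_curvature_locE oc CG sG pG
    (fun a => vector_field_entries (chart_at p) (hX a))
    (fun a b y => @XX a b (chart_at p) y) orthX (@freeX (chart_at p)) cp).
have [C1 [e1 [C10 e10 e1e H1]]] :=
  @curvature_bound _ _ _ m M eps gt xi eps0 hgt Cgt hX XX freeX gram0 kill0 _ cOm.
have [C2 [e2 [C20 e20 e2e H2]]] := volume_bound eps0 hgt Cgt cOm.
(* The action at time 0 provides a volume measure of [g]. *)
have [mu0 hmu0 _] := act 0 eps00.
have mOm : measurable (Om : set (borel M)) by exact: borel_open_measurable.
have fOm : (mu0 Om < +oo)%E.
  apply: le_lt_trans (volume_compact (hgt 0 eps00) hmu0 cOm).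
  apply: le_measure; [exact/mem_set|apply/mem_set; exact: compact_measurable|].
  exact: subset_closure.
pose v := fine (mu0 Om); have v0 : 0 <= v by rewrite fine_ge0.
pose e := Num.min e1 (Num.min e2 1).
(* The constant comes from [Rintegral_compare] with [k = 1 + C2 * |t|] and bounds [C1 * |t|] and
   [C1 * t ^+ 2]; the 1 in the definition of [e] serves to bound [k] by [1 + C2]. *)
apply: (@is_derive0_quadratic _ _ ((1 + C2) * C1 * v + 2 * C2 * C1 * v) e).
  by rewrite !lt_min e10 e20 ltr01.
move=> t; rewrite !lt_min => /and3P[te1 te2 t1].
have te : `|t| < eps by exact: lt_le_trans te1 e1e.
have [mu1 hmu1 ->] := act t te.
have -> : Rintegral mu1 Om (mutual_curvature D1 D2 (gt t)) =
    Rintegral mu1 Om (fun_of (chart_curvature m gt xi t)).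
  by apply: eq_Rintegral => p _; exact: SE.
have bd p : Om p -> `|fun_of (chart_linear m gt xi t) p| <= C1 * `|t| /\
    `|fun_of (chart_curvature m gt xi t) p - fun_of (chart_linear m gt xi t) p|
      <= C1 * `|t| ^+ 2.
  by move=> Omp; apply: H1 => //; exact: subset_closure.
have mc : measurable_fun (Om : set (borel M)) (fun_of (chart_curvature m gt xi t)).
  apply: measurable_funTS; apply: borel_continuous_real.
  exact: (continuous_curvature hgt hX XX freeX te).
have ml : measurable_fun (Om : set (borel M)) (fun_of (chart_linear m gt xi t)).
  apply: measurable_funTS; apply: borel_continuous_real.
  exact: (continuous_linear hgt hX te).
have vc A : measurable (A : set (borel M)) -> A `<=` Om ->
    (mu1 A <= (1 + C2 * `|t|)%:E * mu0 A)%E /\ (mu0 A <= (1 + C2 * `|t|)%:E * mu1 A)%E.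
  move=> mA AO; apply: (H2 t te2 mu0 mu1 hmu0 hmu1 A mA).
  exact: subset_trans AO (@subset_closure _ _).
have k1 : 1 <= 1 + C2 * `|t| by rewrite lerDl mulr_ge0.
have L0 := @Rintegral_linear _ _ _ m M eps gt xi Om mu0 eps0 hgt hX gram0 kill0 oOm cOm
  hout hmu0 t te.
have h := Rintegral_compare mOm fOm k1 (fun A mA AO => (vc A mA AO).1)
  (fun A mA AO => (vc A mA AO).2) mc ml (mulr_ge0 C10 (normr_ge0 t))
  (mulr_ge0 C10 (exprn_ge0 2 (normr_ge0 t))) (fun p Op => (bd p Op).1)
  (fun p Op => (bd p Op).2) L0.
apply: le_trans h _; rewrite -/v.
move: (normr_ge0 t) (ltW t1); move: `|t| => r r0 r1.
have -> : (1 + C2 * r) * (C1 * r ^+ 2) * v + 2 * (1 + C2 * r - 1) * (C1 * r) * v =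
   ((1 + C2 * r) * C1 * v + 2 * C2 * C1 * v) * r ^+ 2 by ring.
apply: ler_wpM2r; first exact: exprn_ge0.
rewrite lerD2r; apply: ler_wpM2r => //; apply: ler_wpM2r => //.
by rewrite lerD2l ler_piMr.
Qed.
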